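(* Let $\Omega\subset\mathbb{R}^2$ be a bounded polygonal domain, let $(q,u,\phi)\in Q\times Q\times V$ be the optimal control, optimal state and adjoint state of the fourth order Dirichlet control problem described in the context, and let $(q_h,u_h,\phi_h)\in Q_h\times Q_h\times V_h$ be the solution of its quadratic $C^0$-interior penalty discretization described in the context. For $T\in\mathcal{T}_h$ set $\eta_{1,T}=h_T^2\|f\|_T$ and $\eta_{2,T}=h_T^2\|u_h-u_d\|_T$. For $e\in\mathcal{E}_h^i$ set $\eta_{3,e}=|e|^{1/2}\|[[\Delta q_h]]\|_e$, $\eta_{4,e}=|e|^{1/2}\|[[\Delta u_h]]\|_e$, $\eta_{5,e}=|e|^{1/2}\|[[\Delta\phi_h]]\|_e$. For $e\in\mathcal{E}_h$ set $\eta_{6,e}=|e|^{-1/2}\|[[\partial q_h/\partial n]]\|_e$, $\eta_{7,e}=|e|^{-1/2}\|[[\partial u_h/\partial n]]\|_e$, $\eta_{8,e}=|e|^{-1/2}\|[[\partial\phi_h/\partial n]]\|_e$. Then there is a constant $C>0$, independent of the mesh parameter $h$, such that for all $T\in\mathcal{T}_h$ $$\eta_{1,T}\le C\big(h_T^2\|f-\bar f\|_T+\|\Delta(u-u_h)\|_T\big),$$ $$\eta_{2,T}\le C\big(h_T^2\|u_d-\bar u_d\|_T+h_T^2\|u-u_h\|_T+\|\Delta(\phi-\phi_h)\|_T\big);$$ for all $e\in\mathcal{E}_h^i$ $$\eta_{3,e}\le C\sum_{T\in\mathcal{T}_e}\|\Delta(q-q_h)\|_T,$$ $$\eta_{4,e}\le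 C\sum_{T\in\mathcal{T}_e}\big(\|\Delta(u-u_h)\|_T+h_T^2\|f\|_T\big),$$ $$\eta_{5,e}\le C\sum_{T\in\mathcal{T}_e}\big(\|\Delta(\phi-\phi_h)\|_T+h_T^2\|u-u_h\|_T+h_T^2\|u_d-\bar u_d\|_T\big);$$ and for all $e\in\mathcal{E}_h$ $$\eta_{6,e}\le C\|q-q_h\|_h,\qquad \eta_{7,e}\le C\|u-u_h\|_h,\qquad \eta_{8,e}\le C\|\phi-\phi_h\|_h .$$
   Context: **Continuous problem.** $n$ is the outward unit normal to $\partial\Omega$; $(\cdot,\cdot)$, $\|\cdot\|$ are the $L_2(\Omega)$ inner product and norm, and $\|\cdot\|_S$ is the $L_2(S)$ norm. Let $\alpha>0$, $f,u_d\in L_2(\Omega)$, $Q=\{p\in H^2(\Omega):\partial p/\partial n=0\text{ on }\partial\Omega\}$, $V=H^2_0(\Omega)$, and $a(p,r)=\int_\Omega\Delta p\,\Delta r\,dx$. Control problem: minimize $\frac12\|v-u_d\|^2+\frac\alpha2|p|^2_{H^2(\Omega)}$ over $p\in Q$, where $v$ is the weak solution of $\Delta^2v=f$ in $\Omega$, $v=p$ and $\partial v/\partial n=0$ on $\partial\Omega$. It has a unique solution. The optimal control $q\in Q$, optimal state $u\in Q$ and adjoint state $\phi\in V$ form the unique triple satisfying - $u=u_f+q$ with $u_f\in V$ and $a(u_f,v)=(f,v)-a(q,v)$ for all $v\in V$; - $a(\phi,v)=(u-u_d,v)$ for all $v\in V$; - $\alpha a(q,p)=a(p,\phi)-(u-u_d,p)$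 for all $p\in Q$. **Mesh.** $\mathcal{T}_h$ is a simplicial, shape-regular triangulation of $\Omega$ (from a shape-regular family), $h_T$ is the diameter of $T\in\mathcal{T}_h$ and $h=\max_Th_T$. $\mathcal{E}_h=\mathcal{E}_h^i\cup\mathcal{E}_h^b$ is the set of edges (interior and boundary) and $|e|$ is the length of $e$. For $e\in\mathcal{E}_h^i$, $\mathcal{T}_e$ is the set of triangles sharing the edge $e$. For $g\in L_2(\Omega)$, $\bar g$ is the $L_2$-projection onto piecewise constants, $\bar g|_T=\frac1{|T|}\int_Tg\,dx$. $P_2(T)$ is the space of polynomials of degree at most 2 on $T$. $V_h=\{v_h\in H^1_0(\Omega):v_h|_T\in P_2(T)\ \forall T\}$ and $Q_h=\{p_h\in H^1(\Omega):p_h|_T\in P_2(T)\ \forall T\}$. **Jumps and averages.** For $e=\partial T_+\cap\partial T_-\in\mathcal{E}_h^i$, let $n_\pm$ be the unit normal on $e$ pointing out of $T_\pm$, and set $[[\partial v/\partial n]]=-(\nabla v_+\cdot n_++\nabla v_-\cdot n_-)$, $\{\{\Delta v\}\}=\frac12(\Delta v_++\Delta v_-)$ and $[[\Delta v]]=\Delta v_+-\Delta v_-$, where $v_\pm=v|_{T_\pm}$. For $e\in\mathcal{E}_h^b$ with outward unit normal $n_e$, set $[[\partial v/\partial n]]=-\nabla v\cdot n_e$ and $\{\{\Delta v\}\}=\Delta v$. **Discrete form and norm.** $$a_h(p_h,r_h)=\sum_{T}\int_T\Delta p_h\Delta r_h\,dx+\sum_{e\in\mathcal{E}_h}\int_e\{\{\Delta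 p_h\}\}[[\partial r_h/\partial n]]\,ds+\sum_{e\in\mathcal{E}_h}\int_e\{\{\Delta r_h\}\}[[\partial p_h/\partial n]]\,ds+\sum_{e\in\mathcal{E}_h}\frac{\sigma}{|e|}\int_e[[\partial p_h/\partial n]][[\partial r_h/\partial n]]\,ds,$$ and $\|v\|_h^2=\sum_T\|\Delta v\|_T^2+\sum_{e\in\mathcal{E}_h}\frac{\sigma}{|e|}\|[[\partial v/\partial n]]\|_e^2$ (used for functions in $H^2(\Omega)+Q_h$). The penalty parameter $\sigma\ge1$ is fixed and such that $a_h$ is coercive and bounded on $Q_h$ with respect to $\|\cdot\|_h$, with constants independent of $h$. **Discrete problem.** $(q_h,u_h,\phi_h)\in Q_h\times Q_h\times V_h$ is the unique solution of - $u_h=u_f^h+q_h$ with $u_f^h\in V_h$ and $a_h(u_f^h,v_h)=(f,v_h)-a_h(q_h,v_h)$ for all $v_h\in V_h$; - $a_h(\phi_h,v_h)=(u_h-u_d,v_h)$ for all $v_h\in V_h$; - $\alpha a_h(q_h,p_h)=a_h(\phi_h,p_h)-(u_h-u_d,p_h)$ for all $p_h\in Q_h$. *)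

(* Defs.v *)
From HB Require Import structures.
From mathcomp Require Import all_boot all_order all_algebra all_fingroup.
From mathcomp Require Import all_classical all_reals all_analysis.

Set Implicit Arguments.
Unset Strict Implicit.
Unset Printing Implicit Defensive.

Import Order.TTheory GRing.Theory Num.Theory.
Import numFieldNormedType.Exports.

Local Open Scope classical_set_scope.
Local Open Scope ring_scope.

Notation plane R := (R * R)%type.

Section Plane.
Variable R : realType.
Implicit Types (x y a b n : plane R) (A : set (plane R)).

Definition dot x y : R := x.1 * y.1 + x.2 * y.2.

(* The library norm on R * R is the sup norm, hence the explicit distance. *)
Definition edist x y : R := Num.sqrt (dot (x - y) (x - y)).

Definition diam A : R := sup [set edist p.1 p.2 | p in A `*` A].

Definition param a b (t : R) : plane R := a + t *: (b - a).

Definition segment a b : set (plane R) := param a b @` `[0, 1].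

Definition unit_normal a b : plane R :=
  (edist a b)^-1 *: ((b - a).2, - (b - a).1).

(* The boundary of [O] is a finite disjoint union of simple closed polygons
   (the cycles of the permutation [s]), and [O] lies on one side of it. *)
Definition polygonal_domain (O : set (plane R)) : Prop :=
  [/\ open O, connected O, O !=set0, bounded_set O &
   interior (closure O) = O /\
   exists m (A : 'I_m -> plane R) (s : 'S_m),
     let side i := segment (A i) (A (s i)) in
     [/\ injective A, (forall i, s i != i),
         (forall i j, i != j -> side i `&` side j `<=`
            [set A i; A (s i)] `&` [set A j; A (s j)])
       & closure O `\` O = \bigcup_i side i]].

End Plane.

(* Elements of L_2 and of the Sobolev spaces are represented by functions on
   the plane, of which only the values almost everywhere on the relevant open
   set (or segment) matter. *)
Section Lebesgue.
Variable R : realType.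
Implicit Types (O : set (plane R)) (f g v w : plane R -> R) (a b : plane R).

Definition mu2 := ((@lebesgue_measure R) \x (@lebesgue_measure R))%E.

Definition L2 O f : Prop :=
  measurable_fun O f /\ (\int[mu2]_(x in O) ((f x) ^+ 2)%:E < +oo)%E.

Definition inner O f g : R := \int[mu2]_(x in O) (f x * g x).

Definition norm2 O f : R := Num.sqrt (inner O f f).

Definition ae_eq_on O f g : Prop := {ae mu2, forall x, O x -> f x = g x}.

Definition area O : R := fine (mu2 O).

Definition mean O f : R := (area O)^-1 * \int[mu2]_(x in O) f x.

(* Arc length on the segment [a, b] *)
Definition seg_int a b f : R :=
  edist a b * \int[lebesgue_measure]_(t in `[0%R, 1%R]) f (param a b t).

Definition seg_norm a b f : R := Num.sqrt (seg_int a b (fun x => f x ^+ 2)).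

Definition seg_L2 a b f : Prop :=
  measurable_fun (`[0, 1] : set R) (f \o param a b) /\
  (\int[lebesgue_measure]_(t in `[0%R, 1%R])
     ((f (param a b t)) ^+ 2)%:E < +oo)%E.

End Lebesgue.

Section Sobolev.
Variable R : realType.
Implicit Types (O : set (plane R)) (f g v w : plane R -> R) (a b n : plane R).

(* Direction [false] is x_1 and [true] is x_2. *)
Definition axis (i : bool) : plane R := if i then (0, 1) else (1, 0).

Definition pderiv (i : bool) f : plane R -> R := fun x => 'D_(axis i) f x.

Fixpoint Ck (k : nat) f : Prop :=
  continuous f /\
  if k is k'.+1 then
    forall i, (forall x, derivable f x (axis i)) /\ Ck k' (pderiv i f)
  else True.

Definition smooth f : Prop := forall k, Ck k f.

Definition test_function O f : Prop :=
  smooth f /\ exists K, [/\ compact K, K `<=` O & forall x, ~ K x -> f x = 0].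

Definition is_wderiv O (i : bool) w g : Prop :=
  L2 O w /\ L2 O g /\
  forall psi, test_function O psi ->
    inner O w (pderiv i psi) = - inner O g psi.

Definition wderiv O (i : bool) w : plane R -> R :=
  xget (cst 0) [set g | is_wderiv O i w g].

Definition wlap O w : plane R -> R :=
  fun x => \sum_(i : bool) wderiv O i (wderiv O i w) x.

(* grad w . n, for a constant vector n *)
Definition nderiv O n w : plane R -> R :=
  fun x => dot (wderiv O false w x, wderiv O true w x) n.

Definition H1 O w : Prop := L2 O w /\ forall i, exists g, is_wderiv O i w g.

Definition H2 O w : Prop := H1 O w /\ forall i, H1 O (wderiv O i w).

Definition H1_norm O w : R :=
  Num.sqrt (norm2 O w ^+ 2 + \sum_(i : bool) norm2 O (wderiv O i w) ^+ 2).

Definition H2_seminorm O w : R :=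
  Num.sqrt (\sum_(i : bool) \sum_(j : bool)
              norm2 O (wderiv O i (wderiv O j w)) ^+ 2).

Definition H2_norm O w : R :=
  Num.sqrt (H1_norm O w ^+ 2 + H2_seminorm O w ^+ 2).

Definition H10 O w : Prop :=
  H1 O w /\ exists psi : nat -> plane R -> R,
    (forall k, test_function O (psi k)) /\
    H1_norm O (w \- psi k) @[k --> \oo] --> (0 : R).

Definition H20 O w : Prop :=
  H2 O w /\ exists psi : nat -> plane R -> R,
    (forall k, test_function O (psi k)) /\
    H2_norm O (w \- psi k) @[k --> \oo] --> (0 : R).

(* [g] is the trace on the boundary segment [a, b] of [w] in H^1(O): the
   continuous extension of the restriction of functions smooth up to the
   boundary. *)
Definition is_trace O a b w g : Prop :=
  [/\ H1 O w, seg_L2 a b g & exists psi : nat -> plane R -> R,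
    [/\ forall k, smooth (psi k),
        H1_norm O (w \- psi k) @[k --> \oo] --> (0 : R)
      & seg_norm a b (g \- psi k) @[k --> \oo] --> (0 : R)]].

Definition trace O a b w : plane R -> R :=
  xget (cst 0) [set g | is_trace O a b w g].

End Sobolev.

Section Continuous.
Variable R : realType.
Implicit Types (O : set (plane R)) (f ud p q r u v phi : plane R -> R).

(* The sign of the normal is irrelevant for a vanishing normal derivative. *)
Definition Qspace O p : Prop :=
  H2 O p /\ forall a b : plane R, a != b -> segment a b `<=` closure O `\` O ->
    is_trace O a b (nderiv O (unit_normal a b) p) (cst 0).

Definition Vspace O v : Prop := H20 O v.

Definition abil O p r : R := inner O (wlap O p) (wlap O r).

(* [v] is the weak solution of Delta^2 v = f with v = p and dv/dn = 0 on the
   boundary, for p in Q; it is p plus an element of V. *)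
Definition weak_state O f p v : Prop :=
  Vspace O (v \- p) /\ forall w, Vspace O w -> abil O v w = inner O f w.

Definition cost O (alpha : R) ud p v : R :=
  2^-1 * norm2 O (v \- ud) ^+ 2 + alpha / 2 * H2_seminorm O p ^+ 2.

Definition optimal_control O (alpha : R) f ud q u : Prop :=
  [/\ Qspace O q, weak_state O f q u &
      forall p v, Qspace O p -> weak_state O f p v ->
        cost O alpha ud q u <= cost O alpha ud p v].

(* Here u_f = u - q. *)
Definition optimality_system O (alpha : R) f ud q u phi : Prop :=
  [/\ Vspace O (u \- q) /\ (forall v, Vspace O v ->
        abil O (u \- q) v = inner O f v - abil O q v),
      forall v, Vspace O v -> abil O phi v = inner O (u \- ud) v
    & forall p, Qspace O p ->
        alpha * abil O q p = abil O p phi - inner O (u \- ud) p].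

End Continuous.

Record mesh (R : realType) := Mesh {
  nvert : nat;
  vert : 'I_nvert -> plane R;
  triangles : {set {set 'I_nvert}} }.

Section MeshGeometry.
Variables (R : realType) (M : mesh R).
Local Notation I := ('I_(nvert M)).
Implicit Types (S T : {set I}) (e : I * I).

Definition hull S : set (plane R) :=
  [set x | exists l : I -> R, [/\ forall i, 0 <= l i, \sum_(i in S) l i = 1
                                & x = \sum_(i in S) l i *: vert i]].

(* the open triangle *)
Definition cell T : set (plane R) := interior (hull T).

Definition is_triangulation (O : set (plane R)) : Prop :=
  [/\ injective (@vert R M),
      (forall T, T \in triangles M -> #|T| = 3%N /\ cell T !=set0),
      (forall T1 T2, T1 \in triangles M -> T2 \in triangles M ->
         hull T1 `&` hull T2 = hull (T1 :&: T2))
    & closure O = \bigcup_(T in [set` triangles M]) hull T].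

Definition hT T : R := diam (hull T).

Definition shape_regular (kappa : R) : Prop :=
  forall T, T \in triangles M ->
    exists x, [set y | edist x y <= hT T / kappa] `<=` hull T.

(* An edge is given by its end points in increasing order of index. *)
Definition edge_triangles e : {set {set I}} :=
  [set T in triangles M | (e.1 \in T) && (e.2 \in T)].

Definition edges : {set I * I} :=
  [set e : I * I | ((e.1 < e.2)%N) && (edge_triangles e != finset.set0)].

Definition interior_edges : {set I * I} :=
  [set e in edges | #|edge_triangles e| == 2].

Definition elen e : R := edist (vert e.1) (vert e.2).

(* The sum below only involves the vertex of [T] opposite to [e]. *)
Definition outward_normal T e : plane R :=
  let n := unit_normal (vert e.1) (vert e.2) in
  - Num.sg (\sum_(i in T) dot n (vert i - vert e.1)) *: n.

End MeshGeometry.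

Section Discretization.
Variables (R : realType) (M : mesh R).
Local Notation I := ('I_(nvert M)).
Implicit Types (T : {set I}) (e : I * I) (v p r f ud : plane R -> R).

Definition eint e f : R := seg_int (vert e.1) (vert e.2) f.

Definition enorm e f : R := seg_norm (vert e.1) (vert e.2) f.

(* trace on [e] from inside [T] *)
Definition etrace T e f : plane R -> R :=
  trace (cell T) (vert e.1) (vert e.2) f.

(* Sum over the one or two triangles containing [e], hence both the interior
   and the boundary case. *)
Definition jump_dn e v : plane R -> R :=
  fun x => - \sum_(T in edge_triangles e)
               etrace T e (nderiv (cell T) (outward_normal T e) v) x.

Definition avg_lap e v : plane R -> R :=
  fun x => (#|edge_triangles e|%:R)^-1 *
           \sum_(T in edge_triangles e) etrace T e (wlap (cell T) v) x.

(* For interior edges; T_+ and T_- are taken in enumeration order. *)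
Definition jump_lap e v : plane R -> R :=
  let Tplus := nth finset.set0 (enum (edge_triangles e)) 0 in
  let Tminus := nth finset.set0 (enum (edge_triangles e)) 1 in
  fun x => etrace Tplus e (wlap (cell Tplus) v) x
           - etrace Tminus e (wlap (cell Tminus) v) x.

Definition quadratic (p : plane R -> R) : Prop :=
  exists c0 c1 c2 c3 c4 c5 : R, forall x, p x =
    c0 + c1 * x.1 + c2 * x.2
    + c3 * x.1 ^+ 2 + c4 * (x.1 * x.2) + c5 * x.2 ^+ 2.

Definition piecewise_P2 p : Prop :=
  forall T, T \in triangles M ->
    exists2 g, quadratic g & ae_eq_on (cell T) p g.

Definition Qh (O : set (plane R)) p : Prop := H1 O p /\ piecewise_P2 p.

Definition Vh (O : set (plane R)) p : Prop := H10 O p /\ piecewise_P2 p.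

Definition ah (sigma : R) p r : R :=
  \sum_(T in triangles M) inner (cell T) (wlap (cell T) p) (wlap (cell T) r)
  + \sum_(e in edges M) eint e (fun x => avg_lap e p x * jump_dn e r x)
  + \sum_(e in edges M) eint e (fun x => avg_lap e r x * jump_dn e p x)
  + \sum_(e in edges M) sigma / elen e *
      eint e (fun x => jump_dn e p x * jump_dn e r x).

Definition hnorm (sigma : R) v : R :=
  Num.sqrt (\sum_(T in triangles M) norm2 (cell T) (wlap (cell T) v) ^+ 2
    + \sum_(e in edges M) sigma / elen e * enorm e (jump_dn e v) ^+ 2).

(* Here u_f^h = u_h - q_h. *)
Definition discrete_system (O : set (plane R)) (alpha sigma : R) f ud
    (qh uh phih : plane R -> R) : Prop :=
  [/\ Vh O (uh \- qh) /\ (forall v, Vh O v ->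
        ah sigma (uh \- qh) v = inner O f v - ah sigma qh v),
      forall v, Vh O v -> ah sigma phih v = inner O (uh \- ud) v
    & forall p, Qh O p ->
        alpha * ah sigma qh p = ah sigma phih p - inner O (uh \- ud) p].

Definition eta1 f T : R := hT T ^+ 2 * norm2 (cell T) f.
Definition eta2 uh ud T : R := hT T ^+ 2 * norm2 (cell T) (uh \- ud).
(* eta_3, eta_4, eta_5, for q_h, u_h, phi_h *)
Definition eta_lap v e : R := Num.sqrt (elen e) * enorm e (jump_lap e v).
(* eta_6, eta_7, eta_8, for q_h, u_h, phi_h *)
Definition eta_dn v e : R := (Num.sqrt (elen e))^-1 * enorm e (jump_dn e v).

(* ||Delta v||_T for v piecewise in H^2 *)
Definition lap_norm T v : R := norm2 (cell T) (wlap (cell T) v).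

(* ||g - mean of g over T||_T *)
Definition osc T (g : plane R -> R) : R :=
  norm2 (cell T) (fun x => g x - mean (cell T) g).

End Discretization.

Definition shape_regular_family (R : realType) (O : set (plane R))
    (F : set (mesh R)) : Prop :=
  exists2 kappa : R, 0 < kappa &
    forall M, F M -> is_triangulation M O /\ shape_regular M kappa.

Definition coercive_bounded (R : realType) (O : set (plane R))
    (F : set (mesh R)) (sigma : R) : Prop :=
  exists c1 c2 : R, 0 < c1 /\ forall M, F M ->
    (forall p, Qh M O p -> c1 * hnorm M sigma p ^+ 2 <= ah M sigma p p) /\
    (forall p r, Qh M O p -> Qh M O r ->
       `|ah M sigma p r| <= c2 * hnorm M sigma p * hnorm M sigma r).

(* Main.v *)
From HB Require Import structures.
From mathcomp Require Import all_boot all_order all_algebra all_fingroup.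
From mathcomp Require Import all_classical all_reals all_analysis.
From mathcomp Require Import measurable_realfun.
From mathcomp Require Import ring lra.
Require Import Defs.

(** The estimates are local efficiency bounds: the equations of the exact
    functions are tested with functions supported near one triangle or edge,
    where the discrete functions are so simple that their residuals can be read
    off, their Laplacian being constant on each triangle.

    The state, the adjoint state and the control are weak solutions [w] of
    biharmonic equations with right-hand sides [G] equal to [f], [u - ud] and
    [0]. For the control this follows from the third optimality condition: for
    test functions in V, the adjoint equation cancels its right-hand side.
    Testing the equation of [w] only with smooth compactly supported functions
    [psi] gives, for a discrete function [wh] approximating [w], two bounds.

    - If [psi] is supported in a triangle, the constant Laplacian of [wh] is
      orthogonal to that of [psi], and the pairing of [G] with [psi] equals
      that of the Laplacian of [w - wh] with the Laplacian of [psi]. A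
      quadratic function on a triangle is recovered from its pairings with
      tensor products of bumps in the inscribed disc, which bounds the best
      quadratic substitute for [G] ([bubble_estimate], [element_residual]).
      This gives the first two estimators.

    - If [psi] is supported in a disc around the midpoint of an interior edge,
      and its Laplacian has integral [K] over one of the two triangles, then the
      integral over the other is [- K], and the pairing of the piecewise constant
      Laplacian of [wh] with that of [psi] is [K] times the jump. A function odd
      across the edge has [K != 0] ([half_plane_lap], [edge_residual]). This
      gives the third, fourth and fifth estimators; for the fifth, the second
      one bounds the part [uh - ud] of the right-hand side.

    The last three estimators measure jumps of normal derivatives, and here the
    point is that the exact functions have none ([normal_trace]), so that the
    jump of the discrete function is that of the error and is one of the terms
    of the mesh-dependent norm ([dn_jump_eq], [eta_dn_le]). A function in Q has,
    by definition, a trace of its normal derivative on each side of the polygon.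
    Having a trace includes being a limit in H^1 of functions smooth on the
    whole plane; since two sides are not parallel ([nonparallel_sides]), both
    partial derivatives are such limits ([Qspace_approximable]), and such limits
    have the same trace from both triangles of an interior edge
    ([common_trace]). Functions in V belong to Q ([Vspace_Qspace]).

    Underneath are the uniqueness of weak derivatives, by the fundamental lemma
    of the calculus of variations, and existence and uniqueness of traces on the
    sides of triangles, by a trace inequality and the completeness of L_2. The
    geometry of the mesh enters mainly through one fact: around the midpoint of an
    edge, the half disc of radius [|e| / kappa] on the inner side of a triangle
    is contained in it ([half_disc]). This places the test functions, shows that
    two triangles at an edge are on opposite sides of it, and that an edge of
    only one triangle is on the boundary. All constants depend on the
    shape-regularity constant [kappa] only. *)

Set Implicit Arguments.
Unset Strict Implicit.
Unset Printing Implicit Defensive.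

Import Order.TTheory GRing.Theory Num.Theory.
Import numFieldNormedType.Exports.

Local Open Scope classical_set_scope.
Local Open Scope ring_scope.

Local Notation leb1 R := (@lebesgue_measure R).
Local Notation leb2 R := ((@lebesgue_measure R) \x (@lebesgue_measure R))%E.

(** * Affine changes of variables and open sets of the plane *)

Section Affine.
Variable R : realType.
Local Notation leb := (@lebesgue_measure R).
Implicit Types (f : measurableTypeR R -> \bar R) (c d : R).

Lemma measurable_affine c d : measurable_fun setT (fun x : measurableTypeR R => c * x + d : measurableTypeR R).
Proof. by apply: measurable_funD => //; apply: measurable_funM. Qed.

Lemma lebesgue_measure_affine c d (A : set R) : c != 0 -> measurable A ->
  leb ((fun x => c * x + d) @^-1` A) = (`|c|^-1%:E * leb A)%E.
Proof.
move=> c0 mA.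
have cn : 0 <= `|c| by [].
pose m' : {measure set (measurableTypeR R) -> \bar R} := mscale (NngNum cn)
  (measure_function_pushforward__canonical__measure_function_Measure leb (measurable_affine c d)).
have H : leb A = m' A.
  apply: lebesgue_measure_unique => //= _ [[a b]] _ <-.
  rewrite /m' /mscale /= /pushforward.
  have [c_gt0|c_lt0|/eqP] := ltgtP 0 c; last by rewrite eq_sym (negbTE c0).
  - rewrite (_ : _ @^-1` _ = `](a - d) / c, (b - d) / c]%classic); last first.
      apply/seteqP; split=> x /=; rewrite !in_itv/= ltr_pdivrMr// ler_pdivlMr//; lra.
    rewrite !lebesgue_measure_itv/= !lte_fin ltr_pM2r ?invr_gt0// ltrD2r.
    case: ifP => _; rewrite ?mule0// -EFinD -EFinM gtr0_norm//; congr EFin; field.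
    exact: lt0r_neq0.
  - rewrite (_ : _ @^-1` _ = `[(b - d) / c, (a - d) / c[%classic); last first.
      apply/seteqP; split=> x /=; rewrite !in_itv/= ler_ndivrMr// ltr_ndivlMr//; lra.
    rewrite !lebesgue_measure_itv/= !lte_fin ltr_nM2r ?invr_lt0// ltrD2r.
    case: ifP => _; rewrite ?mule0// -EFinD -EFinM ltr0_norm//; congr EFin; field.
    exact: ltr0_neq0.
by rewrite H /m' /mscale /= /pushforward /= muleA -EFinM mulVf ?normr_eq0// mul1e. 
Qed.

Lemma ge0_integral_affine f c d : c != 0 -> measurable_fun setT f -> (forall x, 0 <= f x)%E ->
  (\int[leb]_x f (c * x + d)%R = `|c|^-1%:E * \int[leb]_x f x)%E.
Proof.
move=> c0 mf f0.
have cn : 0 <= `|c|^-1 by rewrite invr_ge0.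
rewrite -(ge0_integral_mscale _ _ (NngNum cn))//.
have := @ge0_integral_pushforward _ _ _ _ R _ (measurable_affine c d) leb setT f measurableT mf (fun x _ => f0 x).
rewrite preimage_setT => <-.
apply: eq_measure_integral => [|? A mA _]; first exact: measurable_affine.
rewrite /mscale /= /pushforward; exact: lebesgue_measure_affine.
Qed.

Local Notation mplane := (measurableTypeR R * measurableTypeR R)%type.

Lemma ge0_integral_swap (f : mplane -> \bar R) :
  measurable_fun setT f -> (forall x, 0 <= f x)%E ->
  (\int[leb2 R]_x f (x.2, x.1) = \int[leb2 R]_x f x)%E.
Proof.
move=> mf f0; rewrite fubini_tonelli1//; last first.
  by apply: measurableT_comp => //; apply: measurable_fun_pair.
by rewrite fubini_tonelli2.
Qed.

Lemma measurable_affine2 (k l m : R) :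
  measurable_fun setT (fun x : mplane => k + l * x.1 + m * x.2 : measurableTypeR R).
Proof.
apply: measurable_funD; first apply: measurable_funD => //;
  by apply: measurable_funM => //; (exact: measurable_fst || exact: measurable_snd).
Qed.

(** When [a != 0] the affine map is composed of two maps that change only one
    coordinate, and each of them is a one-dimensional affine substitution in the
    inner integral of Tonelli's theorem. *)
Lemma ge0_integral_affine2_aux (f : mplane -> \bar R) (p1 p2 a b c d : R) :
  a != 0 -> a * d - b * c != 0 ->
  measurable_fun setT f -> (forall x, 0 <= f x)%E ->
  (\int[leb2 R]_x f (p1 + a * x.1 + b * x.2, p2 + c * x.1 + d * x.2)%R
   = `|a * d - b * c|^-1%:E * \int[leb2 R]_x f x)%E.
Proof.
move=> a0 D0 mf f0.
pose e s := p2 + c / a * (s - p1).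
pose g (x : mplane) := f (x.1, (a * d - b * c) / a * x.2 + e x.1).
have mg : measurable_fun setT g.
  apply: measurableT_comp => //; apply: measurable_fun_pair => //.
  rewrite (_ : (fun _ => _) = (fun x : mplane => (p2 - c / a * p1) + c / a * x.1
    + (a * d - b * c) / a * x.2)); first exact: measurable_affine2.
  by apply/funext => x; rewrite /e; ring.
have g0 x : (0 <= g x)%E by exact: f0.
have mh : measurable_fun setT (fun x : mplane => f (p1 + a * x.1 + b * x.2, p2 + c * x.1 + d * x.2)).
  by apply: measurableT_comp => //; apply: measurable_fun_pair; exact: measurable_affine2.
rewrite fubini_tonelli2// /fubini_G.
have fg (s t : R) : f (p1 + a * s + b * t, p2 + c * s + d * t) = g (a * s + (p1 + b * t), t).
  by rewrite /g; congr (f (_, _)); rewrite /e /=; [ring|field].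
transitivity (\int[leb]_t (`|a|^-1%:E * fubini_G leb g t))%E.
  apply: eq_integral => t _ /=.
  rewrite -(@ge0_integral_affine (fun s => g (s, t)) _ (p1 + b * t) a0)//.
    by apply: eq_integral => s _; exact: fg.
  exact: (measurableT_comp mg).
rewrite ge0_integralZl_EFin//=.
- rewrite -fubini_tonelli2// fubini_tonelli1//.
  have -> : (\int[leb]_s fubini_F leb g s =
      \int[leb]_s (`|(a * d - b * c) / a|^-1%:E * fubini_F leb f s))%E.
    apply: eq_integral => s _ /=.
    rewrite -(@ge0_integral_affine (fun t => f (s, t)) _ (e s))//.
    + by rewrite mulf_neq0// invr_eq0.
    + exact: (measurableT_comp mf).
  rewrite ge0_integralZl_EFin//=.
  + rewrite muleA -EFinM -fubini_tonelli1//.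
    congr (_ * _)%E; congr EFin; rewrite normrM normfV; field; by rewrite !normr_eq0 a0 D0.
  + by move=> x _; apply: integral_ge0.
  + exact: (measurable_fun_fubini_tonelli_F f).
- by move=> x _; apply: integral_ge0.
- exact: (measurable_fun_fubini_tonelli_G g).
Qed.

(** If [a = 0], the determinant forces [b != 0], and exchanging the variables
    reduces to the previous case. *)
Lemma ge0_integral_affine2 (f : mplane -> \bar R) (p1 p2 a b c d : R) :
  a * d - b * c != 0 -> measurable_fun setT f -> (forall x, 0 <= f x)%E ->
  (\int[leb2 R]_x f (p1 + a * x.1 + b * x.2, p2 + c * x.1 + d * x.2)%R
   = `|a * d - b * c|^-1%:E * \int[leb2 R]_x f x)%E.
Proof.
move=> D0 mf f0; have [a0|a0] := eqVneq a 0; last exact: ge0_integral_affine2_aux.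
have b0 : b != 0 by apply: contra_neq D0 => b0; rewrite a0 b0; ring.
have D0' : b * c - a * d != 0 by rewrite -opprB oppr_eq0.
pose h (x : mplane) := f (p1 + b * x.1 + a * x.2, p2 + d * x.1 + c * x.2).
have mh : measurable_fun setT h.
  by apply: measurableT_comp => //; apply: measurable_fun_pair; exact: measurable_affine2.
transitivity (\int[leb2 R]_x h (x.2, x.1))%E.
  by apply: eq_integral => x _; rewrite /h /= addrAC [X in (_, X)]addrAC.
have h0 x : (0 <= h x)%E by exact: f0.
rewrite (ge0_integral_swap mh h0) distrC.
exact: ge0_integral_affine2_aux.
Qed.
End Affine.
Section PlaneTopology.
Variable R : realType.
Implicit Types (x y : plane R) (a b c d : R).

Definition orect a b c d : set (plane R) := `]a, b[%classic `*` `]c, d[%classic.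
Definition crect a b c d : set (plane R) := `[a, b]%classic `*` `[c, d]%classic.

Lemma orect_sub a b c d : orect a b c d `<=` crect a b c d.
Proof.
by move=> x [/= x1 x2]; split=> /=; apply: subset_itv_oo_cc.
Qed.

Lemma compact_crect a b c d : compact (crect a b c d).
Proof. by apply: compact_setX; exact: segment_compact. Qed.

Lemma measurable_orect a b c d : measurable (orect a b c d).
Proof. exact: measurableX. Qed.

Lemma measurable_crect a b c d : measurable (crect a b c d).
Proof. exact: measurableX. Qed.

Lemma nbhs_planeP x (A : set (plane R)) : nbhs x A <->
  exists2 e : R, 0 < e & forall y, `|y.1 - x.1| < e -> `|y.2 - x.2| < e -> A y.
Proof.
split=> [/nbhs_ballP[e /= e0 eA]|[e e0 eA]].
  exists e => // y y1 y2; apply: eA.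
  by split; rewrite /ball /= distrC.
apply/nbhs_ballP; exists e => //= y [y1 y2].
by apply: eA; rewrite distrC.
Qed.

Lemma open_planeP (A : set (plane R)) : open A <-> forall x, A x ->
  exists2 e : R, 0 < e & forall y, `|y.1 - x.1| < e -> `|y.2 - x.2| < e -> A y.
Proof.
rewrite openE; split=> [oA x /oA/nbhs_planeP//|H x Ax]; apply/nbhs_planeP; exact: H.
Qed.

(** An open set is the countable union of these rectangles. Through them
    measurability of open sets, and vanishing almost everywhere in an open set,
    reduce to rectangles. *)
Definition rat_rect (O : set (plane R)) (n : nat) : set (plane R) :=
  if (unpickle n : option (rat * rat * rat * rat)) is Some (a, b, c, d) then
    if `[< crect (ratr a) (ratr b) (ratr c) (ratr d) `<=` O >]
    then orect (ratr a) (ratr b) (ratr c) (ratr d) else set0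
  else set0.

Lemma rat_rectP (O : set (plane R)) n : exists a b c d,
  rat_rect O n = orect a b c d /\ crect a b c d `<=` O.
Proof.
have e0 : exists a b c d, set0 = orect a b c d /\ crect a b c d `<=` O.
  exists 1, 0, 1, 0; split; last by move=> x [/= +]; rewrite in_itv/= => /andP[]; lra.
  by apply/seteqP; split=> // x [/= +]; rewrite in_itv/= => /andP[]; lra.
rewrite /rat_rect; case: unpickle => [[[[a b] c] d]|//].
case: asboolP => // H.
by exists (ratr a), (ratr b), (ratr c), (ratr d).
Qed.

Lemma bigcup_rat_rect (O : set (plane R)) : open O -> \bigcup_n rat_rect O n = O.
Proof.
move=> oO; apply/seteqP; split=> [x [n _]|x Ox].
  have [a [b [c [d [-> H]]]]] := rat_rectP O n.
  by move=> /orect_sub/H.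
have /open_planeP/(_ x Ox) [e e0 eO] := oO.
have he : 0 < e / 2 by rewrite divr_gt0.
have [a] := @rat_in_itvoo R (x.1 - e / 2) x.1 ltac:(lra).
rewrite in_itv/= => /andP[a1 a2].
have [b] := @rat_in_itvoo R x.1 (x.1 + e / 2) ltac:(lra).
rewrite in_itv/= => /andP[b1 b2].
have [c] := @rat_in_itvoo R (x.2 - e / 2) x.2 ltac:(lra).
rewrite in_itv/= => /andP[c1 c2].
have [d] := @rat_in_itvoo R x.2 (x.2 + e / 2) ltac:(lra).
rewrite in_itv/= => /andP[d1 d2].
have [n nE] : exists n, (unpickle n : option (rat * rat * rat * rat)) = Some (a, b, c, d).
  by exists (pickle (a, b, c, d)); exact: pickleK.
exists n; first exact: I.
rewrite /rat_rect nE.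
case: asboolP => [_|[]]; first by split; rewrite /= in_itv/= ?a2 ?c2 ?b1 ?d1.
move=> y [/=]; rewrite !in_itv/= => /andP[ya yb] /andP[yc yd].
by apply: eO; rewrite ltr_norml; apply/andP; split; lra.
Qed.

Lemma open_plane_measurable (O : set (plane R)) : open O -> measurable O.
Proof.
move=> /bigcup_rat_rect <-; apply: bigcupT_measurable => n.
by have [a [b [c [d [-> _]]]]] := rat_rectP O n; exact: measurable_orect.
Qed.

Lemma continuous_plane_measurable (f : plane R -> R) (D : set (plane R)) :
  measurable D -> continuous f -> measurable_fun D f.
Proof.
move=> mD cf; apply: (measurable_funS measurableT) => //.
apply: (measurability _ (RGenOInfty.measurableE R)) => //.
move=> _ [_ [a ->] <-]; rewrite setTI; apply: open_plane_measurable.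
by apply: open_comp => [x _|]; [exact: cf|exact: rray_open].
Qed.

Lemma mu2_crect_lt a b c d : (mu2 (crect a b c d) < +oo)%E.
Proof.
have lt_itv (s t : R) : (lebesgue_measure (`[s, t]%classic : set R) < +oo)%E.
  by rewrite lebesgue_measure_itv; case: ifP => _; rewrite ltry.
rewrite /mu2 product_measure1E// lte_mul_pinfty//; last exact: lt_itv.
by rewrite ge0_fin_numE//; exact: lt_itv.
Qed.

Lemma mu2_bounded_lt (A : set (plane R)) (M : R) : measurable A ->
  (forall x, A x -> `|x.1| <= M /\ `|x.2| <= M) -> (mu2 A < +oo)%E.
Proof.
move=> mA AM; apply: le_lt_trans (mu2_crect_lt (- M) M (- M) M).
apply: le_measure; rewrite ?inE//; first exact: measurable_crect.
by move=> x /AM[x1 x2]; split; rewrite /= in_itv/= -ler_norml.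
Qed.

End PlaneTopology.

(** * Square-integrable functions *)

Section SquareIntegrable.
Context d (T : measurableType d) (R : realType).
Variables (mu : {measure set T -> \bar R}) (D : set T) (mD : measurable D).
Implicit Types f g h : T -> R.

Definition sqint f : Prop :=
  measurable_fun D f /\ (\int[mu]_(x in D) ((f x) ^+ 2)%:E < +oo)%E.

Definition dotp f g : R := \int[mu]_(x in D) (f x * g x).

Definition nrm f : R := Num.sqrt (dotp f f).

Lemma sqint_integrable f : sqint f -> mu.-integrable D (EFin \o (fun x => f x ^+ 2)).
Proof.
move=> [mf foo]; apply/integrableP; split.
  by apply/measurable_EFinP; exact: measurable_funX.
rewrite (eq_integral (fun x => (f x ^+ 2)%:E))// => x _ /=.
by rewrite ger0_norm// sqr_ge0.
Qed.

Lemma sqint_integrableM f g : sqint f -> sqint g ->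
  mu.-integrable D (EFin \o (fun x => f x * g x)).
Proof.
move=> sf sg.
apply: (@le_integrable _ _ _ mu D mD _ (EFin \o (fun x => f x ^+ 2 + g x ^+ 2))).
- by apply/measurable_EFinP; apply: measurable_funM; [case: sf|case: sg].
- move=> x _ /=; rewrite lee_fin normrM [leRHS]ger0_norm ?addr_ge0 ?sqr_ge0//.
  rewrite -[f x ^+ 2]real_normK ?num_real// -[g x ^+ 2]real_normK ?num_real//.
  by have := sqr_ge0 (`|f x| - `|g x|); have := normr_ge0 (f x); have := normr_ge0 (g x); nra.
- by apply: (integrableD mD (sqint_integrable sf) (sqint_integrable sg)).
Qed.

Lemma integrable_sqint f : measurable_fun D f ->
  mu.-integrable D (EFin \o (fun x => f x ^+ 2)) -> sqint f.
Proof.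
move=> mf /integrableP[_ foo]; split=> //.
rewrite (eq_integral (fun x => `|(f x ^+ 2)%:E|)%E)// => x _ /=.
by rewrite ger0_norm// sqr_ge0.
Qed.

Lemma sqintD f g : sqint f -> sqint g -> sqint (f \+ g).
Proof.
move=> sf sg; apply: integrable_sqint.
  by apply: measurable_funD; [case: sf|case: sg].
have ifg := sqint_integrableM sf sg.
apply: (eq_integrable mD _ _ _ (integrableD mD
  (integrableD mD (sqint_integrable sf) (sqint_integrable sg)) (integrableD mD ifg ifg))).
by move=> x _ /=; rewrite -!EFinD; congr EFin; ring.
Qed.

Lemma sqintZ k f : sqint f -> sqint (fun x => k * f x).
Proof.
move=> sf; apply: integrable_sqint.
  by apply: measurable_funM => //; case: sf.
apply: (eq_integrable mD _ _ _ (integrableZl mD (k ^+ 2) (sqint_integrable sf))).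
by move=> x _ /=; rewrite exprMn.
Qed.

Lemma eq_sqint f g : (forall x, D x -> f x = g x) -> sqint f -> sqint g.
Proof.
move=> fg [mf foo]; split.
  by apply: eq_measurable_fun mf => x; rewrite inE => /fg.
by rewrite (eq_integral (fun x => (f x ^+ 2)%:E))// => x; rewrite inE => /fg ->.
Qed.

Lemma sqintB f g : sqint f -> sqint g -> sqint (f \- g).
Proof.
move=> sf /(sqintZ (-1)) /(sqintD sf); apply: eq_sqint => x _ /=.
by rewrite mulN1r.
Qed.

Lemma sqint0 : sqint (cst 0).
Proof.
split=> //; rewrite (eq_integral (cst 0%E)) ?integral0// => x _ /=.
by rewrite expr0n.
Qed.

Lemma dotpC f g : dotp f g = dotp g f.
Proof. by apply: eq_Rintegral => x _; rewrite mulrC. Qed.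

Lemma dotpDl f g h : sqint f -> sqint g -> sqint h ->
  dotp (f \+ g) h = dotp f h + dotp g h.
Proof.
move=> sf sg sh; rewrite -RintegralD//; [|exact: sqint_integrableM..].
by apply: eq_Rintegral => x _ /=; rewrite mulrDl.
Qed.

Lemma dotpZl k f h : sqint f -> sqint h -> dotp (fun x => k * f x) h = k * dotp f h.
Proof.
move=> sf sh; rewrite -RintegralZl//; last exact: sqint_integrableM.
by apply: eq_Rintegral => x _ /=; rewrite mulrA.
Qed.

Lemma dotpBl f g h : sqint f -> sqint g -> sqint h ->
  dotp (f \- g) h = dotp f h - dotp g h.
Proof.
move=> sf sg sh; rewrite -mulN1r -dotpZl// -dotpDl//; last exact: sqintZ.
by apply: eq_Rintegral => x _ /=; rewrite mulN1r.
Qed.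

Lemma dotpDr f g h : sqint f -> sqint g -> sqint h ->
  dotp f (g \+ h) = dotp f g + dotp f h.
Proof. by move=> *; rewrite dotpC dotpDl// !(dotpC f). Qed.

Lemma dotpZr k f h : sqint f -> sqint h -> dotp f (fun x => k * h x) = k * dotp f h.
Proof. by move=> *; rewrite dotpC dotpZl// (dotpC f). Qed.

Lemma dotpBr f g h : sqint f -> sqint g -> sqint h ->
  dotp f (g \- h) = dotp f g - dotp f h.
Proof. by move=> *; rewrite dotpC dotpBl// !(dotpC f). Qed.

Lemma dotp_ge0 f : 0 <= dotp f f.
Proof. by apply: Rintegral_ge0 => x _; rewrite -expr2 sqr_ge0. Qed.

Lemma nrm_ge0 f : 0 <= nrm f. Proof. exact: sqrtr_ge0. Qed.

Lemma nrm_sqr f : nrm f ^+ 2 = dotp f f.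
Proof. by rewrite sqr_sqrtr ?dotp_ge0. Qed.

Lemma cauchy_schwarz_dotp f g : sqint f -> sqint g -> `|dotp f g| <= nrm f * nrm g.
Proof.
move=> sf sg.
have quad t : 0 <= dotp f f - t * (2 * dotp f g) + t ^+ 2 * dotp g g.
  have := dotp_ge0 (f \- (fun x => t * g x)).
  have sg' := sqintZ t sg; have sh := sqintB sf sg'.
  by rewrite dotpBl// !dotpBr// dotpZl// dotpZr// dotpZl// (dotpC g f) dotpZr//; lra.
have ff := dotp_ge0 f; have gg := dotp_ge0 g.
rewrite -ler_sqr ?nnegrE ?normr_ge0 ?mulr_ge0 ?nrm_ge0//.
rewrite exprMn !nrm_sqr real_normK ?num_real//.
have [g0|g0] := eqVneq (dotp g g) 0.
  rewrite g0 mulr0; have [->|fg0] := eqVneq (dotp f g) 0; first by rewrite expr0n.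
  have := quad ((dotp f f + 1) / (2 * dotp f g)).
  by rewrite g0 mulr0 addr0 divfK ?mulf_neq0// => ?; exfalso; lra.
have {g0 gg} gg : 0 < dotp g g by rewrite lt_neqAle eq_sym g0.
have := quad (dotp f g / dotp g g).
rewrite [X in 0 <= X](_ : _ = (dotp f f * dotp g g - dotp f g ^+ 2) / dotp g g); last first.
  by field; exact: lt0r_neq0.
by rewrite pmulr_lge0 ?invr_gt0// subr_ge0.
Qed.

Lemma nrmD f g : sqint f -> sqint g -> nrm (f \+ g) <= nrm f + nrm g.
Proof.
move=> sf sg; rewrite -ler_sqr ?nnegrE ?addr_ge0 ?nrm_ge0//.
have sfg := sqintD sf sg.
rewrite sqrrD !nrm_sqr dotpDl// !dotpDr// (dotpC g f).
by have := cauchy_schwarz_dotp sf sg; rewrite ler_norml => /andP[_]; lra.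
Qed.

Lemma nrmZ k f : sqint f -> nrm (fun x => k * f x) = `|k| * nrm f.
Proof.
move=> sf; rewrite /nrm dotpZl//; last exact: sqintZ.
by rewrite dotpZr// mulrA -expr2 sqrtrM ?sqr_ge0// sqrtr_sqr.
Qed.

Lemma eq_dotp f f' g g' : (forall x, D x -> f x = f' x) ->
  (forall x, D x -> g x = g' x) -> dotp f g = dotp f' g'.
Proof. by move=> ff gg; apply: eq_Rintegral => x; rewrite inE => Dx; rewrite ff// gg. Qed.

Lemma eq_nrm f f' : (forall x, D x -> f x = f' x) -> nrm f = nrm f'.
Proof. by move=> ff; congr Num.sqrt; exact: eq_dotp. Qed.

Lemma nrmN f : nrm (\- f) = nrm f.
Proof. by congr Num.sqrt; apply: eq_Rintegral => x _ /=; rewrite mulrNN. Qed.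

Lemma nrmB f g : sqint f -> sqint g -> nrm (f \- g) <= nrm f + nrm g.
Proof.
move=> sf sg; rewrite -(nrmN g); apply: le_trans (nrmD _ _) => //.
by move: (sqintZ (-1) sg); apply: eq_sqint => x _; rewrite mulN1r.
Qed.

Lemma nrm_distC f g : nrm (f \- g) = nrm (g \- f).
Proof. by rewrite -nrmN; apply: eq_nrm => x _ /=; rewrite opprB. Qed.

Lemma ae_dotp f f' g g' : sqint f -> sqint f' -> sqint g -> sqint g' ->
  ae_eq mu D f f' -> ae_eq mu D g g' -> dotp f g = dotp f' g'.
Proof.
move=> [mf _] [mf' _] [mg _] [mg' _] ff gg; rewrite /dotp /Rintegral.
congr fine; apply: ae_eq_integral => //; [by apply/measurable_EFinP; exact: measurable_funM..|].
by apply: filterS2 ff gg => x /= fE gE Dx; rewrite fE// gE.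
Qed.

Lemma ae_nrm f f' : sqint f -> sqint f' -> ae_eq mu D f f' -> nrm f = nrm f'.
Proof. by move=> sf sf' ff; congr Num.sqrt; exact: ae_dotp. Qed.

Lemma nrm_eq0 f : sqint f -> nrm f = 0 -> ae_eq mu D f (cst 0).
Proof.
move=> sf f0; have := nrm_sqr f; rewrite f0 expr0n /= => /esym ff0.
have mf2 : measurable_fun D (EFin \o (fun x => f x ^+ 2)).
  by apply: measurable_int; exact: sqint_integrable.
have : (\int[mu]_(x in D) `|(EFin \o (fun x => (f x ^+ 2)%R)) x|)%E = 0%E.
  rewrite (eq_integral (EFin \o (fun x => f x ^+ 2))); last first.
    by move=> x _ /=; rewrite ger0_norm ?sqr_ge0.
  rewrite -[LHS]fineK; last by apply: integrable_fin_num; [|exact: sqint_integrable].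
  by rewrite -[fine _]/(dotp f f) ff0.
move/(ae_eq_integral_abs mu mD mf2); apply: filterS => x /= + Dx => /(_ Dx) [].
by move/eqP; rewrite sqrf_eq0 => /eqP.
Qed.

Lemma sqint_bounded f (M : R) : measurable_fun D f -> (mu D < +oo)%E ->
  (forall x, D x -> `|f x| <= M) -> sqint f /\ nrm f <= `|M| * Num.sqrt (fine (mu D)).
Proof.
move=> mf Doo fM.
have sqM x : D x -> f x ^+ 2 <= M ^+ 2.
  move=> Dx; rewrite -[f x ^+ 2]real_normK ?num_real//.
  by rewrite lerXn2r ?nnegrE ?normr_ge0 ?fM// (le_trans _ (fM x Dx)).
have iM : mu.-integrable D (EFin \o cst (M ^+ 2)).
  apply: measurable_bounded_integrable => //.
  by exists (M ^+ 2); split; [exact: num_real|move=> y My x _ /=; rewrite ger0_norm ?sqr_ge0// ltW].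
have sf : sqint f.
  apply: integrable_sqint => //; apply: le_integrable iM => //.
    by apply/measurable_EFinP; exact: measurable_funX.
  by move=> x Dx /=; rewrite lee_fin !ger0_norm ?sqr_ge0// sqM.
split=> //; rewrite -sqrtr_sqr -sqrtrM ?sqr_ge0// ler_sqrt; last first.
  by apply: mulr_ge0; [exact: sqr_ge0|exact: fine_ge0].
rewrite -(Rintegral_cst mu mD); apply: le_Rintegral => //; first exact: sqint_integrableM.
Qed.

Lemma integral_EFin_dotp f : sqint f -> (\int[mu]_(x in D) (f x ^+ 2)%:E)%E = (dotp f f)%:E.
Proof.
move=> sf; rewrite /dotp /Rintegral fineK//.
by apply: integrable_fin_num => //; exact: sqint_integrableM.
Qed.

Lemma limn_einf_le (u : nat -> R) (K : R) (n : nat) :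
  (forall m, (n <= m)%N -> u m <= K) -> (limn_einf (EFin \o u) <= K%:E)%E.
Proof.
move=> uK; rewrite limn_einf_lim; apply: lime_le; first exact: is_cvg_einfs.
exists n => // m /= nm; apply: (le_trans (y := (u m)%:E)); last by rewrite lee_fin uK.
by apply: ereal_inf_lbound; exists m => //=.
Qed.

Lemma sum_geometric_half n : \sum_(0 <= i < n) (2^-1 : R) ^+ i = 2 - 2 * 2^-1 ^+ n.
Proof.
elim: n => [|n IH]; first by rewrite big_nil expr0 mulr1 subrr.
by rewrite big_nat_recr//= IH exprS; field.
Qed.

(** Let [De n] be the increments. The series [\sum_n 2 ^+ n * De n ^+ 2] is
    integrable, hence finite almost everywhere, and it controls
    [\sum_n `|De n|] because [`|De n| <= 2^-1 ^+ n + 2 ^+ n * De n ^+ 2]. *)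
Lemma ae_cvg_fast_cauchy (f : nat -> T -> R) : (forall n, sqint (f n)) ->
  (forall n, nrm (f n.+1 \- f n) <= (2^-1) ^+ n) ->
  {ae mu, forall x, D x -> cvgn (fun n => f n x)}.
Proof.
move=> sf fast.
pose De n := f n.+1 \- f n.
have sD n : sqint (De n) by exact: sqintB.
pose u n x : \bar R := (2 ^+ n * (De n x ^+ 2 : R))%:E.
have mu_ n : measurable_fun D (u n).
  by apply/measurable_EFinP/measurable_funM => //; apply: measurable_funX; case: (sD n).
have u0 n x : D x -> (0%R <= u n x)%E.
  by move=> _; rewrite lee_fin; apply: mulr_ge0; [exact: exprn_ge0|exact: sqr_ge0].
have intu n : (\int[mu]_(x in D) u n x <= (2 / (2 ^ (n + 1))%:R)%:E)%E.
  rewrite /u; under eq_integral do rewrite EFinM.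
  rewrite ge0_integralZl_EFin//; last 2 first.
  - by move=> x _; rewrite lee_fin sqr_ge0.
  - by apply/measurable_EFinP/measurable_funX; case: (sD n).
  rewrite integral_EFin_dotp// -nrm_sqr -EFinM lee_fin addn1 expnS natrM natrX invfM mulVKf// -exprVn.
  rewrite -ler_pdivlMl ?exprn_gt0// -exprVn -expr2.
  have h0 : 0 <= (2^-1 : R) ^+ n by rewrite exprn_ge0.
  by apply: lerXn2r; rewrite ?nnegrE ?nrm_ge0//; exact: fast.
have iS : mu.-integrable D (fun x => \sum_(0 <= n <oo) u n x)%E.
  apply/integrableP; split.
    by apply: (ge0_emeasurable_sum (P := xpredT)) => // n x Dx _; exact: u0.
  rewrite (eq_integral (fun x => \sum_(0 <= n <oo) u n x)%E); last first.
    by move=> x; rewrite inE => Dx; rewrite gee0_abs// nneseries_ge0// => n _ _; exact: u0.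
  rewrite integral_nneseries//.
  apply: (@le_lt_trans _ _ (\sum_(0 <= n <oo) (2 / (2 ^ (n + 1))%:R)%:E)%E).
    by apply: lee_nneseries => n *; [apply: integral_ge0 => x Dx; exact: u0|exact: intu].
  have := @cvg_geometric_eseries_half R 2 0.
  by rewrite expr0 divr1 => /cvg_lim; rewrite /eseries => ->//; rewrite ltry.
have := integrable_ae mD iS; apply: filterS => x /= fin Dx; have {}fin := fin Dx.
pose M := fine (\sum_(0 <= n <oo) u n x)%E.
have part n : \sum_(0 <= i < n) (2 ^+ i * De i x ^+ 2) <= M.
  rewrite -lee_fin fineK// -sumEFin.
  by apply: nneseries_lim_ge => i _ _; exact: u0.
have cD : cvgn (series (fun n => De n x)).
  apply: normed_cvg; apply: (@nondecreasing_is_cvgn _ (series (fun n => `|De n x|))).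
    by move=> m n mn; rewrite -subr_ge0 sub_series_geq// sumr_ge0.
  exists (2 + M) => _ [n _ <-]; rewrite seriesEnat /=.
  apply: (@le_trans _ _ (\sum_(0 <= i < n) ((2^-1) ^+ i + 2 ^+ i * De i x ^+ 2))).
    apply: ler_sum => i _.
    have p2 : (0 : R) < 2 ^+ i by rewrite exprn_gt0.
    rewrite exprVn -[De i x ^+ 2]real_normK ?num_real//; move: (normr_ge0 (De i x)).
    move: `|De i x| => y y0.
    rewrite -(ler_pM2l p2) mulrDr divff ?lt0r_neq0//.
    by have := sqr_ge0 (2 ^+ i * y - 1); nra.
  by rewrite big_split /= lerD// sum_geometric_half lerBlDr lerDl mulr_ge0.
have -> : (fun n => f n x) = (fun n => f 0%N x + series (fun n => De n x) n).
  apply/funext => n; rewrite seriesEnat /= /De /= telescope_sumr//; ring.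
by apply: is_cvgD => //; exact: is_cvg_cst.
Qed.

Lemma nrm_diag f : nrm (f \- f) = 0.
Proof.
rewrite /nrm /dotp /Rintegral integral0_eq ?sqrtr0// => x _.
by rewrite /= subrr mulr0.
Qed.

(** The case of the Riesz-Fischer theorem to which every Cauchy sequence reduces
    by extraction. The limit is the pointwise one; Fatou's lemma gives its
    square-integrability and the rate. *)
Lemma fast_cauchy_cvg (f : nat -> T -> R) : (forall n, sqint (f n)) ->
  (forall n, nrm (f n.+1 \- f n) <= (2^-1) ^+ n) ->
  exists2 g, sqint g & forall n, nrm (g \- f n) <= 2 * (2^-1) ^+ n.
Proof.
move=> sf fast; have aec := ae_cvg_fast_cauchy sf fast.
pose g x := fine (limn_esup (fun n => (f n x)%:E)).
have mg : measurable_fun D g.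
  apply: (measurableT_comp (fine_measurable measurableT)).
  by apply: measurable_fun_limn_esup => n; apply/measurable_EFinP; case: (sf n).
have gE : {ae mu, forall x, D x -> (fun n => f n x) @ \oo --> g x}.
  apply: filterS aec => x /= cf Dx; have {}cf := cf Dx.
  have /cvg_limn_einf_sup[_ fE] : (fun n => (f n x)%:E) @ \oo --> (limn (fun n => f n x))%:E.
    by apply: cvg_EFin; [exact: nearW|].
  by rewrite /g fE.
have dist m n : (n <= m)%N -> nrm (f m \- f n) <= 2 * (2^-1) ^+ n - (2^-1) ^+ m * 2.
  elim: m => [|m IH].
    by rewrite leqn0 => /eqP ->; rewrite nrm_diag expr0 mul1r mulr1 subrr.
  rewrite leq_eqVlt => /orP[/eqP ->|]; first by rewrite nrm_diag mulrC subrr.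
  rewrite ltnS => /IH {}IH; rewrite (eq_nrm (f' := (f m.+1 \- f m) \+ (f m \- f n))); last first.
    by move=> x _ /=; ring.
  apply: le_trans (nrmD _ _) _; [exact: sqintB..|].
  by have := fast m; rewrite exprS; lra.
have key n : (\int[mu]_(x in D) (((g \- f n) x) ^+ 2)%:E <= ((2 * (2^-1) ^+ n) ^+ 2)%:E)%E.
  have F := @fatou _ _ _ mu D mD (fun m x => (((f m \- f n) x) ^+ 2)%:E).
  apply: (@le_trans _ _ (\int[mu]_(x in D) limn_einf (fun m => (((f m \- f n) x) ^+ 2)%:E))%E).
    rewrite le_eqVlt; apply/orP; left; apply/eqP; apply: ae_eq_integral => //.
    - by apply/measurable_EFinP/measurable_funX/measurable_funB => //; case: (sf n).
    - rewrite (_ : (fun x => _) = (fun x => - limn_esup (fun m => (- ((f m \- f n) x ^+ 2))%:E))%E).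
        apply: measurableT_comp; first exact: oppe_measurable.
        apply: measurable_fun_limn_esup => m; apply/measurable_EFinP/measurable_funN/measurable_funX.
        by apply: measurable_funB; [case: (sf m)|case: (sf n)].
      apply/funext => x; rewrite -limn_einfN; congr limn_einf.
      by apply/funext => m /=; rewrite opprK.
    - apply: filterS gE => x /= gx Dx.
      suff /cvg_limn_einf_sup[-> _] : (fun m => ((f m x - f n x) ^+ 2)%:E) @ \oo --> ((g x - f n x) ^+ 2)%:E by [].
      apply: cvg_EFin; first exact: nearW.
      have gx' : (fun m => f m x - f n x) @ \oo --> g x - f n x by apply: cvgB; [exact: gx|exact: cvg_cst].
      exact: (cvgM gx' gx').
  apply: (le_trans (F _ _)) => [m|m x Dx|].
  - apply/measurable_EFinP/measurable_funX/measurable_funB; first by case: (sf m).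
    by case: (sf n).
  - by rewrite lee_fin sqr_ge0.
  - under eq_fun do rewrite (integral_EFin_dotp (sqintB (sf _) (sf n))).
    apply: (limn_einf_le (n := n)) => m nm; rewrite -nrm_sqr lerXn2r ?nnegrE ?nrm_ge0//.
    apply: le_trans (dist _ _ nm) _; by rewrite lerBlDr lerDl mulr_ge0.
have sgn n : sqint (g \- f n).
  split; first by apply: measurable_funB => //; case: (sf n).
  by apply: le_lt_trans (key n) _; rewrite ltry.
exists g.
  by move: (sqintD (sgn 0%N) (sf 0%N)); apply: eq_sqint => x _ /=; rewrite subrK.
move=> n; rewrite -(ger0_norm (nrm_ge0 _)) -[leRHS]ger0_norm ?mulr_ge0//.
rewrite -ler_sqr ?nnegrE ?normr_ge0// !real_normK ?num_real// nrm_sqr -lee_fin.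
by rewrite -integral_EFin_dotp.
Qed.

End SquareIntegrable.

Section SquareIntegrableSubset.
Context d (T : measurableType d) (R : realType).
Variables (mu : {measure set T -> \bar R}).
Implicit Types f g h : T -> R.

Lemma sqintS (D E : set T) f : measurable D -> measurable E -> D `<=` E ->
  sqint mu E f -> sqint mu D f.
Proof.
move=> mD mE DE sf; apply: integrable_sqint => //.
  by apply: measurable_funS DE _ => //; case: sf.
by apply: integrableS DE _ => //; exact: sqint_integrable.
Qed.

Lemma nrmS (D E : set T) f : measurable D -> measurable E -> D `<=` E ->
  sqint mu E f -> nrm mu D f <= nrm mu E f.
Proof.
move=> mD mE DE sf; rewrite ler_sqrt ?dotp_ge0//.
have /integrableP[mf foo] := sqint_integrableM mE sf sf.
apply: fine_le.
- by apply: integrable_fin_num => //; apply: (integrableS mE mD DE); exact/integrableP.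
- by apply: integrable_fin_num => //; exact/integrableP.
- apply: ge0_subset_integral => // x _; rewrite lee_fin -expr2 sqr_ge0//.
Qed.

Lemma ae_eq_comp2 (D : set T) (F : R -> R -> R) f f' g g' :
  ae_eq mu D f f' -> ae_eq mu D g g' ->
  ae_eq mu D (fun x => F (f x) (g x)) (fun x => F (f' x) (g' x)).
Proof. by apply: filterS2 => x /= + + Dx => -> // ->. Qed.

End SquareIntegrableSubset.

(** * Smooth functions of one variable *)

Section SmoothLine.
Variable R : realType.
Implicit Types (f g : R -> R) (k n : nat).

Fixpoint Cn k f : Prop :=
  if k is k'.+1 then exists2 f' : R -> R, (forall x : R, is_derive x (1 : R) f (f' x)) & Cn k' f'
  else True.

Definition smooth1 f := forall k, Cn k f.

Lemma CnW k f : Cn k.+1 f -> Cn k f.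
Proof.
elim: k f => [//|k IH] f [f' df cf]; exists f' => //; exact: IH.
Qed.

Lemma CnD k f g : Cn k f -> Cn k g -> Cn k (f \+ g).
Proof.
elim: k f g => [//|k IH] f g [f' df cf] [g' dg cg].
exists (f' \+ g'); last exact: IH.
by move=> x; apply: is_deriveD.
Qed.

Lemma Cn_cst k (c : R) : Cn k (cst c).
Proof. by elim: k c => [//|k IH] c; exists (cst 0) => // x; exact: is_derive_cst. Qed.

Lemma CnM k f g : Cn k f -> Cn k g -> Cn k (f \* g).
Proof.
elim: k f g => [//|k IH] f g Cf Cg.
have [f' df cf] := Cf; have [g' dg cg] := Cg.
exists ((f \* g') \+ (f' \* g)); last by apply: CnD; apply: IH => //; exact: CnW.
move=> x; apply: (is_derive_eq (is_deriveM (df x) (dg x))).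
by rewrite /= -[_ *: g' x]/(f x * g' x) -[_ *: f' x]/(g x * f' x); ring.
Qed.

Lemma Cn_affine k f (c d : R) : Cn k f -> Cn k (fun x => f (c * x + d)).
Proof.
elim: k f => [//|k IH] f [f' df cf].
exists (fun x => f' (c * x + d) * c).
  move=> x; have dl : is_derive x (1 : R) (fun x => c * x + d) c.
    apply: (is_derive_eq (is_deriveD (is_deriveZ c (is_derive_id x (1 : R))) (is_derive_cst d x (1 : R)))).
    by rewrite addr0; exact: mulr1.
  exact: (@is_derive1_comp _ f (fun x => c * x + d) _ _ _ (df _) dl).
exact: (CnM (IH _ cf) (Cn_cst k c)).
Qed.

Lemma Cn_id k : Cn k (fun x => x).
Proof. by case: k => // k; exists (cst 1); [move=> x; exact: is_derive_id|exact: Cn_cst]. Qed.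

Lemma Cn_derive k f : Cn k.+1 f -> Cn k (derive1 f) /\ forall x : R, is_derive x (1 : R) f ((derive1 f) x).
Proof.
move=> [f' df cf]; suff -> : (derive1 f) = f' by [].
by apply/funext => x; rewrite derive1E; apply: derive_val.
Qed.

Lemma smooth1_derive f : smooth1 f -> smooth1 (derive1 f).
Proof. by move=> sf k; have [] := Cn_derive (sf k.+1). Qed.

Lemma smooth1_is_derive f : smooth1 f -> forall x : R, is_derive x (1 : R) f ((derive1 f) x).
Proof. by move=> sf; have [] := Cn_derive (sf 1%N). Qed.

Lemma is_derive_continuous f (x l : R) : is_derive x (1 : R) f l -> {for x, continuous f}.
Proof. by move=> df; apply: differentiable_continuous; apply/derivable1_diffP; case: df. Qed.

Lemma smooth1_continuous f : smooth1 f -> continuous f.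
Proof. by move=> sf x; apply: is_derive_continuous (smooth1_is_derive sf x). Qed.

Lemma smooth1D f g : smooth1 f -> smooth1 g -> smooth1 (f \+ g).
Proof. by move=> sf sg k; exact: CnD. Qed.

Lemma smooth1M f g : smooth1 f -> smooth1 g -> smooth1 (f \* g).
Proof. by move=> sf sg k; exact: CnM. Qed.

Lemma smooth1Z c f : smooth1 f -> smooth1 (fun x => c * f x).
Proof. by move=> sf k; exact: (CnM (Cn_cst k c) (sf k)). Qed.

(** The functions [x |-> p(1/x) exp(-1/x)] extended by [0] to the negative
    half-line are closed under differentiation, which is why [exp(-1/x)] is flat
    at the origin and smooth. *)
Definition flat (p : {poly R}) (x : R) : R :=
  if 0 < x then p.[x^-1] * expR (- x^-1) else 0.

Lemma horner_bound (p : {poly R}) : exists2 A : R, 0 <= A &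
  forall y, 1 <= y -> `|p.[y]| <= A * y ^+ size p.
Proof.
exists (\sum_(i < size p) `|p`_i|); first exact: sumr_ge0.
move=> y y1; rewrite horner_coef mulr_suml.
apply: le_trans (ler_norm_sum _ _ _) _; apply: ler_sum => i _.
rewrite normrM ler_wpM2l// ger0_norm ?exprn_ge0 ?(le_trans ler01)//.
by apply: ler_weXn2l => //; exact: ltnW.
Qed.

Lemma flat_bound (p : {poly R}) : exists2 C : R, 0 <= C &
  forall x, `|x| <= 1 -> `|flat p x| <= C * x ^+ 2.
Proof.
have [A A0 pA] := horner_bound p.
exists (A * ((size p).+2)`!%:R); first by rewrite mulr_ge0.
move=> x x1; rewrite /flat; case: ifPn => x0; last first.
  by rewrite normr0; apply: mulr_ge0; [exact: mulr_ge0|exact: sqr_ge0].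
have y1 : 1 <= x^-1 by rewrite invf_ge1// (le_trans (ler_norm _) x1).
have y0 : 0 < x^-1 by rewrite invr_gt0.
have pF : (0 : R) < ((size p).+2)`!%:R by rewrite ltr0n fact_gt0.
rewrite normrM [X in _ * X]ger0_norm ?expR_ge0// expRN.
rewrite ler_pdivrMr ?expR_gt0//.
have E : (x^-1) ^+ (size p).+2 / ((size p).+2)`!%:R <= expR x^-1.
  by apply: le_trans (expR_ge1Dxn (size p).+1 (ltW y0)); rewrite lerDr.
apply: le_trans (pA _ y1) _; rewrite -!mulrA ler_wpM2l//.
rewrite ler_pdivrMr// in E.
have -> : x^-1 ^+ size p = x ^+ 2 * x^-1 ^+ (size p).+2.
  rewrite !exprS; move: (_ ^+ size p) => Z; rewrite expr0; field.
  by rewrite gt_eqF.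
rewrite [leRHS](_ : _ = x ^+ 2 * (expR x^-1 * ((size p).+2)`!%:R)); last by rewrite expr2; ring.
by rewrite ler_wpM2l// sqr_ge0.
Qed.

Lemma is_derive_flat (p : {poly R}) (x : R) :
  is_derive x (1 : R) (flat p) (flat ('X^2 * (p - p^`())) x).
Proof.
have [x0|x0|<-] := ltgtP 0 x.
- have nE : \forall z \near x, p.[z^-1] * expR (- z^-1) = flat p z.
    near=> z; rewrite /flat; suff -> : 0 < z by [].
    by near: z; exact: lt_nbhsr.
  apply: near_eq_is_derive nE _.
  have dV : is_derive x (1 : R) (fun y : R => y^-1) (- x ^- 2).
    apply: (is_derive_eq (is_deriveV (f := id) _ (is_derive_id _ _))).
      by rewrite gt_eqF.
    by rewrite /= -[_ *: 1]/(_ * 1) mulr1.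
  have d1 := @is_derive1_comp _ (horner p) (fun y => y^-1) _ _ _ (is_derive_poly p _) dV.
  have d2 := @is_derive1_comp _ expR (fun y => - y^-1) _ _ _ (is_derive_expR _) (is_deriveN dV).
  apply: (is_derive_eq (is_deriveM d1 d2)).
  rewrite /flat x0 /= -[X in X + _]/(_ * _) -[X in _ + X]/(_ * _).
  rewrite !hornerE /=; rewrite exprVn; ring.
- have nE : \forall z \near x, 0 = flat p z.
    near=> z; rewrite /flat; suff -> : (0 < z) = false by [].
    by apply/negbTE; rewrite -leNgt ltW//; near: z; exact: lt_nbhsl.
  apply: near_eq_is_derive nE _.
  by rewrite /flat ltNge ltW//=; exact: is_derive_cst.
- have f0 q : flat q 0 = 0 by rewrite /flat ltxx.
  rewrite f0; apply/is_derive1_caratheodory.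
  exists (fun z => flat p z / z); split.
  + move=> z; rewrite f0 !subr0; have [->|z0] := eqVneq z 0; first by rewrite f0 mulr0.
    by rewrite divfK.
  + have [C C0 pC] := flat_bound p.
    suff : flat p z / z @[z --> (0 : R)] --> (0 : R) by rewrite /prop_for /continuous_at f0 mul0r.
    apply/cvgrPdist_le => e e0.
    have H1 : \forall z \near (0 : R), `|z| < 1 by exact: nbhs0_lt.
    have H2 : \forall z \near (0 : R), `|z| < e / (C + 1).
      by apply: nbhs0_lt; rewrite divr_gt0// ltr_wpDl.
    apply: filterS2 H1 H2 => z /ltW z1 z2; rewrite sub0r normrN normrM normfV.
    have [->|z0] := eqVneq z 0; first by rewrite normr0 invr0 mulr0 ltW.
    rewrite ler_pdivrMr ?normr_gt0//.
    apply: le_trans (pC _ z1) _; rewrite -[z ^+ 2]real_normK ?num_real// expr2 mulrA.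
    rewrite ler_wpM2r//; move: z2; rewrite ltr_pdivlMr ?ltr_wpDl// => /ltW; apply: le_trans.
    by rewrite mulrC ler_wpM2l// lerDl.
  + by rewrite f0 mul0r.
Unshelve. all: by end_near. Qed.

Lemma smooth1_flat (p : {poly R}) : smooth1 (flat p).
Proof.
move=> k; elim: k p => [//|k IH] p.
exists (flat ('X^2 * (p - p^`()))); last exact: IH.
by move=> x; exact: is_derive_flat.
Qed.

(** Positive exactly on the positive half-line, with limit [1] at infinity.
    Products of its reflected and rescaled copies are the bump functions and the
    smooth approximations of indicator functions used below. *)
Definition ramp (x : R) : R := flat 1 x.

Lemma rampE x : 0 < x -> ramp x = expR (- x^-1).
Proof. by rewrite /ramp /flat hornerC mul1r => ->. Qed.

Lemma ramp_le0 x : x <= 0 -> ramp x = 0.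
Proof. by rewrite /ramp /flat leNgt => /negbTE ->. Qed.

Lemma ramp_gt0 x : 0 < x -> 0 < ramp x.
Proof. by move=> x0; rewrite rampE// expR_gt0. Qed.

Lemma ramp_ge0 x : 0 <= ramp x.
Proof. by have [/ramp_le0 ->|/ramp_gt0/ltW] := leP x 0. Qed.

Lemma ramp_le1 x : ramp x <= 1.
Proof.
have [/ramp_le0 ->//|x0] := leP x 0.
by rewrite rampE// -expR0 ler_expR oppr_le0 invr_ge0 ltW.
Qed.

Lemma smooth1_ramp : smooth1 ramp. Proof. exact: smooth1_flat. Qed.

Lemma cvg_ramp x : ramp (n%:R * x) @[n --> \oo] --> (if 0 < x then 1 else (0 : R)).
Proof.
have [x0|x0] := ltP 0 x; last first.
  apply: cvg_near_cst; apply: nearW => n; rewrite ramp_le0//.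
  by rewrite mulr_ge0_le0.
rewrite [X in _ --> X](_ : _ = expR (- 0)); last by rewrite oppr0 expR0.
apply: (@cvg_trans _ ((fun n => expR (- (n%:R * x)^-1)) @ \oo)).
  by apply: near_eq_cvg; exists 1%N => // n /= n0; rewrite rampE// mulr_gt0// ltr0n.
apply: continuous_cvg; first exact: continuous_expR.
apply: cvgN; rewrite (_ : (fun n => _) = (fun n => n%:R^-1 * x^-1)); last first.
  by apply/funext => n; rewrite invfM.
rewrite -[X in _ --> X](mul0r x^-1); apply: cvgM; last exact: cvg_cst.
by rewrite -(cvg_shiftS (fun n => n%:R^-1 : R)); exact: cvg_harmonic.
Qed.

End SmoothLine.

(** * Calculus in the plane *)

Section PlaneCalculus.
Variable R : realType.
Implicit Types (f g psi chi : plane R -> R) (x y v : plane R) (i : bool).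

(** Reduces calculus in the plane to functions of one variable. *)
Lemma is_derive_lineP f x v (g : R -> R) (s l : R) :
  (forall h : R, f (h *: v + x) = g (h + s)) ->
  is_derive x v f l <-> is_derive s (1 : R) g l.
Proof.
move=> fg.
have E : (fun h : R => h^-1 *: ((f \o shift x) (h *: v) - f x)) =
         (fun h : R => h^-1 *: ((g \o shift s) (h *: (1 : R)) - g s)).
  have fx : f x = g s by have := fg 0; rewrite scale0r !add0r.
  by apply/funext => h; rewrite /= /shift fg fx -[h *: (1 : R)]/(h * 1) mulr1.
by split=> -[dx <-]; split; rewrite /derivable /derive ?E -?E//; move: dx; rewrite /derivable E.
Qed.

Lemma is_derive_axisP i f x (l : R) : is_derive x (axis R i) f l <->
  is_derive (if i then x.2 else x.1) (1 : R)
    (fun t => f (if i then (x.1, t) else (t, x.2))) l.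
Proof.
apply: is_derive_lineP => h; case: i; case: x => x1 x2; congr f.
  by rewrite /axis -[LHS]/((h * 0 + x1, h * 1 + x2) : plane R) mulr0 add0r mulr1.
by rewrite /axis -[LHS]/((h * 1 + x1, h * 0 + x2) : plane R) mulr0 add0r mulr1.
Qed.

Lemma CkW k f : Ck k.+1 f -> Ck k f.
Proof.
elim: k f => [|k IH] f [cf H]; first by split.
by split=> // i; have [d /IH] := H i.
Qed.

Lemma Ck_continuous k f : Ck k f -> continuous f. Proof. by case: k => [|k] []. Qed.

Lemma Ck_is_derive k f i x : Ck k.+1 f -> is_derive x (axis R i) f (pderiv i f x).
Proof. by move=> [_ /(_ i)[df _]]; split. Qed.

Lemma Ck_pderiv k f i : Ck k.+1 f -> Ck k (pderiv i f).
Proof. by move=> [_ /(_ i)[]]. Qed.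

Lemma CkS k f (f' : bool -> plane R -> R) : continuous f ->
  (forall i x, is_derive x (axis R i) f (f' i x)) -> (forall i, Ck k (f' i)) -> Ck k.+1 f.
Proof.
move=> cf df cf'; split=> // i; split; first by move=> x; have [] := df i x.
suff -> : pderiv i f = f' i by [].
by apply/funext => x; rewrite /pderiv; have [_ ->] := df i x.
Qed.

Lemma pderiv_unique f i x (l : R) : is_derive x (axis R i) f l -> pderiv i f x = l.
Proof. by case. Qed.

Lemma Ck_cst k (c : R) : Ck k (fun _ : plane R => c).
Proof.
elim: k c => [|k IH] c; first by split=> //; exact: cst_continuous.
apply: (@CkS _ _ (fun _ _ => 0)).
- exact: cst_continuous.
- by move=> _; apply: IH.
Qed.

Lemma CkD k f g : Ck k f -> Ck k g -> Ck k (f \+ g).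
Proof.
elim: k f g => [|k IH] f g Cf Cg.
  by split=> // x; apply: cvgD; [exact: (Ck_continuous Cf)|exact: (Ck_continuous Cg)].
apply: (@CkS _ _ (fun i => pderiv i f \+ pderiv i g)).
- by move=> x; apply: cvgD; [exact: (Ck_continuous Cf)|exact: (Ck_continuous Cg)].
- by move=> i x; apply: is_deriveD; [exact: Ck_is_derive Cf|exact: Ck_is_derive Cg].
- by move=> i; apply: IH; exact: Ck_pderiv.
Qed.

Lemma pderivD k f g i : Ck k.+1 f -> Ck k.+1 g -> pderiv i (f \+ g) = pderiv i f \+ pderiv i g.
Proof.
move=> Cf Cg; apply/funext => x; apply: pderiv_unique.
by apply: is_deriveD; [exact: Ck_is_derive Cf|exact: Ck_is_derive Cg].
Qed.

Lemma is_derive_mul f g i x (l m : R) : is_derive x (axis R i) f l ->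
  is_derive x (axis R i) g m -> is_derive x (axis R i) (f \* g) (f x * m + l * g x).
Proof.
move=> df dg; apply: (is_derive_eq (is_deriveM df dg)).
by rewrite -[_ *: m]/(f x * m) -[_ *: l]/(g x * l); ring.
Qed.

Lemma CkM k f g : Ck k f -> Ck k g -> Ck k (f \* g).
Proof.
elim: k f g => [|k IH] f g Cf Cg.
  by split=> // x; apply: cvgM; [exact: (Ck_continuous Cf)|exact: (Ck_continuous Cg)].
apply: (@CkS _ _ (fun i => (f \* pderiv i g) \+ (pderiv i f \* g))).
- by move=> x; apply: cvgM; [exact: (Ck_continuous Cf)|exact: (Ck_continuous Cg)].
- by move=> i x; apply: is_derive_mul; [exact: Ck_is_derive Cf|exact: Ck_is_derive Cg].
- by move=> i; apply: CkD; apply: IH; (exact: Ck_pderiv || exact: CkW).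
Qed.

Lemma pderivM k f g i : Ck k.+1 f -> Ck k.+1 g ->
  pderiv i (f \* g) = (f \* pderiv i g) \+ (pderiv i f \* g).
Proof.
move=> Cf Cg; apply/funext => x; apply: pderiv_unique.
by apply: is_derive_mul; [exact: Ck_is_derive Cf|exact: Ck_is_derive Cg].
Qed.

Lemma CkZ k c f : Ck k f -> Ck k (fun x => c * f x).
Proof. by move=> Cf; apply: (CkM (Ck_cst k c)). Qed.

Lemma pderivZ k f i c : Ck k.+1 f -> pderiv i (fun x => c * f x) = fun x => c * pderiv i f x.
Proof.
move=> Cf; apply/funext => x; apply: pderiv_unique.
apply: (is_derive_eq (is_derive_mul (is_derive_cst c x (axis R i)) (Ck_is_derive _ _ Cf))).
by rewrite /= mul0r addr0.
Qed.

Definition ridge (h : R -> R) (c : R) v : plane R -> R := fun x => h (c + dot v x).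

Lemma continuous_ridge (h : R -> R) c v : continuous h -> continuous (ridge h c v).
Proof.
move=> ch x; apply: (continuous_comp (f := fun x => c + dot v x)); last exact: ch.
apply: cvgD; first exact: cvg_cst.
by apply: cvgD; apply: cvgM; (exact: cvg_cst || exact: cvg_fst || exact: cvg_snd).
Qed.

Lemma is_derive_ridge (h h' : R -> R) c v i x : (forall t, is_derive t (1 : R) h (h' t)) ->
  is_derive x (axis R i) (ridge h c v) ((if i then v.2 else v.1) * ridge h' c v x).
Proof.
move=> dh; apply/is_derive_axisP; rewrite mulrC.
pose l (t : R) := (if i then v.2 else v.1) * t + (c + if i then v.1 * x.1 else v.2 * x.2).
have dl (t : R) : is_derive t (1 : R) l (if i then v.2 else v.1).
  apply: (is_derive_eq (is_deriveD (is_deriveZ _ (is_derive_id t (1 : R))) (is_derive_cst _ t (1 : R)))).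
  by rewrite addr0; exact: mulr1.
have := @is_derive1_comp _ h l _ _ _ (dh _) (dl (if i then x.2 else x.1)).
rewrite (_ : h' _ = ridge h' c v x); last first.
  by rewrite /l /ridge /dot; clear; case: i; congr h'; ring.
congr is_derive; apply/funext => t; rewrite /= /l /ridge /dot.
by clear; case: i; congr h; rewrite /=; ring.
Qed.

Lemma Ck_ridge k (h : R -> R) c v : smooth1 h -> Ck k (ridge h c v).
Proof.
elim: k h => [|k IH] h sh; first by split=> //; apply: continuous_ridge; exact: smooth1_continuous.
apply: (@CkS _ _ (fun i x => (if i then v.2 else v.1) * ridge (derive1 h) c v x)).
- by apply: continuous_ridge; exact: smooth1_continuous.
- by move=> i x; apply: is_derive_ridge; exact: smooth1_is_derive.
- by move=> i; apply: CkZ; apply: IH; exact: smooth1_derive.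
Qed.

Lemma smoothD f g : smooth f -> smooth g -> smooth (f \+ g).
Proof. by move=> sf sg k; exact: CkD. Qed.
Lemma smoothM f g : smooth f -> smooth g -> smooth (f \* g).
Proof. by move=> sf sg k; exact: CkM. Qed.
Lemma smoothZ c f : smooth f -> smooth (fun x => c * f x).
Proof. by move=> sf k; exact: CkZ. Qed.
Lemma smooth_cst (c : R) : smooth (cst c : plane R -> R).
Proof. by move=> k; exact: Ck_cst. Qed.
Lemma smoothB f g : smooth f -> smooth g -> smooth (f \- g).
Proof.
move=> sf /(smoothZ (-1)) /(smoothD sf); congr smooth.
by apply/funext => x /=; rewrite mulN1r.
Qed.
Lemma smooth_pderiv i f : smooth f -> smooth (pderiv i f).
Proof. by move=> sf k; exact: Ck_pderiv (sf k.+1). Qed.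
Lemma smooth_ridge (h : R -> R) c v : smooth1 h -> smooth (ridge h c v).
Proof. by move=> sh k; exact: Ck_ridge. Qed.
Lemma smooth_continuous f : smooth f -> continuous f.
Proof. by move=> /(_ 0%N)/Ck_continuous. Qed.

Lemma is_derive_eps (g : R -> R) (t l : R) :
  (forall e : R, 0 < e -> exists2 d : R, 0 < d & forall h, `|h| < d ->
     `|g (t + h) - g t - l * h| <= e * `|h|) -> is_derive t (1 : R) g l.
Proof.
move=> H; apply/is_derive1_caratheodory.
exists (fun z => if z == t then l else (g z - g t) / (z - t)); split.
- move=> z; case: eqVneq => [->|zt]; first by rewrite !subrr mulr0.
  by rewrite divfK// subr_eq0.
- rewrite /prop_for /continuous_at eqxx; apply/cvgrPdist_le => e e0.
  have [d d0 Hd] := H e e0.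
  apply/nbhs_ballP; exists d => //= z; rewrite /ball /= distrC => zt.
  case: eqVneq => [_|zt0]; first by rewrite subrr normr0 ltW.
  have z0 : z - t != 0 by rewrite subr_eq0.
  have := Hd _ zt; rewrite addrCA subrr addr0 => Hz.
  rewrite distrC -(ler_pM2r (x := `|z - t|)) ?normr_gt0// -normrM mulrBl divfK//.
- by rewrite eqxx.
Qed.

Lemma mvt_dist (g g' : R -> R) (a b m e : R) :
  (forall s : R, is_derive s (1 : R) g (g' s)) ->
  (forall s, `|s - a| <= `|b - a| -> `|g' s - m| <= e) ->
  `|g b - g a - m * (b - a)| <= e * `|b - a|.
Proof.
move=> dg g'm.
have cg : continuous g by move=> s; exact: is_derive_continuous (dg s).
have cw (I : set R) : {within I, continuous g} by exact: continuous_subspaceT.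
have [ab|/ltW ba] := leP a b.
  have [c + E] := @MVT_segment R g g' a b ab (fun s _ => dg s) (cw _).
  rewrite in_itv/= => /andP[ac cb].
  rewrite E -mulrBl normrM ler_wpM2r//; apply: g'm.
  by rewrite !ger0_norm ?subr_ge0// lerD2r.
have [c + E] := @MVT_segment R g g' b a ba (fun s _ => dg s) (cw _).
rewrite in_itv/= => /andP[bc ca].
rewrite (_ : _ - _ - _ = - ((g' c - m) * (a - b))); last by rewrite mulrBl -E; ring.
rewrite normrN normrM (distrC a b) ler_wpM2r//; apply: g'm.
by rewrite !ler0_norm ?subr_le0// lerN2 lerD2r.
Qed.

(** Continuous partial derivatives are enough: an increment along the line is
    the sum of one parallel to each axis, and the mean value inequality applies
    to both. *)
Lemma is_derive_C1_line f x v (t : R) : Ck 1 f ->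
  is_derive t (1 : R) (fun t => f (x + t *: v))
    (dot (pderiv false f (x + t *: v), pderiv true f (x + t *: v)) v).
Proof.
move=> Cf; apply: is_derive_eps => e e0.
set p : plane R := x + t *: v.
have V0 : 0 < `|v.1| + `|v.2| + 1 by rewrite ltr_wpDl ?addr_ge0.
pose e' := e / (`|v.1| + `|v.2| + 1).
have e'0 : 0 < e' by rewrite divr_gt0.
have cont i : exists2 d : R, 0 < d & forall y, `|y.1 - p.1| < d -> `|y.2 - p.2| < d ->
    `|pderiv i f y - pderiv i f p| <= e'.
  have /(_ p) := @Ck_continuous 0 _ (Ck_pderiv i Cf).
  move=> /cvgrPdist_le/(_ _ e'0)/nbhs_planeP[d d0 H]; exists d => // y y1 y2.
  by rewrite distrC; exact: H.
have [d1 d10 H1] := cont false; have [d2 d20 H2] := cont true.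
exists (Num.min d1 d2 / (`|v.1| + `|v.2| + 1)); first by rewrite divr_gt0// lt_min d10.
move=> h; rewrite ltr_pdivlMr// lt_min => /andP[hd1 hd2].
have v1h (d : R) : `|h| * (`|v.1| + `|v.2| + 1) < d -> `|h * v.1| < d.
  apply: le_lt_trans; rewrite normrM ler_wpM2l//.
  by have := normr_ge0 v.2; lra.
have v2h (d : R) : `|h| * (`|v.1| + `|v.2| + 1) < d -> `|h * v.2| < d.
  apply: le_lt_trans; rewrite normrM ler_wpM2l//.
  by have := normr_ge0 v.1; lra.
pose P (s1 s2 : R) : plane R := (p.1 + s1, p.2 + s2).
have pE (s : R) : x + (t + s) *: v = P (s * v.1) (s * v.2).
  rewrite /P /p; case: (x) (v) => x1 x2 [w1 w2] /=.
  by rewrite -[LHS]/((x1 + (t + s) * w1, x2 + (t + s) * w2) : plane R); congr pair;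
    rewrite /= -?[(t *: _)]/(t * _); ring.
have -> : p = P 0 0 by rewrite /P !addr0; case: (p).
rewrite pE.
have D1 : `|f (P (h * v.1) (h * v.2)) - f (P 0 (h * v.2)) - pderiv false f p * (h * v.1)|
     <= e' * `|h * v.1|.
  have /(_ (p.1 + h * v.1) p.1 (pderiv false f p) e') :=
    fun a b m e => @mvt_dist (fun s => f (s, p.2 + h * v.2))
      (fun s => pderiv false f (s, p.2 + h * v.2)) b a m e.
  rewrite (_ : p.1 + h * v.1 - p.1 = h * v.1) ?/P ?addr0; last by ring.
  apply.
    by move=> s; have /is_derive_axisP := Ck_is_derive false (s, p.2 + h * v.2) Cf.
  move=> s sh; apply: H1 => /=; first exact: le_lt_trans sh (v1h _ hd1).
  by rewrite (_ : _ - _ = h * v.2); [exact: v2h|ring].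
have D2 : `|f (P 0 (h * v.2)) - f (P 0 0) - pderiv true f p * (h * v.2)|
     <= e' * `|h * v.2|.
  have /(_ (p.2 + h * v.2) p.2 (pderiv true f p) e') :=
    fun a b m e => @mvt_dist (fun s => f (p.1, s)) (fun s => pderiv true f (p.1, s)) b a m e.
  rewrite (_ : p.2 + h * v.2 - p.2 = h * v.2) ?/P ?addr0; last by ring.
  apply.
    by move=> s; have /is_derive_axisP := Ck_is_derive true (p.1, s) Cf.
  move=> s sh; apply: H2 => /=; first by rewrite subrr normr0.
  exact: le_lt_trans sh (v2h _ hd2).
have -> : P 0 0 = p by rewrite /P !addr0; case: (p).
move: D1 D2; have -> : P 0 0 = p by rewrite /P !addr0; case: (p).
rewrite /dot /= => D1 D2.
rewrite (_ : _ - _ = (f (P (h * v.1) (h * v.2)) - f (P 0 (h * v.2)) - pderiv false f p * (h * v.1))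
  + (f (P 0 (h * v.2)) - f p - pderiv true f p * (h * v.2))); last by ring.
apply: le_trans (ler_normD _ _) _; apply: le_trans (lerD D1 D2) _.
rewrite !normrM -mulrDr -mulrDr mulrCA [leRHS]mulrC ler_wpM2l//.
by rewrite /e' mulrAC ler_pdivrMr// ler_wpM2l ?ltW//; lra.
Qed.

Lemma FTC_line (F F' : R -> R) (a b : R) : a < b ->
  (forall t : R, is_derive t (1 : R) F (F' t)) -> continuous F' ->
  (\int[lebesgue_measure]_(t in `[a, b]) (F' t)%:E = (F b - F a)%:E)%E.
Proof.
move=> ab dF cF'; rewrite EFinB; apply: continuous_FTC2 => //.
- exact: continuous_subspaceT.
- have cF t : {for t, continuous F} by exact: is_derive_continuous (dF t).
  split=> [t _||]; first by case: (dF t).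
  + by apply: cvg_at_right_filter; exact: cF.
  + by apply: cvg_at_left_filter; exact: cF.
- by move=> t _; rewrite derive1E; case: (dF t).
Qed.

Lemma integral_derive_compact (F F' : R -> R) (N : R) :
  (forall t : R, is_derive t (1 : R) F (F' t)) -> continuous F' ->
  (forall t, N < `|t| -> F t = 0) ->
  (\int[lebesgue_measure]_t (F' t)%:E = 0)%E.
Proof.
move=> dF cF' F0; pose M : R := `|N| + 1.
have NM : N < M by rewrite /M; have := ler_norm N; lra.
have M0 : 0 < M by rewrite /M; have := normr_ge0 N; lra.
rewrite (_ : (\int[lebesgue_measure]_t (F' t)%:E)%E = (\int[lebesgue_measure]_(t in `[(- M)%R, M]) (F' t)%:E)%E).
  rewrite (FTC_line _ dF)//; last by lra.
  by rewrite !F0 ?subrr// ?normrN gtr0_norm.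
rewrite [RHS]integral_mkcond; apply: eq_integral => t _; rewrite patchE; case: ifPn => //.
rewrite notin_setE /= in_itv /= => /negP; rewrite -ler_norml -ltNge => tM.
congr EFin; rewrite -(@derive_val _ _ _ _ _ _ _ (dF t)) -derive1E.
have nE : \forall s \near t, 0 = F s.
  near=> s; rewrite F0//; apply: lt_trans NM _.
  by near: s; apply: (@cvgr_gt _ _ (nbhs t) _ (fun s => `|s|) `|t|) => //; exact: cvg_norm.
rewrite derive1E; have := near_eq_is_derive nE (is_derive_cst 0 t (1 : R)).
by case=> _ ->.
Unshelve. all: by end_near. Qed.

Lemma continuous_bounded_crect f (a b c d : R) : continuous f ->
  exists M : R, forall x, crect a b c d x -> `|f x| <= M.
Proof.
move=> cf; have cK := @compact_crect R a b c d.
have /compact_bounded[M [_ HM]] : compact (f @` crect a b c d).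
  by apply: continuous_compact => //; exact: continuous_subspaceT.
exists (M + 1) => x Kx; apply: (HM (M + 1)); first by rewrite ltrDl.
by exists x.
Qed.

Lemma integrable_compact_support f (N : R) : continuous f ->
  (forall x, N < `|x.1| \/ N < `|x.2| -> f x = 0) ->
  (leb2 R).-integrable setT (EFin \o f).
Proof.
move=> cf f0; have mK := measurable_crect (- N) N (- N) N.
have [M fM] := continuous_bounded_crect (- N) N (- N) N cf.
have i1 : (leb2 R).-integrable (crect (- N) N (- N) N) (EFin \o f).
  apply: measurable_bounded_integrable => //.
  - exact: mu2_crect_lt.
  - exact: continuous_plane_measurable.
  - exists M; split; first exact: num_real.
    by move=> y My x Kx; apply: le_trans (fM _ Kx) (ltW My).
have := (@integrable_mkcond _ _ _ (leb2 R) _ (EFin \o f) mK).1 i1; congr integrable.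
apply/funext => x; rewrite patchE; case: ifPn => //.
rewrite notin_setE => Kx; congr EFin; rewrite f0//.
apply: contrapT => /not_orP[/negP + /negP]; rewrite -!leNgt !ler_norml => x1 x2.
by apply: Kx; split; rewrite /= in_itv.
Qed.

Lemma continuous_slices f (z : R) : continuous f ->
  continuous (fun t : R => f (t, z)) /\ continuous (fun t : R => f (z, t)).
Proof.
move=> cf; split=> t; apply/cvgrPdist_le => e e0.
  have /(_ (t, z))/cvgrPdist_le/(_ _ e0)/nbhs_planeP[d d0 H] := cf.
  apply/nbhs_ballP; exists d => // s; rewrite /ball /= => st.
  by apply: H; rewrite /= ?subrr ?normr0// distrC.
have /(_ (z, t))/cvgrPdist_le/(_ _ e0)/nbhs_planeP[d d0 H] := cf.
apply/nbhs_ballP; exists d => // s; rewrite /ball /= => st.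
by apply: H; rewrite /= ?subrr ?normr0// distrC.
Qed.

Lemma pderiv_eq0_near f i x : (\forall y \near x, f y = 0) -> pderiv i f x = 0.
Proof.
move=> f0; apply: pderiv_unique; apply: (near_eq_is_derive _ (is_derive_cst 0 x (axis R i))).
by apply: filterS f0 => y ->.
Qed.

(** By Fubini's theorem and the fundamental theorem of calculus on the lines
    parallel to the axis [i]. *)
Lemma integral_pderiv_compact f i (N : R) : Ck 1 f ->
  (forall x, N < `|x.1| \/ N < `|x.2| -> f x = 0) ->
  (\int[leb2 R]_x (pderiv i f x)%:E = 0)%E.
Proof.
move=> Cf f0.
have cf' : continuous (pderiv i f) by exact: Ck_continuous (Ck_pderiv i Cf).
have f'0 x : N < `|x.1| \/ N < `|x.2| -> pderiv i f x = 0.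
  move=> xN; apply: pderiv_eq0_near; apply/nbhs_planeP.
  case: xN => xN.
    exists (`|x.1| - N); first by rewrite subr_gt0.
    move=> y yx _; apply: f0; left.
    have := lerB_dist x.1 y.1; rewrite distrC in yx; lra.
  exists (`|x.2| - N); first by rewrite subr_gt0.
  move=> y _ yx; apply: f0; right.
  have := lerB_dist x.2 y.2; rewrite distrC in yx; lra.
have int' := integrable_compact_support cf' f'0.
case: i cf' f'0 int' => cf' f'0 int'.
- rewrite -(integral12_prod_meas1 int') /fubini_F; apply: integral0_eq => x _.
  apply: (@integral_derive_compact (fun t => f (x, t)) (fun t => pderiv true f (x, t)) N).
  + by move=> t; have /is_derive_axisP := Ck_is_derive true (x, t) Cf.
  + exact: (@continuous_slices _ x cf').2.
  + by move=> t tN; apply: f0; right.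
- rewrite -(integral21_prod_meas1 int') /fubini_G; apply: integral0_eq => y _.
  apply: (@integral_derive_compact (fun t => f (t, y)) (fun t => pderiv false f (t, y)) N).
  + by move=> t; have /is_derive_axisP := Ck_is_derive false (t, y) Cf.
  + exact: (@continuous_slices _ y cf').1.
  + by move=> t tN; apply: f0; left.
Qed.

End PlaneCalculus.

(** * Rectangles determine integrals *)

Section OpenRectangles.
Variable R : realType.
Local Notation mplane := (measurableTypeR R * measurableTypeR R)%type.

Definition orects : set (set mplane) :=
  [set A | exists a b c d : R, A = orect a b c d].

Lemma orectI (a b c d a' b' c' d' : R) : orect a b c d `&` orect a' b' c' d' =
  orect (Num.max a a') (Num.min b b') (Num.max c c') (Num.min d d').
Proof.
apply/seteqP; split=> x.
  move=> [[/= + +] [/= + +]]; rewrite !in_itv/= => /andP[? ?] /andP[? ?] /andP[? ?] /andP[? ?].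
  by split; rewrite /= in_itv/= gt_max lt_min; apply/andP; split; apply/andP; split.
move=> [/= + +]; rewrite !in_itv/= !gt_max !lt_min.
by move=> /andP[/andP[? ?] /andP[? ?]] /andP[/andP[? ?] /andP[? ?]]; split; split;
  rewrite /= in_itv/=; apply/andP; split.
Qed.

Lemma setI_closed_orects : setI_closed orects.
Proof.
by move=> _ _ [a [b [c [d ->]]]] [a' [b' [c' [d' ->]]]]; rewrite orectI; do 4 eexists.
Qed.

Let T' := g_sigma_algebraType orects.

Lemma open_sigma_orects (U : set (plane R)) : open U -> <<s orects>> U.
Proof.
move=> /bigcup_rat_rect <-; apply: (@bigcupT_measurable _ T') => n.
have [a [b [c [d [-> _]]]]] := rat_rectP U n.
by apply: sub_sigma_algebra; exists a, b, c, d.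
Qed.

(** An open set is a countable union of rectangles, so continuous functions, in
    particular the two coordinates, are measurable for the generated
    sigma-algebra. *)
Lemma measurable_sigma_orects : @measurable _ mplane = <<s orects>>.
Proof.
apply/seteqP; split; last first.
  apply: smallest_sub; first exact: sigma_algebra_measurable.
  by move=> _ [a [b [c [d ->]]]]; exact: measurable_orect.
have mop (h : plane R -> R) : continuous h -> measurable_fun setT (h : T' -> R).
  move=> ch; apply: (measurability _ (RGenOInfty.measurableE R)) => //.
  move=> _ [_ [a ->] <-]; rewrite setTI; apply: open_sigma_orects.
  by apply: open_comp => [x _|]; [exact: ch|exact: rray_open].
have mf : measurable_fun setT (fst : T' -> R) by apply: mop => x; exact: cvg_fst.
have ms : measurable_fun setT (snd : T' -> R) by apply: mop => x; exact: cvg_snd.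
rewrite measurable_prod_measurableType; apply: smallest_sub.
  exact: (@sigma_algebra_measurable _ T').
move=> _ [A mA] [B mB] <-.
have -> : A `*` B = (fst @^-1` A) `&` (snd @^-1` B) by [].
apply: (@measurableI _ T'); rewrite -[X in _ X]setTI; [exact: mf|exact: ms].
Qed.

Lemma bigcup_orect : \bigcup_n orect (- n%:R) n%:R (- n%:R) n%:R = [set: plane R].
Proof.
apply/seteqP; split=> // x _; pose m := (Num.truncn (Num.max `|x.1| `|x.2|)).+1.
have : Num.max `|x.1| `|x.2| < m%:R by exact: truncnS_gt.
rewrite gt_max !ltr_norml => /andP[x1 x2].
by exists m => //; split; rewrite /= in_itv.
Qed.

End OpenRectangles.

Section InducedMeasure.
Context d (T : measurableType d) (R : realType) (mu : {measure set T -> \bar R}).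
Variables (f : T -> \bar R) (mf : measurable_fun setT f) (f0 : forall x, (0 <= f x)%E).

Definition induced (A : set T) : \bar R := (\int[mu]_(x in A) f x)%E.

Let induced0 : induced set0 = 0%E. Proof. exact: integral_set0. Qed.
Let induced_ge0 A : (0 <= induced A)%E. Proof. by apply: integral_ge0 => x _. Qed.
Let induced_sigma : semi_sigma_additive induced.
Proof. exact: semi_sigma_additive_nng_induced. Qed.

HB.instance Definition _ :=
  isMeasure.Build _ _ _ induced induced0 induced_ge0 induced_sigma.

Definition induced_measure : {measure set T -> \bar R} := induced.

End InducedMeasure.

Section IntegralOverRectangles.
Variable R : realType.
Local Notation mplane := (measurableTypeR R * measurableTypeR R)%type.

(** The measures with the positive and the negative part of [h] as densities
    agree on open rectangles, a generating pi-system, hence everywhere. *)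
Lemma ae_eq0_orects (h : mplane -> R) :
  (leb2 R).-integrable setT (EFin \o h) ->
  (forall a b c d : R, (\int[leb2 R]_(x in orect a b c d) (h x)%:E = 0)%E) ->
  ae_eq (leb2 R) setT (EFin \o h) (cst 0%E).
Proof.
move=> ih h0.
have mh := measurable_int _ ih.
pose hp := (EFin \o h)^\+%E; pose hn := (EFin \o h)^\-%E.
have mp : measurable_fun setT hp by exact: measurable_funepos.
have mn : measurable_fun setT hn by exact: measurable_funeneg.
have ip := integrable_funepos measurableT ih.
have inn := integrable_funeneg measurableT ih.
have fin (A : set mplane) : measurable A ->
    (\int[leb2 R]_(x in A) hp x)%E \is a fin_num /\ (\int[leb2 R]_(x in A) hn x)%E \is a fin_num.
  by move=> mA; split; apply: integrable_fin_num => //;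
    (apply: (integrableS _ mA _ ip) => // || apply: (integrableS _ mA _ inn) => //).
pose m1 := induced_measure (leb2 R) mp (fun x => funepos_ge0 _ x).
pose m2 := induced_measure (leb2 R) mn (fun x => funeneg_ge0 _ x).
have m12 A : @measurable _ mplane A -> m1 A = m2 A.
  apply: (measure_unique (@orects R) (fun n : nat => orect (- n%:R) n%:R (- n%:R) n%:R)).
  - exact: measurable_sigma_orects.
  - exact: setI_closed_orects.
  - by move=> n; do 4 eexists.
  - exact: bigcup_orect.
  - move=> _ [a [b [c [e ->]]]]; have mA := measurable_orect a b c e.
    have [f1 f2] := fin _ mA; have := h0 a b c e.
    rewrite integralE -/hp -/hn /m1 /m2 /= /induced => /eqP.
    by rewrite sube_eq ?f1 ?f2 ?add0e// => /eqP.
  - move=> k; have [+ _] := fin _ (measurable_orect (- k%:R) k%:R (- k%:R) k%:R).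
    by move=> H; rewrite -ge0_fin_numE; [exact: H|exact: measure_ge0].
apply: (integral_ae_eq measurableT ih) => // A _ mA.
rewrite integral0 integralE -/hp -/hn.
have := m12 _ mA; rewrite /m1 /m2 /= /induced => ->.
by rewrite subee//; have [] := fin _ mA.
Qed.

End IntegralOverRectangles.

(** * Test functions and the fundamental lemma *)

Lemma ae_eq_bigcup d (T : measurableType d) (R : realType) (mu : {measure set T -> \bar R})
  (F : nat -> set T) (D : set T) (f g : T -> R) :
  (forall n, ae_eq mu (F n) f g) -> D `<=` \bigcup_n F n -> ae_eq mu D f g.
Proof.
move=> H DF; have : {ae mu, forall x, forall n, F n x -> f x = g x} by exact: ae_foralln.
by apply: filterS => x /= Hx /DF[n _ /Hx].
Qed.

Section PlaneL2.
Variables (R : realType) (O : set (plane R)) (mO : measurable O).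
Implicit Types f g h : plane R -> R.

Lemma L2D f g : L2 O f -> L2 O g -> L2 O (f \+ g).
Proof. exact: (@sqintD _ _ _ (leb2 R) O mO). Qed.

Lemma L2B f g : L2 O f -> L2 O g -> L2 O (f \- g).
Proof. exact: (@sqintB _ _ _ (leb2 R) O mO). Qed.

Lemma L2Z k f : L2 O f -> L2 O (fun x => k * f x).
Proof. exact: (@sqintZ _ _ _ (leb2 R) O mO). Qed.

Lemma L20 : L2 O (cst 0).
Proof. exact: (@sqint0 _ _ _ (leb2 R) O). Qed.

Lemma eq_L2 f g : (forall x, O x -> f x = g x) -> L2 O f -> L2 O g.
Proof. exact: (@eq_sqint _ _ _ (leb2 R) O). Qed.

Lemma innerC f g : inner O f g = inner O g f.
Proof. exact: (@dotpC _ _ _ (leb2 R) O). Qed.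

Lemma innerDl f g h : L2 O f -> L2 O g -> L2 O h ->
  inner O (f \+ g) h = inner O f h + inner O g h.
Proof. exact: (@dotpDl _ _ _ (leb2 R) O mO). Qed.

Lemma innerBl f g h : L2 O f -> L2 O g -> L2 O h ->
  inner O (f \- g) h = inner O f h - inner O g h.
Proof. exact: (@dotpBl _ _ _ (leb2 R) O mO). Qed.

Lemma innerZl k f h : L2 O f -> L2 O h -> inner O (fun x => k * f x) h = k * inner O f h.
Proof. exact: (@dotpZl _ _ _ (leb2 R) O mO). Qed.

Lemma innerDr f g h : L2 O f -> L2 O g -> L2 O h ->
  inner O f (g \+ h) = inner O f g + inner O f h.
Proof. exact: (@dotpDr _ _ _ (leb2 R) O mO). Qed.

Lemma norm2_ge0 f : 0 <= norm2 O f.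
Proof. exact: sqrtr_ge0. Qed.

Lemma cauchy_schwarz f g : L2 O f -> L2 O g -> `|inner O f g| <= norm2 O f * norm2 O g.
Proof. exact: (@cauchy_schwarz_dotp _ _ _ (leb2 R) O mO). Qed.

Lemma norm2D f g : L2 O f -> L2 O g -> norm2 O (f \+ g) <= norm2 O f + norm2 O g.
Proof. exact: (@nrmD _ _ _ (leb2 R) O mO). Qed.

Lemma norm2B f g : L2 O f -> L2 O g -> norm2 O (f \- g) <= norm2 O f + norm2 O g.
Proof. exact: (@nrmB _ _ _ (leb2 R) O mO). Qed.

Lemma norm2Z k f : L2 O f -> norm2 O (fun x => k * f x) = `|k| * norm2 O f.
Proof. exact: (@nrmZ _ _ _ (leb2 R) O mO). Qed.

Lemma norm2_diag f : norm2 O (f \- f) = 0.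
Proof. exact: (@nrm_diag _ _ _ (leb2 R) O). Qed.

Lemma eq_inner f f' g g' : (forall x, O x -> f x = f' x) ->
  (forall x, O x -> g x = g' x) -> inner O f g = inner O f' g'.
Proof. exact: (@eq_dotp _ _ _ (leb2 R) O). Qed.

Lemma ae_inner f f' g g' : L2 O f -> L2 O f' -> L2 O g -> L2 O g' ->
  ae_eq_on O f f' -> ae_eq_on O g g' -> inner O f g = inner O f' g'.
Proof. exact: (@ae_dotp _ _ _ (leb2 R) O mO). Qed.

Lemma ae_norm2 f f' : L2 O f -> L2 O f' -> ae_eq_on O f f' -> norm2 O f = norm2 O f'.
Proof. exact: (@ae_nrm _ _ _ (leb2 R) O mO). Qed.

Lemma ae_refl f : ae_eq_on O f f.
Proof. exact: nearW. Qed.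

Lemma ae_sym f g : ae_eq_on O f g -> ae_eq_on O g f.
Proof. exact: (@ae_eq_sym _ _ _ (leb2 R)). Qed.

Lemma ae_trans f g h : ae_eq_on O f g -> ae_eq_on O g h -> ae_eq_on O f h.
Proof. exact: (@ae_eq_trans _ _ _ (leb2 R)). Qed.

Lemma ae_comp2 (F : R -> R -> R) f f' g g' : ae_eq_on O f f' -> ae_eq_on O g g' ->
  ae_eq_on O (fun x => F (f x) (g x)) (fun x => F (f' x) (g' x)).
Proof. exact: (@ae_eq_comp2 _ _ _ (leb2 R)). Qed.

Lemma eq_ae f g : (forall x, O x -> f x = g x) -> ae_eq_on O f g.
Proof. by move=> fg; apply: nearW. Qed.

Lemma L2_integrableM f g : L2 O f -> L2 O g ->
  (leb2 R).-integrable O (EFin \o (fun x => f x * g x)).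
Proof. exact: (@sqint_integrableM _ _ _ (leb2 R) O mO). Qed.

Lemma L2_bounded f (M : R) : measurable_fun O f -> (leb2 R O < +oo)%E ->
  (forall x, O x -> `|f x| <= M) ->
  L2 O f /\ norm2 O f <= `|M| * Num.sqrt (fine (leb2 R O)).
Proof. exact: (@sqint_bounded _ _ _ (leb2 R) O mO). Qed.

Lemma L2_integrable f : (leb2 R O < +oo)%E -> L2 O f -> (leb2 R).-integrable O (EFin \o f).
Proof.
move=> Ooo Lf; have [] := @L2_bounded (cst 1) 1 (@measurable_cst _ _ _ _ _ _) Ooo.
  by move=> x _; rewrite normr1.
move=> L1 _.
apply: eq_integrable (L2_integrableM Lf L1) => //.
by move=> x _ /=; rewrite mulr1.
Qed.

End PlaneL2.

Section PlaneL2Subset.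
Variables (R : realType) (D E : set (plane R)) (mD : measurable D) (mE : measurable E).
Hypothesis DE : D `<=` E.
Implicit Types f g : plane R -> R.

Lemma L2S f : L2 E f -> L2 D f.
Proof. exact: (@sqintS _ _ _ (leb2 R) D E f mD mE DE). Qed.

Lemma norm2S f : L2 E f -> norm2 D f <= norm2 E f.
Proof. exact: (@nrmS _ _ _ (leb2 R) D E f mD mE DE). Qed.

End PlaneL2Subset.

Section TestFunctions.
Variable R : realType.
Implicit Types (O : set (plane R)) (f g w psi chi : plane R -> R) (x : plane R) (i : bool).

Lemma test_out O psi x : test_function O psi -> ~ O x -> psi x = 0.
Proof. by move=> [_ [K [_ KO K0]]] Ox; apply: K0 => /KO. Qed.

Lemma test_box O psi : test_function O psi ->
  exists N : R, forall x, N < `|x.1| \/ N < `|x.2| -> psi x = 0.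
Proof.
move=> [_ [K [/compact_bounded[M [_ HM]] _ K0]]]; exists (M + 1) => x xM.
apply: K0 => /(HM (M + 1) _); rewrite ltrDl ltr01 => /(_ isT).
rewrite {1}/Num.norm /= ge_max => /andP[x1 x2].
by case: xM; rewrite ltNge ?x1 ?x2.
Qed.

Lemma test_pderiv O psi i : test_function O psi -> test_function O (pderiv i psi).
Proof.
move=> [sp [K [cK KO K0]]]; split; first exact: smooth_pderiv.
exists K; split=> // x Kx; apply: pderiv_eq0_near.
have oK : open (~` K) by apply: closed_openC; apply: compact_closed => //; exact: norm_hausdorff.
by apply: filterS (open_nbhs_nbhs (conj oK Kx)) => y; exact: K0.
Qed.

Lemma testM O chi psi : smooth chi -> test_function O psi -> test_function O (chi \* psi).
Proof.
move=> sc [sp [K [cK KO K0]]]; split; first exact: smoothM.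
by exists K; split=> // x Kx; rewrite /= K0 ?mulr0.
Qed.

Lemma testS O O' psi : O `<=` O' -> test_function O psi -> test_function O' psi.
Proof. by move=> OO' [sp [K [cK KO K0]]]; split=> //; exists K; split=> // x /KO/OO'. Qed.

Lemma testZ O c psi : test_function O psi -> test_function O (fun x => c * psi x).
Proof. by move=> tp; apply: (testM (chi := cst c)) => //; exact: smooth_cst. Qed.

Lemma testD O psi chi : test_function O psi -> test_function O chi ->
  test_function O (psi \+ chi).
Proof.
move=> [sp [K [cK KO K0]]] [sc [L [cL LO L0]]]; split; first exact: smoothD.
exists (K `|` L); split; first exact: compactU.
  by move=> x [/KO|/LO].
by move=> x /not_orP[Kx Lx]; rewrite /= K0// L0// addr0.
Qed.

Lemma L2_compact_support (A : set (plane R)) f (N : R) : measurable A -> continuous f ->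
  (forall x, N < `|x.1| \/ N < `|x.2| -> f x = 0) -> L2 A f.
Proof.
move=> mA cf f0.
suff : sqint (leb2 R) setT f by move/(@sqintS _ _ _ (leb2 R) _ _ _ mA measurableT); apply.
apply: integrable_sqint => //; first exact: continuous_plane_measurable.
apply: (@integrable_compact_support _ (fun x => f x ^+ 2) N).
  by move=> x; apply: cvgM; exact: cf.
by move=> x /f0 ->; rewrite expr0n.
Qed.

Lemma test_L2 O (A : set (plane R)) psi : measurable A -> test_function O psi -> L2 A psi.
Proof.
move=> mA tp; have [N H] := test_box tp.
by apply: L2_compact_support H => //; apply: smooth_continuous; case: tp.
Qed.

Lemma mu2_bounded_set (A : set (plane R)) : measurable A -> bounded_set A ->
  exists2 N : R, A `<=` crect (- N) N (- N) N & (leb2 R A < +oo)%E.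
Proof.
move=> mA [M [_ HM]].
have AN x : A x -> `|x.1| <= M + 1 /\ `|x.2| <= M + 1.
  move=> /(HM (M + 1) _); rewrite ltrDl ltr01 => /(_ isT).
  by rewrite {1}/Num.norm /= ge_max => /andP.
exists (M + 1); last exact: mu2_bounded_lt AN.
by move=> x /AN[x1 x2]; split; rewrite /= in_itv/= -ler_norml.
Qed.

Lemma L2_continuous (A : set (plane R)) f : measurable A -> bounded_set A -> continuous f -> L2 A f.
Proof.
move=> mA bA cf; have [N AN Aoo] := mu2_bounded_set mA bA.
have [M fM] := @continuous_bounded_crect _ f (- N) N (- N) N cf.
have [] // := @sqint_bounded _ _ _ (leb2 R) A mA f M _ Aoo.
  exact: continuous_plane_measurable.
by move=> x /AN/fM.
Qed.

Lemma inner_out (A : set (plane R)) f g : (forall x, ~ A x -> g x = 0) ->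
  inner A f g = inner setT f g.
Proof.
move=> g0; rewrite /inner [LHS]Rintegral_mkcond; apply: eq_Rintegral => x _.
by rewrite patchE; case: ifPn => //; rewrite notin_setE => /g0 ->; rewrite mulr0.
Qed.

(** The derivative of the compactly supported product [chi \* psi] has integral
    zero. *)
Lemma inner_pderiv O chi psi i : Ck 1 chi -> test_function O psi ->
  inner O chi (pderiv i psi) = - inner O (pderiv i chi) psi.
Proof.
move=> Cc tp; have tp' := test_pderiv i tp.
have [N pN] := test_box tp; have [N' pN'] := test_box tp'.
have Cp : Ck 1 psi by case: tp.
have cc := Ck_continuous Cc; have cp := Ck_continuous Cp.
have cc' := Ck_continuous (Ck_pderiv i Cc); have cp' := Ck_continuous (Ck_pderiv i Cp).
rewrite !inner_out; [|by move=> x; exact: test_out..].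
apply/eqP; rewrite -addr_eq0; apply/eqP.
rewrite /inner -RintegralD//.
- have := @integral_pderiv_compact _ (chi \* psi) i N (CkM Cc Cp).
  rewrite (pderivM _ Cc Cp) /Rintegral => -> //.
  by move=> x /pN /= ->; rewrite mulr0.
- apply: (@integrable_compact_support _ (chi \* pderiv i psi) N').
    by move=> x; apply: cvgM; [exact: cc|exact: cp'].
  by move=> x /pN' /= ->; rewrite mulr0.
- apply: (@integrable_compact_support _ (pderiv i chi \* psi) N).
    by move=> x; apply: cvgM; [exact: cc'|exact: cp].
  by move=> x /pN /= ->; rewrite mulr0.
Qed.

(** Vanishing off the rectangle and converging boundedly to its indicator
    function, these carry an identity between integrals from test functions to
    rectangles. *)
Definition rect_bump (a b c d : R) (n : nat) : plane R -> R :=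
  fun x => (ramp (n%:R * (x.1 - a)) * ramp (n%:R * (b - x.1))) *
           (ramp (n%:R * (x.2 - c)) * ramp (n%:R * (d - x.2))).

Lemma smooth_rect_bump a b c d n : smooth (rect_bump a b c d n).
Proof.
have r (k : R) (v : plane R) (h : plane R -> R) : (forall x, h x = k + dot v x) -> smooth (fun x => ramp (h x)).
  move=> hE; rewrite (_ : (fun x => _) = ridge (@ramp R) k v); last by apply/funext => x; rewrite hE.
  exact/smooth_ridge/smooth1_ramp.
apply: smoothM; apply: smoothM.
- by apply: (r (- (n%:R * a)) (n%:R, 0)) => x; rewrite /dot /=; ring.
- by apply: (r (n%:R * b) (- n%:R, 0)) => x; rewrite /dot /=; ring.
- by apply: (r (- (n%:R * c)) (0, n%:R)) => x; rewrite /dot /=; ring.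
- by apply: (r (n%:R * d) (0, - n%:R)) => x; rewrite /dot /=; ring.
Qed.

Lemma rect_bump_out a b c d n x : ~ orect a b c d x -> rect_bump a b c d n x = 0.
Proof.
move=> H; rewrite /rect_bump.
have z (t : R) : t <= 0 -> ramp (n%:R * t) = 0.
  by move=> t0; rewrite ramp_le0// mulr_ge0_le0.
have [xa|xa] := leP x.1 a; first by rewrite (z (x.1 - a)) ?mul0r// subr_le0.
have [xb|xb] := leP b x.1; first by rewrite (z (b - x.1)) ?mulr0 ?mul0r// subr_le0.
have [xc|xc] := leP x.2 c; first by rewrite (z (x.2 - c)) ?mul0r ?mulr0// subr_le0.
have [xd|xd] := leP d x.2; first by rewrite (z (d - x.2)) ?mulr0// subr_le0.
by exfalso; apply: H; split; rewrite /= in_itv/= ?xa ?xb ?xc ?xd.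
Qed.

Lemma rect_bump_bound a b c d n x : `|rect_bump a b c d n x| <= 1.
Proof.
by rewrite ger0_norm ?mulr_ge0 ?ramp_ge0// !mulr_ile1 ?mulr_ge0 ?ramp_ge0 ?ramp_le1.
Qed.

Lemma cvg_rect_bump a b c d x : rect_bump a b c d n x @[n --> \oo] --> (\1_(orect a b c d) x : R).
Proof.
have [Ox|Ox] := pselect (orect a b c d x); last first.
  rewrite indicE memNset//; apply: cvg_near_cst; apply: nearW => n.
  by rewrite rect_bump_out.
rewrite indicE mem_set//=; move: Ox => [/=]; rewrite !in_itv/= => /andP[? ?] /andP[? ?].
have r (t : R) : 0 < t -> ramp (n%:R * t) @[n --> \oo] --> (1 : R).
  by move=> t0; have := @cvg_ramp R t; rewrite t0.
have xa : 0 < x.1 - a by rewrite subr_gt0.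
have xb : 0 < b - x.1 by rewrite subr_gt0.
have xc : 0 < x.2 - c by rewrite subr_gt0.
have xd : 0 < d - x.2 by rewrite subr_gt0.
have H : rect_bump a b c d n x @[n --> \oo] --> (1 * 1 * (1 * 1) : R).
  by apply: cvgM; apply: cvgM; exact: r.
by move: H; rewrite !mulr1.
Qed.

Lemma test_rect_bump O a b c d n : crect a b c d `<=` O -> test_function O (rect_bump a b c d n).
Proof.
move=> KO; split; first exact: smooth_rect_bump.
exists (crect a b c d); split=> //; first exact: compact_crect.
by move=> x Kx; apply: rect_bump_out => /orect_sub.
Qed.

(** The fundamental lemma of the calculus of variations. Dominated convergence
    along [rect_bump] shows that [g] has integral zero over every rectangle whose
    closure lies in [O], and rectangles determine [g] almost everywhere. *)
Lemma fundamental_lemma O g : open O -> L2 O g ->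
  (forall psi, test_function O psi -> inner O g psi = 0) -> ae_eq_on O g (cst 0).
Proof.
move=> oO Lg g0.
have mO := open_plane_measurable oO.
have int0 a b c d : crect a b c d `<=` O -> (\int[leb2 R]_(x in orect a b c d) (g x)%:E = 0)%E.
  move=> KO; have mK := measurable_crect a b c d.
  have Koo : (leb2 R (crect a b c d) < +oo)%E by exact: mu2_crect_lt.
  have sgK : sqint (leb2 R) (crect a b c d) g := L2S mK mO KO Lg.
  have ig : (leb2 R).-integrable (crect a b c d) (EFin \o g) by exact: L2_integrable.
  have mb n : measurable_fun (crect a b c d) (rect_bump a b c d n).
    by apply: continuous_plane_measurable => //; apply: smooth_continuous; exact: smooth_rect_bump.
  have := @dominated_convergence _ _ _ (leb2 R) _ mK
    (fun n x => (g x * rect_bump a b c d n x)%:E)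
    (fun x => (g x * \1_(orect a b c d) x)%:E) (fun x => `|(g x)%:E|%E).
  case.
  - by move=> n; apply/measurable_EFinP; apply: measurable_funM; [case: sgK|exact: mb].
  - apply/measurable_EFinP; apply: measurable_funM; first by case: sgK.
    by apply: measurable_indic; exact: measurable_orect.
  - apply: nearW => x _; apply: cvg_EFin; first exact: nearW.
    by apply: cvgM; [exact: cvg_cst|exact: cvg_rect_bump].
  - exact: integrable_abse.
  - apply: nearW => x n _; rewrite lee_fin normrM.
    by rewrite -[leRHS]mulr1 ler_wpM2l// rect_bump_bound.
  move=> _ _.
  have E n : (\int[leb2 R]_(x in crect a b c d) (g x * rect_bump a b c d n x)%:E = 0)%E.
    have gz := g0 _ (test_rect_bump n KO).
    have sb : sqint (leb2 R) (crect a b c d) (rect_bump a b c d n).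
      exact: test_L2 (test_rect_bump n KO).
    rewrite -[LHS]fineK; last first.
      by apply: integrable_fin_num => //; exact: (L2_integrableM mK sgK sb).
    rewrite -[fine _]/(inner (crect a b c d) g (rect_bump a b c d n)) inner_out; last first.
      by move=> x Kx; apply: rect_bump_out => /orect_sub.
    rewrite -(@inner_out O) ?gz// => x Ox.
    by apply: rect_bump_out => /orect_sub/KO.
  rewrite (_ : [sequence _]_n = cst 0%E); last by apply/funext => n; exact: E.
  move=> /(cvg_lim (@ereal_hausdorff R)); rewrite lim_cst// => H; rewrite [RHS]H.
  rewrite [LHS]integral_mkcond [RHS]integral_mkcond; apply: eq_integral => x _.
  rewrite !patchE indicE; case: (boolP (x \in orect a b c d)) => xo.
    by rewrite mem_set ?mulr1//; apply: orect_sub; exact: set_mem.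
  by case: ifP; rewrite ?mulr0.
have aeQ n : ae_eq (leb2 R) (rat_rect O n) (EFin \o g) (cst 0%E).
  have [a [b [c [d [-> KO]]]]] := rat_rectP O n.
  have mQ := measurable_orect a b c d; have mK := measurable_crect a b c d.
  pose h : plane R -> R := g \_ (orect a b c d).
  have sgQ : sqint (leb2 R) (orect a b c d) g.
    by apply: (L2S mQ mO _ Lg); exact: subset_trans (@orect_sub _ _ _ _ _) KO.
  have Qoo : (leb2 R (orect a b c d) < +oo)%E.
    apply: le_lt_trans (mu2_crect_lt a b c d).
    by apply: le_measure; rewrite ?inE//; exact: orect_sub.
  have ig : (leb2 R).-integrable (orect a b c d) (EFin \o g) by exact: L2_integrable.
  have hE : EFin \o h = ((EFin \o g) \_ (orect a b c d)).
    by apply/funext => x; rewrite /h /= !patchE; case: ifP.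
  have ih : (leb2 R).-integrable setT (EFin \o h).
    by rewrite hE; apply/(@integrable_mkcond _ _ _ (leb2 R) _ (EFin \o g) mQ).
  have h0 (a' b' c' d' : R) : (\int[leb2 R]_(x in orect a' b' c' d') (h x)%:E = 0)%E.
    rewrite -(int0 (Num.max a' a) (Num.min b' b) (Num.max c' c) (Num.min d' d)); last first.
      move=> x [/= + +]; rewrite !in_itv/= !ge_max !le_min => /andP[/andP[_ ?] /andP[_ ?]].
      move=> /andP[/andP[_ ?] /andP[_ ?]]; apply: KO.
      by split; rewrite /= in_itv/=; apply/andP; split.
    rewrite -orectI [LHS]integral_mkcond [RHS]integral_mkcond; apply: eq_integral => x _.
    rewrite !patchE [X in _ = if X then _ else _]in_setI /h patchE.
    by case: (x \in orect a' b' c' d') => //=; case: ifP.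
  apply: filterS (ae_eq0_orects ih h0) => x /= /(_ I) + Qx.
  by rewrite /h patchE mem_set.
apply: (@ae_eq_bigcup _ _ _ (leb2 R) (rat_rect O)); last by rewrite bigcup_rat_rect.
by move=> n; apply: filterS (aeQ n) => x /= + Qx => /(_ Qx)[].
Qed.

End TestFunctions.

(** * Weak derivatives *)

Section WeakDerivatives.
Variable R : realType.
Implicit Types (O U : set (plane R)) (f g w psi chi : plane R -> R) (x n : plane R) (i j : bool).

Lemma inner_sub U O f psi : U `<=` O -> test_function U psi -> inner U f psi = inner O f psi.
Proof.
move=> UO tp; rewrite !inner_out// => x; first by move=> /(contra_not (@UO x)); exact: test_out.
by exact: test_out.
Qed.

(** The difference of the two derivatives is orthogonal to all test functions. *)
Lemma is_wderiv_unique O i w w' g g' : open O -> is_wderiv O i w g -> is_wderiv O i w' g' ->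
  ae_eq_on O w w' -> ae_eq_on O g g'.
Proof.
move=> oO [Lw [Lg wg]] [Lw' [Lg' wg']] ww; have mO := open_plane_measurable oO.
have Lgg := L2B mO Lg Lg'.
have : ae_eq_on O (g \- g') (cst 0).
  apply: fundamental_lemma => // psi tp.
  have Lp := test_L2 mO tp; have Lp' := test_L2 mO (test_pderiv i tp).
  rewrite innerBl//; apply/eqP; rewrite subr_eq0 -eqr_opp -wg// -wg'//; apply/eqP.
  by apply: ae_inner => //; exact: ae_refl.
move=> /(fun H => ae_comp2 (fun a b => a + b) H (ae_refl O g')) H.
apply: ae_trans (ae_trans _ H) _; apply: eq_ae => x _ /=; first by rewrite subrK.
by rewrite add0r.
Qed.

Lemma wderivP O i w g : is_wderiv O i w g -> is_wderiv O i w (wderiv O i w).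
Proof. by move=> wg; apply: (@xgetPex _ (cst 0) [set g | is_wderiv O i w g]); exists g. Qed.

Lemma wderiv_ae O i w g : open O -> is_wderiv O i w g -> ae_eq_on O (wderiv O i w) g.
Proof.
by move=> oO wg; apply: (is_wderiv_unique oO (wderivP wg) wg); exact: ae_refl.
Qed.

Lemma is_wderiv_ae O i w w' g g' : measurable O -> is_wderiv O i w g ->
  L2 O w' -> L2 O g' -> ae_eq_on O w w' -> ae_eq_on O g g' -> is_wderiv O i w' g'.
Proof.
move=> mO [Lw [Lg wg]] Lw' Lg' ww gg; split=> //; split=> // psi tp.
have Lp := test_L2 mO tp; have Lp' := test_L2 mO (test_pderiv i tp).
rewrite -(ae_inner mO Lw Lw' Lp' Lp' ww (@ae_refl _ _ _)).
by rewrite -(ae_inner mO Lg Lg' Lp Lp gg (@ae_refl _ _ _)) wg.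
Qed.

Lemma is_wderiv_comb O i (k l : R) w g w' g' : measurable O ->
  is_wderiv O i w g -> is_wderiv O i w' g' ->
  is_wderiv O i (fun x => k * w x + l * w' x) (fun x => k * g x + l * g' x).
Proof.
move=> mO [Lw [Lg wg]] [Lw' [Lg' wg']].
have kw := L2Z mO k Lw; have lw := L2Z mO l Lw'.
have kg := L2Z mO k Lg; have lg := L2Z mO l Lg'.
split; first exact: (L2D mO kw lw); split; first exact: (L2D mO kg lg).
move=> psi tp; have Lp := test_L2 mO tp; have Lp' := test_L2 mO (test_pderiv i tp).
have := innerDl mO kw lw Lp'; have := innerDl mO kg lg Lp.
rewrite !innerZl// => E1 E2; rewrite [LHS]E2 [in RHS]E1 wg// wg'//; ring.
Qed.

Lemma is_wderivS U O i w g : measurable U -> measurable O -> U `<=` O ->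
  is_wderiv O i w g -> is_wderiv U i w g.
Proof.
move=> mU mO UO [Lw [Lg wg]]; split; first exact: (L2S mU mO UO).
split; first exact: (L2S mU mO UO).
move=> psi tp; rewrite (inner_sub _ UO tp) (inner_sub _ UO (test_pderiv i tp)).
by apply: wg; exact: testS tp.
Qed.

Lemma is_wderiv_C1 O i chi : measurable O -> bounded_set O -> Ck 1 chi ->
  is_wderiv O i chi (pderiv i chi).
Proof.
move=> mO bO Cc; split; first by apply: L2_continuous => //; exact: Ck_continuous Cc.
split; last by move=> psi tp; exact: inner_pderiv.
by apply: L2_continuous => //; exact: Ck_continuous (Ck_pderiv i Cc).
Qed.

End WeakDerivatives.

Section WeakGradients.
Variable R : realType.
Implicit Types (O U : set (plane R)) (f w psi chi : plane R -> R) (x n : plane R) (i j : bool).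
Implicit Types (g : bool -> plane R -> R) (h : bool -> bool -> plane R -> R).

(** Weak derivatives are carried along explicitly, since [wderiv] is a choice
    determined only almost everywhere: [g] stands for the gradient of [w] and [h]
    for its Hessian. *)
Definition wgrad O w g := forall i, is_wderiv O i w (g i).
Definition whess O w g h :=
  wgrad O w g /\ forall i, wgrad O (g i) (h i).

Lemma H1P O w : H1 O w <-> L2 O w /\ exists g, wgrad O w g.
Proof.
split=> [[Lw H]|[Lw [g wg]]]; split=> //; last by move=> i; exists (g i).
by exists (fun i => wderiv O i w) => i; have [g wg] := H i; exact: wderivP wg.
Qed.

Lemma wgrad_H1 O w g : wgrad O w g -> H1 O w.
Proof. by move=> wg; apply/H1P; split; [case: (wg false)|exists g]. Qed.

Lemma H1_wgrad O w : H1 O w -> wgrad O w (fun i => wderiv O i w).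
Proof. by move=> [_ H] i; have [g wg] := H i; exact: wderivP wg. Qed.

Lemma H2_whess O w : H2 O w -> whess O w (fun i => wderiv O i w)
  (fun i j => wderiv O j (wderiv O i w)).
Proof. move=> [w1 w2]; split; first exact: H1_wgrad.
by move=> i; apply: H1_wgrad; exact: w2. Qed.

Lemma wgrad_ae O w w' g g' : measurable O -> wgrad O w g -> L2 O w' -> (forall i, L2 O (g' i)) ->
  ae_eq_on O w w' -> (forall i, ae_eq_on O (g i) (g' i)) -> wgrad O w' g'.
Proof. by move=> mO wg Lw' Lg' ww gg i; apply: (is_wderiv_ae mO (wg i)). Qed.

Lemma whess_wderiv O w g h i j : open O -> whess O w g h ->
  ae_eq_on O (wderiv O j (wderiv O i w)) (h i j) /\ L2 O (wderiv O j (wderiv O i w)).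
Proof.
move=> oO [wg wh]; have mO := open_plane_measurable oO.
have gi := wderiv_ae oO (wg i).
have wd := wderivP (wg i).
have H : is_wderiv O j (wderiv O i w) (h i j).
  apply: (is_wderiv_ae mO (wh i j)); [by case: wd => _ []|by case: (wh i j) => _ []|exact: ae_sym|exact: ae_refl].
by split; [exact: wderiv_ae|case: (wderivP H) => _ []].
Qed.

Lemma whess_H2 O w g h : open O -> whess O w g h -> H2 O w.
Proof.
move=> oO wh; split; first exact: wgrad_H1 (wh.1).
move=> i; have mO := open_plane_measurable oO.
have wd := wderivP (wh.1 i).
split; first by case: wd => _ [].
move=> j; exists (h i j); apply: (is_wderiv_ae mO (wh.2 i j)).
- by case: wd => _ [].
- by case: (wh.2 i j) => _ [].
- by apply: ae_sym; exact: wderiv_ae (wh.1 i).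
- exact: ae_refl.
Qed.

Lemma wgrad_comb O (k l : R) w g w' g' : measurable O -> wgrad O w g -> wgrad O w' g' ->
  wgrad O (fun x => k * w x + l * w' x) (fun i x => k * g i x + l * g' i x).
Proof. by move=> mO wg wg' i; exact: is_wderiv_comb. Qed.

Lemma whess_comb O (k l : R) w g h w' g' h' : measurable O -> whess O w g h -> whess O w' g' h' ->
  whess O (fun x => k * w x + l * w' x) (fun i x => k * g i x + l * g' i x)
    (fun i j x => k * h i j x + l * h' i j x).
Proof.
by move=> mO [wg wh] [wg' wh']; split; [exact: wgrad_comb|move=> i; exact: wgrad_comb].
Qed.

Lemma wgradS U O w g : measurable U -> measurable O -> U `<=` O -> wgrad O w g -> wgrad U w g.
Proof. by move=> mU mO UO wg i; exact: is_wderivS (wg i). Qed.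

Lemma whessS U O w g h : measurable U -> measurable O -> U `<=` O ->
  whess O w g h -> whess U w g h.
Proof. by move=> mU mO UO [wg wh]; split; [exact: wgradS wg|move=> i; exact: wgradS (wh i)]. Qed.

Lemma wgrad_C1 O chi : measurable O -> bounded_set O -> Ck 1 chi ->
  wgrad O chi (fun i => pderiv i chi).
Proof. by move=> mO bO Cc i; exact: is_wderiv_C1. Qed.

Lemma whess_smooth O chi : measurable O -> bounded_set O -> smooth chi ->
  whess O chi (fun i => pderiv i chi) (fun i j => pderiv j (pderiv i chi)).
Proof.
move=> mO bO sc; split; first by apply: wgrad_C1.
by move=> i; apply: wgrad_C1 => //; exact: smooth_pderiv.
Qed.

Definition lap f : plane R -> R := fun x => \sum_(i : bool) pderiv i (pderiv i f) x.

Lemma wlap_ae O w g h : open O -> whess O w g h ->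
  ae_eq_on O (wlap O w) (fun x => \sum_(i : bool) h i i x) /\ L2 O (wlap O w).
Proof.
move=> oO wh; have mO := open_plane_measurable oO.
have [at_ Lt] := whess_wderiv true true oO wh; have [af Lf] := whess_wderiv false false oO wh.
have E (F : bool -> plane R -> R) : (fun x => \sum_(i : bool) F i x) = (fun x => F true x + F false x).
  by apply/funext => x; rewrite big_bool.
rewrite /wlap !E; split; first exact: ae_comp2.
exact: (L2D mO Lt Lf).
Qed.

Lemma nderiv_ae O w g n : open O -> wgrad O w g ->
  ae_eq_on O (nderiv O n w) (fun x => dot (g false x, g true x) n) /\ L2 O (nderiv O n w).
Proof.
move=> oO wg; have mO := open_plane_measurable oO.
split.
  by apply: (ae_comp2 (fun a b => dot (a, b) n)); exact: wderiv_ae.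
have := L2D mO (L2Z mO n.1 (wderivP (wg false)).2.1) (L2Z mO n.2 (wderivP (wg true)).2.1).
by apply: eq_L2 => x _; rewrite /nderiv /dot /= ![n.1 * _]mulrC ![n.2 * _]mulrC.
Qed.

Lemma wlap_smooth O chi : open O -> bounded_set O -> smooth chi ->
  ae_eq_on O (wlap O chi) (lap chi) /\ L2 O (wlap O chi).
Proof.
move=> oO bO sc; have mO := open_plane_measurable oO.
exact: (wlap_ae oO (whess_smooth mO bO sc)).
Qed.

Lemma L2_lap_test O A psi : measurable A -> test_function O psi -> L2 A (lap psi).
Proof.
move=> mA tp; have := L2D mA (test_L2 mA (test_pderiv true (test_pderiv true tp)))
  (test_L2 mA (test_pderiv false (test_pderiv false tp))).
by apply: eq_L2 => x _; rewrite /lap big_bool.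
Qed.

Lemma H1_norm_bounds O w g : open O -> wgrad O w g ->
  [/\ norm2 O w <= H1_norm O w, forall i, norm2 O (g i) <= H1_norm O w &
      H1_norm O w <= norm2 O w + (norm2 O (g true) + norm2 O (g false))].
Proof.
move=> oO wg; have mO := open_plane_measurable oO.
have E i : norm2 O (wderiv O i w) = norm2 O (g i).
  by apply: ae_norm2 (wderiv_ae oO (wg i)) => //; [case: (wderivP (wg i)) => _ []|case: (wg i) => _ []].
have -> : H1_norm O w = Num.sqrt (norm2 O w ^+ 2 + (norm2 O (g true) ^+ 2 + norm2 O (g false) ^+ 2)).
  by rewrite /H1_norm; congr (Num.sqrt (_ + _)); rewrite big_bool; congr (_ ^+ 2 + _ ^+ 2); exact: E.
have n0 := norm2_ge0 O w; have n1 := norm2_ge0 O (g true); have n2 := norm2_ge0 O (g false).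
have s0 : 0 <= norm2 O w ^+ 2 by exact: sqr_ge0.
have s1 : 0 <= norm2 O (g true) ^+ 2 by exact: sqr_ge0.
have s2 : 0 <= norm2 O (g false) ^+ 2 by exact: sqr_ge0.
have le (a b : R) : 0 <= a -> 0 <= b -> a ^+ 2 <= b -> a <= Num.sqrt b.
  by move=> a0 b0 ab; rewrite -(ler_sqr (x := a)) ?nnegrE ?sqrtr_ge0// sqr_sqrtr.
split.
- by apply: le => //; lra.
- by case; apply: le => //; lra.
- rewrite -ler_sqr ?nnegrE ?sqrtr_ge0// ?addr_ge0// sqr_sqrtr; last by lra.
  by rewrite !sqrrD; nra.
Qed.

Lemma cvg0_squeeze (u v : nat -> R) : (forall k, 0 <= u k <= v k) ->
  v k @[k --> \oo] --> (0 : R) -> u k @[k --> \oo] --> (0 : R).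
Proof.
by move=> uv v0; apply: (@squeeze_cvgr _ _ _ _ (cst 0) v u); [exact: nearW|exact: cvg_cst|].
Qed.

Lemma H1_cvgP O w g (psi : nat -> plane R -> R) : open O -> bounded_set O ->
  wgrad O w g -> (forall k, smooth (psi k)) ->
  H1_norm O (w \- psi k) @[k --> \oo] --> (0 : R) <->
  norm2 O (w \- psi k) @[k --> \oo] --> (0 : R) /\
  forall i, norm2 O (g i \- pderiv i (psi k)) @[k --> \oo] --> (0 : R).
Proof.
move=> oO bO wg sp; have mO := open_plane_measurable oO.
have B k := H1_norm_bounds oO (wgrad_comb 1 (-1) mO wg (wgrad_C1 mO bO (sp k 1%N))).
have E (f f' : plane R -> R) : (fun x => 1 * f x + -1 * f' x) = f \- f'.
  by apply/funext => x; rewrite mul1r mulN1r.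
split=> [H|[H Hi]].
- split; first apply: cvg0_squeeze H => k.
    by rewrite norm2_ge0; have [+ _ _] := B k; rewrite E.
  move=> i; apply: cvg0_squeeze H => k; rewrite norm2_ge0.
  by have [_ + _] := B k => /(_ i); rewrite !E.
- apply: (@cvg0_squeeze _ (fun k => norm2 O (w \- psi k) + (norm2 O (g true \- pderiv true (psi k))
    + norm2 O (g false \- pderiv false (psi k))))).
    by move=> k; have [_ _ +] := B k; rewrite !E => ->; rewrite sqrtr_ge0.
  by rewrite -[X in _ --> X](addr0 0) -[X in _ --> _ + X](addr0 0); apply: cvgD => //; apply: cvgD.
Qed.

End WeakGradients.

(** * The trace inequality *)

Lemma integral_sqr_comb d (T : measurableType d) (R : realType) (mu : {measure set T -> \bar R})
  (D : set T) (mD : measurable D) (a b : R) (f g h : T -> R) :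
  sqint mu D f -> sqint mu D g -> sqint mu D h ->
  (\int[mu]_(x in D) (a * f x ^+ 2 + b * (g x ^+ 2 + h x ^+ 2))%:E =
   (a * nrm mu D f ^+ 2 + b * (nrm mu D g ^+ 2 + nrm mu D h ^+ 2))%:E)%E.
Proof.
move=> sf sg sh.
have i1 := sqint_integrable sf; have i2 := sqint_integrable sg.
have i3 := sqint_integrable sh.
have i23 := integrableD mD i2 i3.
under eq_integral do rewrite EFinD !EFinM EFinD.
rewrite integralD//; [|exact: (integrableZl mD a i1)|exact: (integrableZl mD b i23)].
rewrite (integralZl mD i1) (integralZl mD i23) integralD//.
by rewrite !(integral_EFin_dotp mD)// -!nrm_sqr -!EFinM -EFinD.
Qed.

Section TraceInequality.
Variable R : realType.
Implicit Types (psi : plane R -> R) (A B P u v x : plane R) (T : set (plane R)).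

Lemma is_derive_affine (c d s : R) : is_derive s (1 : R) (fun y : R => c * y + d) c.
Proof.
apply: (is_derive_eq (is_deriveD (is_deriveZ c (is_derive_id s (1 : R))) (is_derive_cst d s (1 : R)))).
by rewrite addr0; exact: mulr1.
Qed.

(** The function [(2 * s - 1) * F s ^+ 2] vanishes at [1/2] and is [- F 0 ^+ 2] at
    [0]; the integral of its derivative is estimated with Young's inequality. *)
Lemma endpoint_bound (F F' : R -> R) : (forall s : R, is_derive s (1 : R) F (F' s)) ->
  continuous F' ->
  ((F 0 ^+ 2)%:E <= \int[leb1 R]_(s in `]0%R, (2^-1)%R[) (3 * F s ^+ 2 + F' s ^+ 2)%:E)%E.
Proof.
move=> dF cF'.
have cF : continuous F by move=> s; exact: is_derive_continuous (dF s).
pose H (s : R) := (2 * s - 1) * (F s * F s).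
pose H' (s : R) := 2 * (F s * F s) + (2 * s - 1) * (2 * (F s * F' s)).
have cF2 : continuous (fun s => F s * F s) by move=> s; apply: cvgM; exact: cF.
have cFF' : continuous (fun s => F s * F' s) by move=> s; apply: cvgM; [exact: cF|exact: cF'].
have dH (s : R) : is_derive s (1 : R) H (H' s).
  have d1 : is_derive s (1 : R) (fun s => 2 * s - 1) 2.
    exact: is_derive_affine.
  apply: (is_derive_eq (is_deriveM d1 (is_deriveM (dF s) (dF s)))).
  by rewrite -[LHS]/((2 * s - 1) * (F s * F' s + F s * F' s) + (F s * F s) * 2) /H'; ring.
have cH' : continuous H'.
  move=> s; apply: cvgD; first by apply: cvgM; [exact: cvg_cst|exact: cF2].
  apply: cvgM; last by apply: cvgM; [exact: cvg_cst|exact: cFF'].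
  by apply: cvgB; [apply: cvgM; [exact: cvg_cst|exact: cvg_id]|exact: cvg_cst].
have h0 : (0 : R) < 2^-1 by rewrite invr_gt0.
have := FTC_line h0 dH cH'.
have -> : H 2^-1 - H 0 = F 0 ^+ 2 by rewrite /H expr2; field.
move=> <-.
have mH' : measurable_fun (`]0%R, (2^-1)%R[ : set R) H'.
  by apply: measurable_funS (continuous_measurable_fun cH').
have mHI (D : set R) : measurable D -> measurable_fun D (fun t => (H' t)%:E).
  by move=> mD; apply/measurable_EFinP; apply: measurable_funS (continuous_measurable_fun cH').
rewrite -integral_itv_bndo_bndc; last exact: mHI.
rewrite -integral_itv_obnd_cbnd; last exact: mHI.
apply: le_integral => //.
- apply: (@integrableS _ _ _ (leb1 R) `[0, 2^-1]) => //; first exact: subset_itv_oo_cc.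
  apply: continuous_compact_integrable; first exact: segment_compact.
  exact: continuous_subspaceT.
- apply: (@integrableS _ _ _ (leb1 R) `[0, 2^-1]) => //; first exact: subset_itv_oo_cc.
  apply: continuous_compact_integrable; first exact: segment_compact.
  apply: continuous_subspaceT => s; apply: cvgD.
    by apply: cvgM; [exact: cvg_cst|exact: cF2].
  by apply: cvgM; exact: cF'.
- move=> s; rewrite inE/= in_itv/= => /andP[s0 s1]; rewrite lee_fin /H'.
  have := sqr_ge0 (F s + (1 - 2 * s) * F' s).
  have : (1 - 2 * s) ^+ 2 * F' s ^+ 2 <= F' s ^+ 2.
    by rewrite ler_piMl ?sqr_ge0// -[leRHS](expr1n _ 2) lerXn2r ?nnegrE//; lra.
  by rewrite !expr2; nra.
Qed.

(** The previous bound along each segment parallel to [v], integrated over the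
    parallelogram by an affine change of variables. *)
Lemma parallelogram_trace T psi A u v : measurable T ->
  u.1 * v.2 - v.1 * u.2 != 0 ->
  (forall s t, 0 < s < 2^-1 -> 0 < t < 2^-1 -> T (A + t *: u + s *: v)) ->
  Ck 1 psi -> L2 T psi -> (forall i, L2 T (pderiv i psi)) ->
  (\int[leb1 R]_(t in `]0%R, (2^-1)%R[) (psi (A + t *: u) ^+ 2)%:E <=
   (`|u.1 * v.2 - v.1 * u.2|^-1 * (3 * norm2 T psi ^+ 2 + dot v v *
     (norm2 T (pderiv false psi) ^+ 2 + norm2 T (pderiv true psi) ^+ 2)))%:E)%E.
Proof.
move=> mT D0 inT Cp Lp Lp'.
pose k (x : plane R) := 3 * psi x ^+ 2 + dot v v * (pderiv false psi x ^+ 2 + pderiv true psi x ^+ 2).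
pose K (x : plane R) : \bar R := (\1_T x * k x)%:E.
have V0 : 0 <= dot v v by rewrite addr_ge0// -expr2 sqr_ge0.
have cp := Ck_continuous Cp; have cp' i := Ck_continuous (Ck_pderiv i Cp).
have k0 x : 0 <= k x.
  by rewrite addr_ge0//; apply: mulr_ge0 => //; rewrite ?sqr_ge0// addr_ge0// sqr_ge0.
have K0 x : (0 <= K x)%E by rewrite lee_fin; apply: mulr_ge0.
have ck : continuous k.
  move=> x; apply: cvgD; apply: cvgM; try exact: cvg_cst.
    by apply: cvgM; exact: cp.
  by apply: cvgD; apply: cvgM; exact: cp'.
have mk : measurable_fun setT k by exact: continuous_plane_measurable.
have mK : measurable_fun setT K.
  by apply/measurable_EFinP; apply: measurable_funM => //; exact: measurable_indic.
have intK : (\int[leb2 R]_x K x = (3 * norm2 T psi ^+ 2 + dot v v *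
     (norm2 T (pderiv false psi) ^+ 2 + norm2 T (pderiv true psi) ^+ 2))%:E)%E.
  have -> : (\int[leb2 R]_x K x = \int[leb2 R]_(x in T) (k x)%:E)%E.
    rewrite [RHS]integral_mkcond; apply: eq_integral => x _; rewrite patchE /K indicE.
    by case: (x \in T); rewrite ?mul1r ?mul0r.
  exact: (@integral_sqr_comb _ _ _ (leb2 R) T mT 3 (dot v v) psi (pderiv false psi) (pderiv true psi)
    Lp (Lp' false) (Lp' true)).
rewrite EFinM -intK -(@ge0_integral_affine2 R K A.1 A.2)//.
pose KK (y : plane R) := K (A.1 + u.1 * y.1 + v.1 * y.2, A.2 + u.2 * y.1 + v.2 * y.2).
have mKK : measurable_fun (setT : set (measurableTypeR R * measurableTypeR R)%type) KK.
  by apply: measurableT_comp => //; apply: measurable_fun_pair; exact: measurable_affine2.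
have KK0 y : (0 <= KK y)%E := K0 _.
have KKE s t : KK (t, s) = K (A + t *: u + s *: v).
  rewrite /KK; congr K; case: (A) (u) (v) => A1 A2 [u1 u2] [v1 v2] /=.
  rewrite -[RHS]/((A1 + t * u1 + s * v1, A2 + t * u2 + s * v2) : plane R).
  by congr pair; ring.
rewrite (@fubini_tonelli1 _ _ _ _ _ (leb1 R) (leb1 R) KK)//.
apply: (@le_trans _ _ (\int[leb1 R]_(t in `]0%R, (2^-1)%R[) fubini_F (leb1 R) KK t)%E); last first.
  apply: (@ge0_subset_integral _ _ _ (leb1 R) _ _ _ _ (fubini_F (leb1 R) KK)) => //.
  - exact: (@measurable_fun_fubini_tonelli_F _ _ _ _ _ (leb1 R) KK mKK KK0).
  - by move=> t _; apply: integral_ge0.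
apply: ge0_le_integral => //.
- by move=> t _; rewrite lee_fin sqr_ge0.
- apply/measurable_EFinP; apply: measurable_funX.
  have : continuous (fun t : R => psi (A + t *: u)).
    move=> t; apply: is_derive_continuous; exact: is_derive_C1_line.
  by move=> /continuous_measurable_fun; exact: measurable_funS.
- have mF := @measurable_fun_fubini_tonelli_F _ _ _ _ _ (leb1 R) KK mKK KK0.
  exact: (@measurable_funS _ _ _ _ setT _ _ measurableT (@subsetT _ _) mF).
- move=> t /=; rewrite in_itv/= => tI.
  pose F s := psi (A + t *: u + s *: v).
  pose F' s := dot (pderiv false psi (A + t *: u + s *: v), pderiv true psi (A + t *: u + s *: v)) v.
  have dF s : is_derive s (1 : R) F (F' s) by exact: is_derive_C1_line.
  have cl i : continuous (fun s : R => pderiv i psi (A + t *: u + s *: v)).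
    move=> s; apply: (continuous_comp (f := fun s : R => A + t *: u + s *: v)); last exact: cp'.
    by apply: cvgD; [exact: cvg_cst|apply: cvgZl; exact: cvg_id].
  have cF' : continuous F'.
    by move=> s; apply: cvgD; apply: cvgM; (exact: cl || exact: cvg_cst).
  have -> : psi (A + t *: u) = F 0 by rewrite /F scale0r addr0.
  apply: le_trans (endpoint_bound dF cF') _.
  apply: (@le_trans _ _ (\int[leb1 R]_(s in `]0%R, (2^-1)%R[) KK (t, s))%E); last first.
    have mK2 := measurableT_comp mKK (@measurable_pair1 _ _ _ _ t).
    apply: (@ge0_subset_integral _ _ _ (leb1 R) _ _ _ _ (fun s => KK (t, s))) => //.
  apply: ge0_le_integral => //.
  + by move=> s _; rewrite lee_fin addr_ge0 ?sqr_ge0//; apply: mulr_ge0 => //; exact: sqr_ge0.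
  + have cF : continuous (fun s => 3 * F s ^+ 2 + F' s ^+ 2).
      move=> s; apply: cvgD; last by apply: cvgM; exact: cF'.
      apply: cvgM; first exact: cvg_cst.
      by apply: cvgM; exact: is_derive_continuous (dF s).
    apply/measurable_EFinP.
    exact: (@measurable_funS _ _ _ _ setT _ _ measurableT (@subsetT _ _) (continuous_measurable_fun cF)).
  + have mK1 := measurableT_comp mKK (@measurable_pair1 _ _ _ _ t).
    exact: (@measurable_funS _ _ _ _ setT _ _ measurableT (@subsetT _ _) mK1).
  + move=> s /=; rewrite in_itv/= => sI; rewrite KKE /K lee_fin indicE mem_set; last exact: inT.
    rewrite mul1r /k lerD2l /F' /dot /=.
    move: (pderiv false psi _) (pderiv true psi _) => a b.
    by have := sqr_ge0 (a * v.2 - b * v.1); nra.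
Qed.

(** What the trace inequality uses of a triangle with side [A, B]: on each half
    of the side stands a parallelogram contained in [T]. Two are needed, as one
    parallelogram over the whole side would leave the triangle. *)
Definition trace_domain T A B := exists P,
  [/\ (B - A).1 * (P - A).2 - (P - A).1 * (B - A).2 != 0,
      forall s t, 0 < s < 2^-1 -> 0 < t < 2^-1 -> T (A + t *: (B - A) + s *: (P - A)) &
      forall s t, 0 < s < 2^-1 -> 0 < t < 2^-1 -> T (B + t *: (A - B) + s *: (P - B))].

Lemma integral_halves (f : R -> R) : continuous f -> (forall t, 0 <= f t) ->
  (\int[leb1 R]_(t in `[0%R, 1%R]) (f t)%:E =
   \int[leb1 R]_(t in `]0%R, (2^-1)%R[) (f t)%:E +
   \int[leb1 R]_(t in `]0%R, (2^-1)%R[) (f (1 - t)%R)%:E)%E.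
Proof.
move=> cf f0; have mf := continuous_measurable_fun cf.
have mfS (D : set R) : measurable D -> measurable_fun D (EFin \o f).
  by move=> mD; apply/measurable_EFinP; exact: measurable_funS mf.
have h01 : 0 <= (2^-1 : R) <= 1 by apply/andP; split; lra.
have -> : (`[0, 1]%classic : set R) = `[0, 2^-1]%classic `|` `]2^-1, 1]%classic.
  by apply: itv_bndbnd_setU; rewrite bnd_simp; case/andP: h01.
rewrite ge0_integral_setU//=; last 3 first.
- by apply: mfS; apply: measurableU.
- by move=> t _; rewrite lee_fin.
- apply/disj_setPS => t [/=]; rewrite !in_itv/= => /andP[_ ?] /andP[? _]; lra.
congr (_ + _)%E.
  rewrite integral_itv_obnd_cbnd; last exact: mfS.
  by rewrite integral_itv_bndo_bndc//; exact: mfS.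
rewrite -integral_itv_bndo_bndc; last exact: mfS.
rewrite [LHS]integral_mkcond [RHS]integral_mkcond.
pose g (t : R) : \bar R := ((EFin \o f) \_ `]2^-1, 1[%classic) t.
have mg : measurable_fun setT g.
  by apply/(measurable_restrictT _ _).1 => //; exact: mfS.
have g0 t : (0 <= g t)%E by rewrite /g patchE; case: ifP => //; rewrite lee_fin.
have n1 : (-1 : R) != 0 by rewrite oppr_eq0 oner_eq0.
have := ge0_integral_affine 1 n1 mg g0.
rewrite normrN normr1 invr1 mul1e => <-.
apply: eq_integral => t _; rewrite /g !patchE mulN1r addrC.
rewrite (_ : (1 - t \in `]2^-1, 1[%classic) = (t \in `]0, 2^-1[%classic))//.
by apply/idP/idP; rewrite !inE/= !in_itv/= => /andP[? ?]; apply/andP; split; lra.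
Qed.

(** The bound for one parallelogram is used over each half of the side. *)
Lemma trace_inequality T A B : measurable T -> trace_domain T A B ->
  exists2 C : R, 0 <= C & forall psi, Ck 1 psi -> L2 T psi -> (forall i, L2 T (pderiv i psi)) ->
    sqint (leb1 R) `[0, 1] (psi \o param A B) /\
    nrm (leb1 R) `[0, 1] (psi \o param A B) <=
      C * (norm2 T psi + (norm2 T (pderiv true psi) + norm2 T (pderiv false psi))).
Proof.
move=> mT [P [D0 T1 T2]].
have D0' : (A - B).1 * (P - B).2 - (P - B).1 * (A - B).2 != 0.
  by rewrite -oppr_eq0; move: D0; apply: contra_neq => <-; rewrite /=; ring.
pose V1 := dot (P - A) (P - A); pose V2 := dot (P - B) (P - B).
have V10 : 0 <= V1 by rewrite addr_ge0// -expr2 sqr_ge0.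
have V20 : 0 <= V2 by rewrite addr_ge0// -expr2 sqr_ge0.
pose d1 := `|(B - A).1 * (P - A).2 - (P - A).1 * (B - A).2|^-1.
pose d2 := `|(A - B).1 * (P - B).2 - (P - B).1 * (A - B).2|^-1.
have d10 : 0 <= d1 by rewrite invr_ge0.
have d20 : 0 <= d2 by rewrite invr_ge0.
pose M := d1 * (3 + V1) + d2 * (3 + V2).
have M0 : 0 <= M by rewrite addr_ge0// mulr_ge0// addr_ge0.
exists (Num.sqrt M); first exact: sqrtr_ge0.
move=> psi Cp Lp Lp'.
have cl : continuous (fun t : R => psi (param A B t)).
  move=> t; apply: is_derive_continuous; exact: is_derive_C1_line.
set I := (\int[leb1 R]_(t in `[0%R, 1%R]) ((psi \o param A B) t ^+ 2)%:E)%E.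
pose S := norm2 T psi + (norm2 T (pderiv true psi) + norm2 T (pderiv false psi)).
have IM : (I <= (M * S ^+ 2)%:E)%E.
  rewrite /I (@integral_halves (fun t => psi (param A B t) ^+ 2)); last 2 first.
  - by move=> t; apply: cvgM; exact: cl.
  - by move=> t; exact: sqr_ge0.
  have := parallelogram_trace mT D0 T1 Cp Lp Lp'.
  have := parallelogram_trace mT D0' T2 Cp Lp Lp'.
  rewrite -/d1 -/d2 -/V1 -/V2.
  have -> : (\int[leb1 R]_(t in `]0%R, 2^-1%R[) (psi (B + t *: (A - B)) ^+ 2)%:E =
    \int[leb1 R]_(t in `]0%R, 2^-1%R[) (psi (param A B (1 - t)) ^+ 2)%:E)%E.
    apply: eq_integral => t _; congr ((psi _ ^+ 2)%:E); rewrite /param.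
    case: (A) (B) => A1 A2 [B1 B2].
    rewrite -[LHS]/((B1 + t * (A1 - B1), B2 + t * (A2 - B2)) : plane R).
    rewrite -[RHS]/((A1 + (1 - t) * (B1 - A1), A2 + (1 - t) * (B2 - A2)) : plane R).
    by congr pair; ring.
  move=> H2 H1; apply: le_trans (leeD H1 H2) _; rewrite -EFinD lee_fin /M /S.
  have n0 := norm2_ge0 T psi; have n1 := norm2_ge0 T (pderiv true psi).
  have n2 := norm2_ge0 T (pderiv false psi).
  move: (norm2 T psi) (norm2 T (pderiv true psi)) (norm2 T (pderiv false psi)) n0 n1 n2 => a b c a0 b0 c0.
  have key (V : R) : 0 <= V -> 3 * a ^+ 2 + V * (c ^+ 2 + b ^+ 2) <= (3 + V) * (a + (b + c)) ^+ 2.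
    move=> V0; rewrite [leRHS]mulrDl; apply: lerD.
      by rewrite ler_wpM2l// lerXn2r ?nnegrE ?addr_ge0// lerDl addr_ge0.
    rewrite ler_wpM2l//; rewrite !expr2; nra.
  rewrite [leRHS]mulrDl -[X in _ <= X + _]mulrA -[X in _ <= _ + X]mulrA.
  by apply: lerD; rewrite ler_wpM2l// key.
have sp : sqint (leb1 R) `[0, 1] (psi \o param A B).
  split; last by apply: le_lt_trans IM _; rewrite ltry.
  exact: measurable_funS (continuous_measurable_fun cl).
split=> //.
have S0 : 0 <= S by rewrite !addr_ge0 ?norm2_ge0.
rewrite -ler_sqr ?nnegrE ?nrm_ge0 ?mulr_ge0 ?sqrtr_ge0//.
by rewrite nrm_sqr exprMn [in leRHS]sqr_sqrtr// -lee_fin -integral_EFin_dotp.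
Qed.

End TraceInequality.

(** * Traces *)

Section Traces.
Variable R : realType.
Implicit Types (psi w f : plane R -> R) (A B P x : plane R) (O T : set (plane R)).
Implicit Types (g : bool -> plane R -> R) (gam : plane R -> R).

Local Notation sI := (sqint (leb1 R) `[0, 1]).
Local Notation nI := (nrm (leb1 R) `[0, 1]).
Local Notation aeI := (ae_eq (leb1 R) `[0%R, 1%R]%classic).
Let mI : measurable (`[0, 1]%classic : set R) := measurable_itv `[0, 1].

Lemma seg_sqintD (f g : R -> R) : sI f -> sI g -> sI (f \+ g).
Proof. exact: (@sqintD _ _ _ (leb1 R) _ mI). Qed.
Lemma seg_sqintB (f g : R -> R) : sI f -> sI g -> sI (f \- g).
Proof. exact: (@sqintB _ _ _ (leb1 R) _ mI). Qed.
Lemma seg_sqintZ k (f : R -> R) : sI f -> sI (fun t : R => k * f t).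
Proof. exact: (@sqintZ _ _ _ (leb1 R) _ mI). Qed.
Lemma seg_nrmD (f g : R -> R) : sI f -> sI g -> nI (f \+ g) <= nI f + nI g.
Proof. exact: (@nrmD _ _ _ (leb1 R) _ mI). Qed.
Lemma seg_nrm_diag (f : R -> R) : nI (f \- f) = 0.
Proof. exact: (@nrm_diag _ _ _ (leb1 R)). Qed.
Lemma seg_nrm_eq0 (f : R -> R) : sI f -> nI f = 0 -> aeI f (cst 0).
Proof. exact: (@nrm_eq0 _ _ _ (leb1 R) _ mI). Qed.

Lemma seg_normE A B f : seg_norm A B f = Num.sqrt (edist A B) * nI (f \o param A B).
Proof. by rewrite -sqrtrM ?sqrtr_ge0. Qed.

Lemma edistC A B : edist A B = edist B A.
Proof. by rewrite /edist /dot /=; congr Num.sqrt; ring. Qed.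

Lemma edist_gt0 A B : A != B -> 0 < edist A B.
Proof.
move=> AB; rewrite sqrtr_gt0 lt_neqAle addr_ge0 -?expr2 ?sqr_ge0// andbT eq_sym.
apply: contra AB; rewrite /dot -!expr2 paddr_eq0 ?sqr_ge0// !sqrf_eq0 => /andP[/eqP a /eqP b].
apply/eqP; move: a b; case: (A) (B) => a1 a2 [b1 b2] /= /eqP + /eqP.
by rewrite !subr_eq0 => /eqP -> /eqP ->.
Qed.

Lemma seg_norm_cvg0 A B (f : nat -> plane R -> R) : A != B ->
  seg_norm A B (f k) @[k --> \oo] --> (0 : R) <->
  nI (f k \o param A B) @[k --> \oo] --> (0 : R).
Proof.
move=> AB; have d0 : 0 < Num.sqrt (edist A B) by rewrite sqrtr_gt0 edist_gt0.
have E k : seg_norm A B (f k) = Num.sqrt (edist A B) * nI (f k \o param A B) := seg_normE _ _ _.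
split=> H.
  have -> : (fun k => nI (f k \o param A B)) = (fun k => (Num.sqrt (edist A B))^-1 * seg_norm A B (f k)).
    by apply/funext => k; rewrite E mulKf ?gt_eqF.
  by rewrite -[X in _ --> X](mulr0 (Num.sqrt (edist A B))^-1); apply: cvgM => //; exact: cvg_cst.
have -> : (fun k => seg_norm A B (f k)) = (fun k => Num.sqrt (edist A B) * nI (f k \o param A B)).
  by apply/funext => k; rewrite E.
by rewrite -[X in _ --> X](mulr0 (Num.sqrt (edist A B))); apply: cvgM => //; exact: cvg_cst.
Qed.

(** Convergence in H^1 is expressed through the weak gradient [g], so that it
    restricts at once to subsets of [O]. *)
Definition trace_seq O A B w g gam (psi : nat -> plane R -> R) :=
  [/\ forall k, smooth (psi k), norm2 O (w \- psi k) @[k --> \oo] --> (0 : R),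
      forall i, norm2 O (g i \- pderiv i (psi k)) @[k --> \oo] --> (0 : R)
    & nI ((gam \- psi k) \o param A B) @[k --> \oo] --> (0 : R)].

Lemma is_traceP O A B w g gam : open O -> bounded_set O -> A != B -> wgrad O w g ->
  is_trace O A B w gam <-> seg_L2 A B gam /\ exists psi : nat -> plane R -> R, trace_seq O A B w g gam psi.
Proof.
move=> oO bO AB wg; split.
  move=> [_ sg [psi [sp H1 H2]]]; split=> //; exists psi.
  have [Hw Hg] := (H1_cvgP oO bO wg sp).1 H1.
  by split=> //; apply/(seg_norm_cvg0 (fun k => gam \- psi k) AB).
move=> [sg [psi [sp Hw Hg Ht]]]; split=> //; first exact: wgrad_H1 wg.
exists psi; split=> //; first exact/(H1_cvgP oO bO wg sp).
exact/(seg_norm_cvg0 (fun k => gam \- psi k) AB).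
Qed.

Lemma continuous_param psi A B : continuous psi -> continuous (psi \o param A B).
Proof.
move=> cp t; apply: (continuous_comp (f := param A B)); last exact: cp.
by apply: cvgD; [exact: cvg_cst|apply: cvgZl; exact: cvg_id].
Qed.

Lemma sqint_param psi A B : continuous psi -> sI (psi \o param A B).
Proof.
move=> /(@continuous_param _ A B) cp.
have := @continuous_compact_integrable R (fun t => (psi \o param A B) t ^+ 2) `[0, 1]%classic
  (@segment_compact _ _ _).
move=> H; apply: integrable_sqint => //.
  exact: measurable_funS (continuous_measurable_fun cp).
by apply: H; apply: continuous_subspaceT => t; apply: cvgM; exact: cp.
Qed.

Lemma cvg0_uniq (a : R) (u : nat -> R) : 0 <= a -> (forall k, a <= u k) ->
  u k @[k --> \oo] --> (0 : R) -> a = 0.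
Proof.
move=> a0 au u0; apply/eqP; rewrite eq_le a0 andbT.
by apply: (ler_cvg_to (cvg_cst a) u0); exact: nearW.
Qed.

Lemma cvgD0 (u v : nat -> R) : u k @[k --> \oo] --> (0 : R) -> v k @[k --> \oo] --> (0 : R) ->
  (u k + v k) @[k --> \oo] --> (0 : R).
Proof. by move=> u0 v0; rewrite -[X in _ --> X](addr0 0); exact: cvgD. Qed.

Lemma cvgZ0 (c : R) (u : nat -> R) : u k @[k --> \oo] --> (0 : R) ->
  (c * u k) @[k --> \oo] --> (0 : R).
Proof. by move=> u0; rewrite -[X in _ --> X](mulr0 c); apply: cvgM => //; exact: cvg_cst. Qed.

Lemma seg_nrm_triangle f1 f2 f3 A B : sI (f1 \o param A B) -> sI (f2 \o param A B) -> sI (f3 \o param A B) ->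
  nI ((f1 \- f3) \o param A B) <= nI ((f1 \- f2) \o param A B) + nI ((f2 \- f3) \o param A B).
Proof.
move=> s1 s2 s3; rewrite (@eq_nrm _ _ _ (leb1 R) _ _
  (((f1 \- f2) \o param A B) \+ ((f2 \- f3) \o param A B))); last first.
  by move=> t _ /=; rewrite addrA subrK.
exact: (seg_nrmD (seg_sqintB s1 s2) (seg_sqintB s2 s3)).
Qed.

Lemma pderivB i f psi : smooth f -> smooth psi ->
  pderiv i (f \- psi) = pderiv i f \- pderiv i psi.
Proof.
move=> sf sp; have -> : f \- psi = f \+ (fun x => -1 * psi x).
  by apply/funext => x /=; rewrite mulN1r.
rewrite (pderivD i (sf 1%N) (CkZ (-1) (sp 1%N))) (pderivZ i (-1) (sp 1%N)).
by apply/funext => x /=; rewrite mulN1r.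
Qed.

(** By the trace inequality, two sequences of smooth functions with the same
    limit in H^1 have the same limit on the side. *)
Lemma trace_unique T A B w w' g g' gam gam' : open T -> bounded_set T -> A != B ->
  trace_domain T A B -> wgrad T w g -> wgrad T w' g' -> ae_eq_on T w w' ->
  is_trace T A B w gam -> is_trace T A B w' gam' ->
  aeI (gam \o param A B) (gam' \o param A B).
Proof.
move=> oT bT AB dT wg wg' ww.
have mT := open_plane_measurable oT.
move=> /(is_traceP _ oT bT AB wg)[sg [psi [sp pw pg pt]]].
move=> /(is_traceP _ oT bT AB wg')[sg' [psi' [sp' pw' pg' pt']]].
have [C C0 HC] := trace_inequality mT dT.
have gg i : ae_eq_on T (g i) (g' i) := is_wderiv_unique oT (wg i) (wg' i) ww.
have sgg : sI ((gam \- gam') \o param A B) := seg_sqintB sg sg'.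
have nrm0 : nI ((gam \- gam') \o param A B) = 0.
  pose u k := nI ((gam \- psi k) \o param A B) + (C * ((norm2 T (w \- psi k) + norm2 T (w' \- psi' k)) +
     ((norm2 T (g true \- pderiv true (psi k)) + norm2 T (g' true \- pderiv true (psi' k))) +
      (norm2 T (g false \- pderiv false (psi k)) + norm2 T (g' false \- pderiv false (psi' k)))))
     + nI ((gam' \- psi' k) \o param A B)).
  apply: (@cvg0_uniq _ u); first exact: nrm_ge0.
  - move=> k.
    have cp : continuous (psi k) by exact: smooth_continuous.
    have cp' : continuous (psi' k) by exact: smooth_continuous.
    have s1 := sqint_param A B cp; have s1' := sqint_param A B cp'.
    apply: le_trans (seg_nrm_triangle sg s1 sg') _; rewrite lerD2l.
    apply: le_trans (seg_nrm_triangle s1 s1' sg') _; apply: lerD; last first.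
      rewrite (_ : nI _ = nI ((gam' \- psi' k) \o param A B))//.
      by rewrite nrm_distC.
    have Cd : Ck 1 (psi k \- psi' k) by exact: (smoothB (sp k) (sp' k)).
    have dif i := pderivB i (sp k) (sp' k).
    have Lc f : continuous f -> L2 T f by exact: L2_continuous.
    have cpi i : continuous (pderiv i (psi k)) by apply: smooth_continuous; exact: smooth_pderiv.
    have cpi' i : continuous (pderiv i (psi' k)) by apply: smooth_continuous; exact: smooth_pderiv.
    have Ld := L2B mT (Lc _ cp) (Lc _ cp').
    have Ldi i : L2 T (pderiv i (psi k \- psi' k)) by rewrite dif; apply: (L2B mT); apply: Lc.
    have [_ +] := HC _ Cd Ld Ldi; move=> /le_trans; apply; rewrite ler_wpM2l// !dif.
    have tri f f' p p' : L2 T f -> L2 T f' -> L2 T p -> L2 T p' -> ae_eq_on T f f' ->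
        norm2 T (p \- p') <= norm2 T (f \- p) + norm2 T (f' \- p').
      move=> Lf Lf' Lp Lp' ff.
      have <- : norm2 T (f \- p') = norm2 T (f' \- p').
        apply: (ae_norm2 mT) (L2B mT Lf Lp') (L2B mT Lf' Lp') _.
        exact: (ae_comp2 (fun a b => a - b) ff (@ae_refl _ _ _)).
      have -> : p \- p' = (f \- p') \- (f \- p) by apply/funext => x /=; ring.
      by rewrite addrC; apply: (norm2B mT); exact: (L2B mT).
    have Lw := (wg false).1; have Lw' := (wg' false).1.
    have Lg i := (wg i).2.1; have Lg' i := (wg' i).2.1.
    by apply: lerD; [apply: tri => //; exact: Lc|apply: lerD; apply: tri => //; exact: Lc].
  - exact: (cvgD0 pt (cvgD0 (cvgZ0 C (cvgD0 (cvgD0 pw pw') (cvgD0 (cvgD0 (pg true) (pg' true))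
      (cvgD0 (pg false) (pg' false))))) pt')).
have := seg_nrm_eq0 sgg nrm0; apply: filterS => t /= + tI => /(_ tI)/eqP.
by rewrite subr_eq0 => /eqP.
Qed.

(** The trace inequality makes the restrictions to the side Cauchy in L_2. *)
Lemma trace_seq_exists T A B w g (psi : nat -> plane R -> R) : open T -> bounded_set T -> A != B ->
  trace_domain T A B -> wgrad T w g -> (forall k, smooth (psi k)) ->
  norm2 T (w \- psi k) @[k --> \oo] --> (0 : R) ->
  (forall i, norm2 T (g i \- pderiv i (psi k)) @[k --> \oo] --> (0 : R)) ->
  exists2 gam, seg_L2 A B gam & trace_seq T A B w g gam psi.
Proof.
move=> oT bT AB dT wg sp pw pg.
have mT := open_plane_measurable oT.
have [C C0 HC] := trace_inequality mT dT.
pose e k := C * (norm2 T (w \- psi k) + (norm2 T (g true \- pderiv true (psi k)) +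
   norm2 T (g false \- pderiv false (psi k)))).
have ecv : e k @[k --> \oo] --> (0 : R).
  exact: (cvgZ0 C (cvgD0 pw (cvgD0 (pg true) (pg false)))).
have cp k : continuous (psi k) by exact: smooth_continuous.
have cpi k i : continuous (pderiv i (psi k)) by apply: smooth_continuous; exact: smooth_pderiv.
have Lc f : continuous f -> L2 T f by exact: L2_continuous.
have sI_ k := sqint_param A B (cp k).
have cauchy k l : nI ((psi k \- psi l) \o param A B) <= e k + e l.
  have Cd : Ck 1 (psi k \- psi l) by exact: (smoothB (sp k) (sp l)).
  have dif i := pderivB i (sp k) (sp l).
  have Ldi i : L2 T (pderiv i (psi k \- psi l)) by rewrite dif; apply: (L2B mT); apply: Lc.
  have [_ +] := HC _ Cd (L2B mT (Lc _ (cp k)) (Lc _ (cp l))) Ldi.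
  move=> /le_trans; apply; rewrite /e -mulrDr ler_wpM2l// !dif.
  have tri f p p' : L2 T f -> L2 T p -> L2 T p' ->
      norm2 T (p \- p') <= norm2 T (f \- p) + norm2 T (f \- p').
    move=> Lf Lp Lp'.
    have -> : p \- p' = (f \- p') \- (f \- p) by apply/funext => x /=; ring.
    by rewrite addrC; apply: (norm2B mT); exact: (L2B mT).
  have t0 := tri _ _ _ (wg false).1 (Lc _ (cp k)) (Lc _ (cp l)).
  have t1 i := tri _ _ _ (wg i).2.1 (Lc _ (cpi k i)) (Lc _ (cpi l i)).
  rewrite addrACA [X in _ <= _ + X]addrACA; exact: lerD t0 (lerD (t1 true) (t1 false)).
have half_gt0 n : 0 < (2^-1 : R) ^+ n by rewrite exprn_gt0.
have N_ n : exists N, forall k, (N <= k)%N -> e k <= 2^-1 ^+ n / 2.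
  have d0 : 0 < (2^-1 : R) ^+ n / 2 by rewrite divr_gt0.
  have /cvgrPdist_le/(_ _ d0)[N _ HN] := ecv.
  by exists N => k /HN; rewrite sub0r normrN => /(le_trans (ler_norm _)).
have [N HN] := choice N_.
(* A subsequence with increments at most [2^-1 ^+ n], so that it converges fast. *)
pose j := fix j n := if n is n'.+1 then maxn (j n') (N n) else N 0%N.
have jN n : (N n <= j n)%N by case: n => //= n; rewrite leq_maxr.
have jS n : (j n <= j n.+1)%N by rewrite /= leq_maxl.
have close n k : (j n <= k)%N -> nI ((psi (j n) \- psi k) \o param A B) <= 2^-1 ^+ n.
  move=> jk; apply: le_trans (cauchy _ _) _.
  by apply: le_trans (lerD (HN n _ (jN n)) (HN n _ (leq_trans (jN n) jk))) _; rewrite -splitr.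
have [|G sG HG] := @fast_cauchy_cvg _ _ _ (leb1 R) _ mI (fun n => psi (j n) \o param A B)
  (fun n => sI_ (j n)).
  by move=> n; rewrite nrm_distC; exact: close.
(* [G] is a function of the parameter on the side; extend it constantly across the side. *)
pose gam x := G (dot (x - A) (B - A) / dot (B - A) (B - A)).
have gamE t : gam (param A B t) = G t.
  have : dot (B - A) (B - A) != 0.
    by have := edist_gt0 AB; rewrite edistC /edist sqrtr_gt0 => /gt_eqF ->.
  rewrite /gam /param; move: (B - A) => [v1 v2] v0; congr G.
  rewrite addrC addKr -[LHS]/((t * v1 * v1 + t * v2 * v2) / dot (v1, v2) (v1, v2)).
  apply: (mulIf v0); rewrite divfK//; rewrite /dot /=; ring.
have sgam : seg_L2 A B gam.
  by apply: (eq_sqint _ sG) => t _ /=; rewrite gamE.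
exists gam => //; split=> //.
apply/cvgrPdist_le => eps eps0.
have : (3 * 2^-1 ^+ n) @[n --> \oo] --> (0 : R).
  by apply: cvgZ0; apply: cvg_expr; rewrite ger0_norm//; lra.
move=> /cvgrPdist_le/(_ _ eps0)[n _ Hn]; exists (j n) => // k /= jk.
rewrite sub0r normrN ger0_norm ?nrm_ge0//.
apply: le_trans (seg_nrm_triangle sgam (sI_ (j n)) (sI_ k)) _.
have h1 : nI ((gam \- psi (j n)) \o param A B) <= 2 * 2^-1 ^+ n.
  apply: le_trans (HG n); rewrite le_eqVlt; apply/orP; left; apply/eqP.
  by apply: eq_nrm => t _ /=; rewrite gamE.
have := Hn n (leqnn n); rewrite /= sub0r normrN ger0_norm; last by apply: mulr_ge0 => //; exact: ltW.
apply: le_trans; apply: le_trans (lerD h1 (close n k jk)) _.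
by rewrite -[X in _ + X]mul1r -[leLHS]mulrDl (_ : 2 + 1 = 3 :> R)//; ring.
Qed.

Lemma trace_ae T A B w g gam : open T -> bounded_set T -> A != B -> trace_domain T A B ->
  wgrad T w g -> is_trace T A B w gam ->
  seg_L2 A B (trace T A B w) /\ aeI (trace T A B w \o param A B) (gam \o param A B).
Proof.
move=> oT bT AB dT wg tg.
have tr : is_trace T A B w (trace T A B w).
  by apply: (@xgetPex _ (cst 0) [set h | is_trace T A B w h]); exists gam.
split; first by case: tr.
exact: (trace_unique oT bT AB dT wg wg (@ae_refl _ _ _) tr tg).
Qed.

Lemma is_trace_ae T A B w g gam w' : open T -> bounded_set T -> A != B -> wgrad T w g ->
  L2 T w' -> ae_eq_on T w w' -> is_trace T A B w gam -> is_trace T A B w' gam.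
Proof.
move=> oT bT AB wg Lw' ww; have mT := open_plane_measurable oT.
have wg' : wgrad T w' g.
  apply: (wgrad_ae mT wg Lw' _ ww) => i; last exact: ae_refl.
  by case: (wg i) => _ [].
move=> /(is_traceP _ oT bT AB wg)[sg [psi [sp pw pg pt]]].
apply/(is_traceP _ oT bT AB wg'); split=> //; exists psi; split=> //.
suff E k : norm2 T (w' \- psi k) = norm2 T (w \- psi k) by under eq_fun do rewrite E.
have Lp := L2_continuous mT bT (smooth_continuous (sp k)).
apply: esym; apply: (ae_norm2 mT); [exact: (L2B mT (wg false).1 Lp)|exact: (L2B mT Lw' Lp)|].
exact: (ae_comp2 (fun a b => a - b) ww (@ae_refl _ _ _)).
Qed.

Lemma is_traceS U T A B w g gam : open U -> open T -> bounded_set T -> A != B -> U `<=` T ->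
  wgrad T w g -> is_trace T A B w gam -> is_trace U A B w gam.
Proof.
move=> oU oT bT AB UT wg; have mT := open_plane_measurable oT; have mU := open_plane_measurable oU.
have bU : bounded_set U.
  by case: bT => M [rM HM]; exists M; split=> // x Mx y /UT; exact: HM.
have Lc f : continuous f -> L2 T f by exact: L2_continuous.
move=> /(is_traceP _ oT bT AB wg)[sg [psi [sp pw pg pt]]].
apply/(is_traceP _ oU bU AB (wgradS mU mT UT wg)); split=> //; exists psi; split=> //.
  apply: cvg0_squeeze pw => k; rewrite norm2_ge0; apply: (norm2S mU mT UT).
  by apply: (L2B mT (wg false).1); apply: Lc; exact: smooth_continuous.
move=> i; apply: cvg0_squeeze (pg i) => k; rewrite norm2_ge0; apply: (norm2S mU mT UT).
by apply: (L2B mT (wg i).2.1); apply: Lc; apply: smooth_continuous; exact: smooth_pderiv.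
Qed.

Lemma is_trace_comb T A B (k l : R) w g gam w' g' gam' : open T -> bounded_set T -> A != B ->
  wgrad T w g -> wgrad T w' g' -> is_trace T A B w gam -> is_trace T A B w' gam' ->
  is_trace T A B (fun x => k * w x + l * w' x) (fun x => k * gam x + l * gam' x).
Proof.
move=> oT bT AB wg wg'; have mT := open_plane_measurable oT.
move=> /(is_traceP _ oT bT AB wg)[sg [psi [sp pw pg pt]]].
move=> /(is_traceP _ oT bT AB wg')[sg' [psi' [sp' pw' pg' pt']]].
apply/(is_traceP _ oT bT AB (wgrad_comb k l mT wg wg')); split.
  exact: (seg_sqintD (seg_sqintZ k sg) (seg_sqintZ l sg')).
have Lc f : continuous f -> L2 T f by exact: L2_continuous.
have key d (X : measurableType d) (mu : {measure set X -> \bar R}) (D : set X) (mD : measurable D)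
    (f f' p p' : X -> R) : sqint mu D f -> sqint mu D f' -> sqint mu D p -> sqint mu D p' ->
    nrm mu D ((fun y => k * f y + l * f' y) \- (fun y => k * p y + l * p' y)) <=
    `|k| * nrm mu D (f \- p) + `|l| * nrm mu D (f' \- p').
  move=> sf sf' s1 s1'; rewrite -(nrmZ mD)//; last exact: sqintB.
  rewrite -(nrmZ mD)//; last exact: sqintB.
  rewrite (@eq_nrm _ _ _ mu D _ ((fun y => k * (f \- p) y) \+ (fun y => l * (f' \- p') y))).
    by apply: nrmD => //; apply: sqintZ => //; exact: sqintB.
  by move=> y _ /=; ring.
have key2 := key _ _ (leb2 R) T mT.
exists (fun n x => k * psi n x + l * psi' n x).
have cvgkl (a b : nat -> R) : a n @[n --> \oo] --> (0 : R) -> b n @[n --> \oo] --> (0 : R) ->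
  (`|k| * a n + `|l| * b n) @[n --> \oo] --> (0 : R).
  by move=> a0 b0; exact: (cvgD0 (cvgZ0 _ a0) (cvgZ0 _ b0)).
split.
- by move=> n; apply: smoothD; apply: smoothZ.
- apply: cvg0_squeeze (cvgkl _ _ pw pw') => n; rewrite norm2_ge0.
  apply: key2; [exact: (wg false).1|exact: (wg' false).1|..];
    apply: Lc; exact: smooth_continuous.
- move=> i; apply: cvg0_squeeze (cvgkl _ _ (pg i) (pg' i)) => n; rewrite norm2_ge0.
  have -> : pderiv i (fun x => k * psi n x + l * psi' n x) =
      (fun x => k * pderiv i (psi n) x + l * pderiv i (psi' n) x).
    rewrite (pderivD i (CkZ k (sp n 1%N)) (CkZ l (sp' n 1%N))).
    by rewrite (pderivZ i k (sp n 1%N)) (pderivZ i l (sp' n 1%N)).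
  apply: key2; [exact: (wg i).2.1|exact: (wg' i).2.1|..];
    apply: Lc; apply: smooth_continuous; exact: smooth_pderiv.
- apply: cvg0_squeeze (cvgkl _ _ pt pt') => n; rewrite nrm_ge0.
  apply: (key _ _ (leb1 R) _ mI (gam \o param A B) (gam' \o param A B)
     (psi n \o param A B) (psi' n \o param A B)) => //;
  by apply: sqint_param; exact: smooth_continuous.
Qed.

Lemma is_trace_smooth T A B psi : open T -> bounded_set T -> A != B -> smooth psi ->
  is_trace T A B psi psi.
Proof.
move=> oT bT AB sp; have mT := open_plane_measurable oT.
have wg := wgrad_C1 mT bT (sp 1%N).
apply/(is_traceP _ oT bT AB wg); split; first by apply: sqint_param; exact: smooth_continuous.
exists (fun=> psi); split=> //.
- by under eq_fun do rewrite norm2_diag; exact: cvg_cst.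
- by move=> i; under eq_fun do rewrite norm2_diag; exact: cvg_cst.
- have -> : (fun _ : nat => nI ((psi \- psi) \o param A B)) = cst 0.
    by apply/funext => n; exact: (seg_nrm_diag (psi \o param A B)).
  exact: cvg_cst.
Qed.

End Traces.

(** * Triangles in the plane *)

Section PlaneGeometry.
Variable R : realType.
Implicit Types (A B P x y u v n m : plane R).

Definition cross u v : R := u.1 * v.2 - u.2 * v.1.

(** The barycentric coordinate of [x] that belongs to the third vertex. *)
Definition bary A B P x : R := cross (B - A) (x - A) / cross (B - A) (P - A).

Lemma scale2E (a : R) x : a *: x = (a * x.1, a * x.2) :> plane R. Proof. by []. Qed.
Lemma add2E x y : x + y = (x.1 + y.1, x.2 + y.2) :> plane R. Proof. by []. Qed.
Lemma opp2E x : - x = (- x.1, - x.2) :> plane R. Proof. by []. Qed.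
Definition vecE := (scale2E, add2E, opp2E).

Lemma cross_rot A B P : cross (P - B) (A - B) = cross (B - A) (P - A).
Proof. by rewrite !vecE /cross /=; ring. Qed.

Lemma crossD A B x y : cross (B - A) (x + y - A) = cross (B - A) (x - A) + cross (B - A) y.
Proof. by rewrite !vecE /cross /=; ring. Qed.

Lemma baryD A B P x v : bary A B P (x + v) = bary A B P x + cross (B - A) v / cross (B - A) (P - A).
Proof. by rewrite /bary crossD mulrDl. Qed.

Lemma bary_sum A B P x : cross (B - A) (P - A) != 0 ->
  bary B P A x + bary P A B x + bary A B P x = 1.
Proof.
move=> D0; rewrite /bary (cross_rot B P A) (cross_rot A B P).
by rewrite -!mulrDl; apply: (mulIf D0); rewrite divfK// mul1r !vecE /cross /=; ring.
Qed.

Lemma bary_comb A B P x : cross (B - A) (P - A) != 0 ->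
  x = bary B P A x *: A + bary P A B x *: B + bary A B P x *: P.
Proof.
move=> D0; rewrite /bary (cross_rot B P A) (cross_rot A B P).
move: D0; rewrite !vecE /cross /=; case: x A B P => [x1 x2] [a1 a2] [b1 b2] [p1 p2] /= D0.
by congr pair; field.
Qed.

Lemma baryE A B P (a b c : R) : cross (B - A) (P - A) != 0 -> a + b + c = 1 ->
  bary A B P (a *: A + b *: B + c *: P) = c.
Proof.
move=> D0 abc; apply: (mulIf D0); rewrite /bary divfK//.
have -> : a = 1 - b - c by lra.
by rewrite !vecE /cross /=; ring.
Qed.

Lemma continuous_bary A B P : continuous (bary A B P).
Proof.
have -> : bary A B P = ridge (fun t => - dot (- (B - A).2, (B - A).1) A / cross (B - A) (P - A)
    + (cross (B - A) (P - A))^-1 * t) 0 (- (B - A).2, (B - A).1).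
  apply/funext => x; rewrite /ridge add0r /bary -[_ / _ + _]/(_ * _ + _) [_^-1 * _]mulrC -mulrDl.
  by congr (_ / _); rewrite !vecE /cross /dot /=; ring.
by apply: smooth_continuous; apply: smooth_ridge => k;
  exact: (CnD (Cn_cst k _) (CnM (Cn_cst k _) (Cn_id _ k))).
Qed.

Definition tri A B P := [set x | [/\ 0 <= bary B P A x, 0 <= bary P A B x & 0 <= bary A B P x]].
Definition otri A B P := [set x | [/\ 0 < bary B P A x, 0 < bary P A B x & 0 < bary A B P x]].

Lemma open_otri A B P : open (otri A B P).
Proof.
have -> : otri A B P = [set x | 0 < bary B P A x] `&` [set x | 0 < bary P A B x] `&` [set x | 0 < bary A B P x].
  by apply/seteqP; split=> x /= => [[]|[[]]].
have H A' B' P' : open [set x : plane R | 0 < bary A' B' P' x].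
  by apply: (open_comp _ (@open_gt R 0)) => x _; exact: continuous_bary.
by apply: openI => //; apply: openI.
Qed.

Lemma closed_tri A B P : closed (tri A B P).
Proof.
have -> : tri A B P = [set x | 0 <= bary B P A x] `&` [set x | 0 <= bary P A B x] `&` [set x | 0 <= bary A B P x].
  by apply/seteqP; split=> x /= => [[]|[[]]].
have H A' B' P' : closed [set x : plane R | 0 <= bary A' B' P' x].
  by apply: (closed_comp _ (@closed_ge R 0)) => x _; exact: continuous_bary.
by apply: closedI => //; apply: closedI.
Qed.

Lemma otri_interior A B P : otri A B P `<=` interior (tri A B P).
Proof.
move=> x ox; rewrite /interior; apply: (@filterS _ _ _ (otri A B P)).
  by move=> y [? ? ?]; split; exact: ltW.
exact: (open_nbhs_nbhs (conj (@open_otri A B P) ox)).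
Qed.

Lemma trace_domain_tri A B P T : cross (B - A) (P - A) != 0 -> otri A B P `<=` T ->
  trace_domain T A B.
Proof.
move=> D0 oT.
have D1 : cross (P - B) (A - B) != 0 by rewrite cross_rot.
have D2 : cross (A - P) (B - P) != 0 by rewrite cross_rot.
have key a b c x : 0 < a -> 0 < b -> 0 < c -> a + b + c = 1 ->
    x = a *: A + b *: B + c *: P -> T x.
  move=> a0 b0 c0 abc ->; apply: oT; split.
  - have -> : a *: A + b *: B + c *: P = b *: B + c *: P + a *: A by rewrite [RHS]addrC addrA.
    by rewrite baryE// -abc; ring.
  - have -> : a *: A + b *: B + c *: P = c *: P + a *: A + b *: B by rewrite [LHS]addrC addrA.
    by rewrite baryE// -abc; ring.
  - by rewrite baryE.
exists P; split.
- by move: D0; rewrite /cross [(B - A).2 * _]mulrC.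
- move=> s t /andP[s0 s1] /andP[t0 t1]; apply: (key (1 - t - s) t s) => //; [lra|ring|].
  by rewrite !vecE /=; congr pair; ring.
- move=> s t /andP[s0 s1] /andP[t0 t1]; apply: (key t (1 - t - s) s) => //; [lra|ring|].
  by rewrite !vecE /=; congr pair; ring.
Qed.

Lemma dot_ge0 v : 0 <= dot v v.
Proof. by rewrite addr_ge0// -expr2 sqr_ge0. Qed.

Lemma edist_ge0 x y : 0 <= edist x y. Proof. exact: sqrtr_ge0. Qed.

Lemma edist_sqr x y : edist x y ^+ 2 = dot (x - y) (x - y).
Proof. by rewrite sqr_sqrtr ?dot_ge0. Qed.

Lemma edist_le x y (r : R) : 0 <= r -> (edist x y <= r) = (dot (x - y) (x - y) <= r ^+ 2).
Proof. by move=> r0; rewrite -edist_sqr ler_sqr ?nnegrE ?edist_ge0. Qed.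

Lemma diam_ge (S : set (plane R)) (N : R) x y : S `<=` crect (- N) N (- N) N -> S x -> S y ->
  edist x y <= diam S.
Proof.
move=> SN Sx Sy; apply: ub_le_sup; last by exists (x, y).
exists (4 * `|N|) => _ [[a b] [/= Sa Sb] <-].
have [/andP[a1 a2] /andP[a3 a4]] : (- N <= a.1 <= N) /\ (- N <= a.2 <= N) by exact: SN.
have [/andP[b1 b2] /andP[b3 b4]] : (- N <= b.1 <= N) /\ (- N <= b.2 <= N) by exact: SN.
have N0 : 0 <= N by lra.
rewrite ger0_norm// edist_le ?mulr_ge0//.
have h (s t : R) : - N <= s <= N -> - N <= t <= N -> (s - t) * (s - t) <= 4 * (N * N).
  by move=> /andP[? ?] /andP[? ?]; nra.
have := h a.1 b.1; have := h a.2 b.2.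
rewrite a1 a2 a3 a4 b1 b2 b3 b4 => /(_ isT isT) h1 /(_ isT isT) h2.
rewrite /dot !vecE /= expr2; have := mulr_ge0 N0 N0; lra.
Qed.

(** An affine function with values in [[0, 1]] on a disc of radius [r] has slope
    at most [1 / (2 * r)]. *)
Lemma bary_lipschitz A B P x v (r : R) : 0 < r -> cross (B - A) (P - A) != 0 ->
  [set y | edist x y <= r] `<=` tri A B P ->
  `|cross (B - A) v / cross (B - A) (P - A)| * (2 * r) <= Num.sqrt (dot v v).
Proof.
move=> r0 D0 rT; have r0' := ltW r0.
have D1 : cross (P - B) (A - B) != 0 by rewrite cross_rot.
have bary01 y : tri A B P y -> 0 <= bary A B P y <= 1.
  by move=> [a0 b0 c0]; rewrite c0 -(bary_sum y D0) lerDr addr_ge0.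
have [v0|v0] := eqVneq (dot v v) 0.
  have /eqP := v0; rewrite paddr_eq0 -?expr2 ?sqr_ge0// !sqrf_eq0 => /andP[/eqP e1 /eqP e2].
  by rewrite v0 sqrtr0 /cross e1 e2 !mulr0 subrr mul0r normr0 mul0r.
set N := Num.sqrt (dot v v).
have N0 : 0 < N by rewrite sqrtr_gt0 lt_neqAle eq_sym v0 dot_ge0.
have inb (c : R) : `|c| = r / N -> tri A B P (x + c *: v).
  move=> cE; apply: rT => /=; rewrite (edist_le _ _ r0').
  have -> : dot (x - (x + c *: v)) (x - (x + c *: v)) = `|c| ^+ 2 * dot v v.
    by rewrite real_normK ?num_real// !vecE /dot /=; ring.
  by rewrite cE -(sqr_sqrtr (dot_ge0 v)) -/N -exprMn divfK ?gt_eqF.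
have rN : 0 < r / N by rewrite divr_gt0.
have := bary01 _ (inb (r / N) (gtr0_norm rN)).
have := bary01 _ (inb (- (r / N)) _); rewrite normrN gtr0_norm// => /(_ erefl).
rewrite !baryD; set L := cross (B - A) v / _.
have cZ c : cross (B - A) (c *: v) / cross (B - A) (P - A) = c * L.
  by rewrite /L mulrA; congr (_ / _); rewrite !vecE /cross /=; ring.
rewrite !cZ; set l0 := bary A B P x; set k := r / N => /andP[h1 h2] /andP[h3 h4].
have -> : 2 * r = 2 * k * N by rewrite /k; field; rewrite gt_eqF.
rewrite mulrA -[leRHS]mul1r; apply: ler_wpM2r; first exact: ltW.
by case: (ger0P L) => _; lra.
Qed.

(** A degenerate triangle has no interior point, as it is contained in a line. *)
Lemma collinear_interior A B P (S : set (plane R)) x : A != B -> cross (B - A) (P - A) = 0 ->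
  (forall y, S y -> exists a b c : R, a + b + c = 1 /\ y = a *: A + b *: B + c *: P) ->
  ~ interior S x.
Proof.
move=> AB D0 Scomb; rewrite /interior => /nbhs_planeP[e e0 H].
have line y : S y -> cross (B - A) (y - A) = 0.
  move=> /Scomb[a [b [c [abc ->]]]].
  have -> : a = 1 - b - c by lra.
  transitivity (c * cross (B - A) (P - A)); last by rewrite D0 mulr0.
  by rewrite !vecE /cross /=; ring.
have inS (t : plane R) : `|t.1| < e -> `|t.2| < e -> cross (B - A) t = 0.
  move=> t1 t2; have hx : S x by apply: H; rewrite !subrr normr0.
  have : S (x + t) by apply: H => /=; rewrite addrC addKr.
  by move=> /line; rewrite crossD (line x hx) add0r.
have e2 : `|e / 2| < e by rewrite gtr0_norm ?divr_gt0//; lra.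
have z : `|0 : R| < e by rewrite normr0.
have := inS (e / 2, 0) e2 z; have := inS (0, e / 2) z e2.
rewrite /cross /= !mulr0 subr0 sub0r => /eqP + /eqP.
have h0 : (e / 2 == 0) = false by rewrite gt_eqF// divr_gt0.
rewrite oppr_eq0 (mulf_eq0 (B.1 - A.1)) (mulf_eq0 (B.2 - A.2)) h0 !orbF => /eqP h1 /eqP h2.
move/eqP: AB; apply; apply/esym.
move: h1 h2; case: (A) (B) => a1 a2 [b1 b2] /= /eqP + /eqP.
by rewrite !subr_eq0 => /eqP -> /eqP ->.
Qed.

Lemma unit_normalE A B v : A != B -> dot (unit_normal A B) v = - (edist A B)^-1 * cross (B - A) v.
Proof. by move=> AB; rewrite /unit_normal !vecE /dot /cross /=; ring. Qed.

Lemma unit_normal_norm A B : A != B -> dot (unit_normal A B) (unit_normal A B) = 1.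
Proof.
move=> AB; have d0 := edist_gt0 AB; have := edist_sqr A B.
rewrite /unit_normal; set d := edist A B => E.
have dn : d != 0 by rewrite gt_eqF.
have -> : 1 = d^-1 ^+ 2 * d ^+ 2 by rewrite -exprMn mulVf// expr1n.
by rewrite E !vecE /dot /=; ring.
Qed.

End PlaneGeometry.

(** * Geometry of the mesh *)

Section Mesh.
Variables (R : realType) (Om : set (plane R)) (M : mesh R) (kappa : R).
Hypotheses (bO : bounded_set Om) (rO : interior (closure Om) = Om).
Hypotheses (tM : is_triangulation M Om) (k0 : 0 < kappa) (sM : shape_regular M kappa).
Local Notation I := ('I_(nvert M)).
Local Notation V := (@vert R M).
Implicit Types (S T : {set I}) (e : I * I) (i j k : I) (x y v : plane R).

Local Notation trips i j k := (i |: (j |: [set k]))%SET.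

Lemma hull_trips i j k x : i != j -> i != k -> j != k ->
  hull (trips i j k) x <-> exists a b c : R,
    [/\ 0 <= a, 0 <= b, 0 <= c, a + b + c = 1 & x = a *: V i + b *: V j + c *: V k].
Proof.
move=> ij ik jk.
have ni : i \notin (j |: [set k])%SET by rewrite !inE negb_or ij ik.
have nj : j \notin [set k]%SET by rewrite !inE.
split=> [[l [l0 l1 ->]]|[a [b [c [a0 b0 c0 abc ->]]]]].
  exists (l i), (l j), (l k); split=> //.
    by move: l1; rewrite big_setU1//= big_setU1//= big_set1 addrA.
  by rewrite big_setU1//= big_setU1//= big_set1 addrA.
exists (fun h => if h == i then a else if h == j then b else c); split.
- by move=> h; case: ifP => // _; case: ifP.
- rewrite big_setU1//= big_setU1//= big_set1 eqxx eq_sym (negbTE ij) eqxx.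
  by rewrite eq_sym (negbTE ik) eq_sym (negbTE jk) addrA.
- rewrite big_setU1//= big_setU1//= big_set1 eqxx [j == i]eq_sym (negbTE ij) eqxx.
  by rewrite [k == i]eq_sym (negbTE ik) [k == j]eq_sym (negbTE jk) addrA.
Qed.

Lemma vert_neq i j : i != j -> V i != V j.
Proof. by case: tM => injV _ _ _; apply: contra_neq => /injV. Qed.

Lemma hull_tri i j k : i != j -> i != k -> j != k -> trips i j k \in triangles M ->
  cross (V j - V i) (V k - V i) != 0 /\ hull (trips i j k) = tri (V i) (V j) (V k).
Proof.
move=> ij ik jk tT.
have D0 : cross (V j - V i) (V k - V i) != 0.
  apply/eqP => D0; case: tM => _ /(_ _ tT)[_ [x cx]] _ _.
  apply: (collinear_interior (vert_neq ij) D0 _ cx) => y /(hull_trips _ ij ik jk).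
  by move=> [a [b [c [_ _ _ abc ->]]]]; exists a, b, c.
split=> //; apply/seteqP; split=> x.
  move=> /(hull_trips _ ij ik jk)[a [b [c [a0 b0 c0 abc ->]]]].
  have D1 : cross (V k - V j) (V i - V j) != 0 by rewrite cross_rot.
  have D2 : cross (V i - V k) (V j - V k) != 0 by rewrite cross_rot.
  split.
  - have -> : a *: V i + b *: V j + c *: V k = b *: V j + c *: V k + a *: V i by rewrite [RHS]addrC addrA.
    by rewrite baryE// -abc; ring.
  - have -> : a *: V i + b *: V j + c *: V k = c *: V k + a *: V i + b *: V j by rewrite [LHS]addrC addrA.
    by rewrite baryE// -abc; ring.
  - by rewrite baryE.
move=> [l1 l2 l3]; apply/(hull_trips _ ij ik jk).
by exists (bary (V j) (V k) (V i) x), (bary (V k) (V i) (V j) x), (bary (V i) (V j) (V k) x);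
  split=> //; [exact: bary_sum|exact: bary_comb].
Qed.

Lemma triangle_with i j T : T \in triangles M -> i \in T -> j \in T -> i != j ->
  exists k, [/\ i != k, j != k & T = trips i j k].
Proof.
move=> tT iT jT ij; case: tM => _ /(_ _ tT)[T3 _] _ _.
have jT' : j \in (T :\ i)%SET by rewrite !inE eq_sym ij.
have : #|(T :\ i :\ j)%SET| == 1%N.
  by move: T3; rewrite (cardsD1 i) iT (cardsD1 j (T :\ i)) jT' => /eqP; rewrite !add1n !eqSS.
move=> /cards1P[k kE]; exists k.
have : k \in (T :\ i :\ j)%SET by rewrite kE inE.
rewrite !inE => /and3P[kj ki kT].
rewrite [i == k]eq_sym [j == k]eq_sym ki kj; split=> //.
by rewrite -kE finset.setD1K// finset.setD1K.
Qed.

Lemma triangle_trips T : T \in triangles M ->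
  exists i j k, [/\ i != j, i != k, j != k & T = trips i j k].
Proof.
move=> tT; case: (tM) => _ /(_ _ tT)[T3 _] _ _.
have : (0 < #|T|)%N by rewrite T3.
move=> /card_gt0P[i iT].
have : (0 < #|(T :\ i)%SET|)%N by move: T3; rewrite (cardsD1 i) iT => /eqP; rewrite add1n eqSS => /eqP ->.
move=> /card_gt0P[j]; rewrite !inE => /andP[ji jT].
have ij : i != j by rewrite eq_sym.
by have [k [ik jk TE]] := triangle_with tT iT jT ij; exists i, j, k.
Qed.

Lemma hull_closed T : T \in triangles M -> closed (hull T).
Proof.
move=> tT; have [i [j [k [ij ik jk TE]]]] := triangle_trips tT.
by move: tT; rewrite TE => /(hull_tri ij ik jk)[_ ->]; exact: closed_tri.
Qed.

Lemma hull_sub T : T \in triangles M -> hull T `<=` closure Om.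
Proof. by case: tM => _ _ _ -> tT x hx; exists T. Qed.

Lemma cell_sub T : T \in triangles M -> cell T `<=` Om.
Proof. by move=> /hull_sub h; rewrite -rO; exact: interiorS. Qed.

Lemma open_cell T : open (cell T). Proof. exact: open_interior. Qed.

Lemma bounded_cell T : T \in triangles M -> bounded_set (cell T).
Proof.
move=> /cell_sub h; case: bO => N [rN HN]; exists N; split=> // x Nx y /h; exact: HN.
Qed.

Lemma closure_crect : exists N : R, closure Om `<=` crect (- N) N (- N) N.
Proof.
have mO : measurable Om by apply: open_plane_measurable; rewrite -rO; exact: open_interior.
have [N ON _] := mu2_bounded_set mO bO; exists N.
have cc : closed (crect (- N) N (- N) N).
  by apply: compact_closed; [exact: norm_hausdorff|exact: compact_crect].
by rewrite [X in _ `<=` X]((closure_id _).1 cc); exact: closureS.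
Qed.

Lemma edist_hT T x y : T \in triangles M -> hull T x -> hull T y -> edist x y <= hT T.
Proof.
move=> /hull_sub h hx hy; have [N HN] := closure_crect.
by apply: (@diam_ge _ _ N) => //; apply: subset_trans HN.
Qed.

Lemma edge_geometry e T : e \in edges M -> T \in edge_triangles e ->
  T \in triangles M /\ exists k, let A := V e.1 in let B := V e.2 in let P := V k in
  [/\ e.1 != k, e.2 != k, T = trips e.1 e.2 k,
      cross (B - A) (P - A) != 0 & hull T = tri A B P].
Proof.
rewrite !inE => /andP[e12 _] /andP[tT /andP[e1T e2T]]; split=> //.
have ne : e.1 != e.2 by apply: contraTneq e12 => ->; rewrite ltnn.
have [k [k1 k2 TE]] := triangle_with tT e1T e2T ne.
have [D0 hE] : cross (V e.2 - V e.1) (V k - V e.1) != 0 /\ hull T = tri (V e.1) (V e.2) (V k).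
  by move: tT; rewrite TE; exact: hull_tri.
by exists k.
Qed.

Lemma edge_neq e : e \in edges M -> e.1 != e.2.
Proof. by rewrite inE => /andP[e12 _]; apply: contraTneq e12 => ->; rewrite ltnn. Qed.

Lemma edge_vert_neq e : e \in edges M -> V e.1 != V e.2.
Proof. by move=> /edge_neq/vert_neq. Qed.

Lemma outward_normalE e k : e \in edges M -> e.1 != k -> e.2 != k ->
  cross (V e.2 - V e.1) (V k - V e.1) != 0 ->
  outward_normal (trips e.1 e.2 k) e =
    Num.sg (cross (V e.2 - V e.1) (V k - V e.1)) *: unit_normal (V e.1) (V e.2).
Proof.
move=> eE k1 k2 D0; have ne := edge_neq eE; have AB := edge_vert_neq eE.
rewrite /outward_normal !big_setU1 ?big_set1 ?inE ?negb_or ?ne ?k1 ?k2//=.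
rewrite !unit_normalE//.
have d0 : 0 < (edist (V e.1) (V e.2))^-1 by rewrite invr_gt0 edist_gt0.
congr (_ *: _); set D := cross _ (V k - _).
have z u : cross u u = 0 by rewrite /cross; ring.
rewrite z subrr (_ : cross (V e.2 - V e.1) 0 = 0) ?mulr0 ?add0r; last by rewrite /cross /=; ring.
by rewrite !mulNr sgrN opprK sgrM (gtr0_sg d0) mul1r.
Qed.

Lemma outward_dot e k v : e \in edges M -> e.1 != k -> e.2 != k ->
  cross (V e.2 - V e.1) (V k - V e.1) != 0 ->
  dot (outward_normal (trips e.1 e.2 k) e) v =
    - (`|cross (V e.2 - V e.1) (V k - V e.1)| / edist (V e.1) (V e.2)) *
      (cross (V e.2 - V e.1) v / cross (V e.2 - V e.1) (V k - V e.1)).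
Proof.
move=> eE k1 k2 D0; have AB := edge_vert_neq eE.
have nE := outward_normalE eE k1 k2 D0.
move: nE D0; set D := cross _ (V k - _) => nE D0.
transitivity (Num.sg D * dot (unit_normal (V e.1) (V e.2)) v).
  by rewrite nE !vecE /dot /=; ring.
have d0 : edist (V e.1) (V e.2) != 0 by rewrite gt_eqF// edist_gt0.
by rewrite unit_normalE// [in RHS]normrEsg; field; rewrite D0 d0.
Qed.

Lemma outward_normal_dot e T : e \in edges M -> T \in edge_triangles e ->
  dot (outward_normal T e) (outward_normal T e) = 1 /\
  exists k (c : R), [/\ T = trips e.1 e.2 k, 0 < c,
    cross (V e.2 - V e.1) (V k - V e.1) != 0, hull T = tri (V e.1) (V e.2) (V k) &
    forall v, dot (outward_normal T e) v =
       - c * (cross (V e.2 - V e.1) v / cross (V e.2 - V e.1) (V k - V e.1))].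
Proof.
move=> eE TE; have AB := edge_vert_neq eE.
have [tT [k [k1 k2 Tk D0 hE]]] := edge_geometry eE TE.
have nE := outward_normalE eE k1 k2 D0; rewrite -Tk in nE.
move: nE D0; set D := cross _ (V k - _) => nE D0.
split.
  transitivity (Num.sg D ^+ 2 * dot (unit_normal (V e.1) (V e.2)) (unit_normal (V e.1) (V e.2))).
    by rewrite nE !vecE /dot /=; ring.
  by rewrite unit_normal_norm// mulr1 sqr_sg D0.
exists k, (`|D| / edist (V e.1) (V e.2)); split=> //.
  by rewrite divr_gt0 ?normr_gt0 ?edist_gt0.
by move=> v; rewrite {1}Tk outward_dot.
Qed.

Definition midpoint e := param (V e.1) (V e.2) 2^-1.

Lemma cross_midpoint e x : cross (V e.2 - V e.1) (x - midpoint e) =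
  cross (V e.2 - V e.1) (x - V e.1).
Proof. by rewrite /midpoint /param !vecE /cross /=; field. Qed.

Lemma hull_side e T x : e \in edges M -> T \in edge_triangles e -> hull T x ->
  dot (outward_normal T e) (x - midpoint e) <= 0.
Proof.
move=> eE TE; have [_ [k [c [_ c0 D0 -> nE]]]] := outward_normal_dot eE TE.
move=> [_ _ l0]; rewrite nE mulNr oppr_le0 (pmulr_rge0 _ c0) cross_midpoint.
exact: l0.
Qed.

Lemma elen_le_hT e T : e \in edges M -> T \in edge_triangles e -> elen e <= hT T.
Proof.
move=> eE TE; have [tT [k [k1 k2 Tk D0 hE]]] := edge_geometry eE TE.
have ne := edge_neq eE.
apply: edist_hT => //; rewrite Tk; apply/(hull_trips _ ne k1 k2).
- by exists 1, 0, 0; rewrite !scale0r scale1r !addr0; split.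
- by exists 0, 1, 0; rewrite !scale0r scale1r !addr0 !add0r; split.
Qed.

(** The barycentric coordinates belonging to the end points of [e] are [1/2] at
    its midpoint, and the disc of radius [hT T / kappa] in [T] bounds their slope
    by [kappa / (2 * hT T)]; they remain nonnegative up to distance
    [hT T / kappa], which is at least [elen e / kappa]. The sign of the third
    coordinate is the side of the edge. *)
Lemma half_disc e T x : e \in edges M -> T \in edge_triangles e ->
  edist x (midpoint e) <= elen e / kappa ->
  dot (outward_normal T e) (x - midpoint e) <= 0 -> hull T x.
Proof.
move=> eE TE; have [_ [k [c [Tk c0 D0 hE nE]]]] := outward_normal_dot eE TE.
have [tT _] := edge_geometry eE TE.
have le0 : 0 < elen e by rewrite edist_gt0// edge_vert_neq.
have h0 : 0 < hT T := lt_le_trans le0 (elen_le_hT eE TE).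
move: nE D0 hE; rewrite /midpoint /elen; set A := V e.1; set B := V e.2; set P := V k.
set m := param A B 2^-1 => nE D0 hE xm xn.
have [z zT] := sM tT; rewrite hE in zT.
have r0 : 0 < hT T / kappa by rewrite divr_gt0.
have D1 : cross (P - B) (A - B) != 0 by rewrite cross_rot.
have D2 : cross (A - P) (B - P) != 0 by rewrite cross_rot.
have lip A' B' P' : cross (B' - A') (P' - A') != 0 -> [set y | edist z y <= hT T / kappa] `<=` tri A' B' P' ->
    bary A' B' P' m = 2^-1 -> 0 <= bary A' B' P' x.
  move=> D' zT' lm; have := @bary_lipschitz _ A' B' P' z (x - m) _ r0 D' zT'.
  rewrite -/(edist x m) => /le_trans/(_ xm) L.
  have -> : x = m + (x - m) by rewrite addrC subrK.
  rewrite baryD lm; move: L; set l := _ / _ => L.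
  have : `|l| <= 2^-1.
    have r2 : 0 < 2 * (hT T / kappa) by rewrite mulr_gt0.
    rewrite -(ler_pM2r r2); apply: le_trans L _.
    rewrite mulKf ?pnatr_eq0// ler_pM2r ?invr_gt0//.
    exact: (elen_le_hT eE TE).
  by rewrite ler_norml => /andP[]; lra.
have rotT A' B' P' : tri A' B' P' = tri B' P' A' by apply/seteqP; split=> y [] *; split.
have lamm A' B' P' (a b : R) : cross (B' - A') (P' - A') != 0 -> m = a *: A' + b *: B' + 2^-1 *: P' ->
    a + b = 2^-1 -> bary A' B' P' m = 2^-1.
  by move=> D' -> ab; rewrite baryE// ab; lra.
rewrite hE; split.
- apply: lip => //; first by rewrite -rotT.
  by apply: (lamm _ _ _ 2^-1 0) => //; [rewrite /m /param !vecE /=; congr pair; field|lra].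
- apply: lip => //; first by rewrite rotT.
  by apply: (lamm _ _ _ 0 2^-1) => //; [rewrite /m /param !vecE /=; congr pair; field|lra].
- by move: xn; rewrite nE mulNr oppr_le0 (pmulr_rge0 _ c0) [cross _ (x - m)]cross_midpoint.
Qed.

Lemma cell_tri i j k : i != j -> i != k -> j != k -> trips i j k \in triangles M ->
  otri (V i) (V j) (V k) `<=` cell (trips i j k).
Proof. by move=> ij ik jk /(hull_tri ij ik jk)[_ hE]; rewrite /cell hE; exact: otri_interior. Qed.

Lemma trace_domain_cell e T : e \in edges M -> T \in edge_triangles e ->
  trace_domain (cell T) (V e.1) (V e.2).
Proof.
move=> eE TE; have [tT [k [k1 k2 Tk D0 hE]]] := edge_geometry eE TE.
apply: (trace_domain_tri D0); rewrite Tk; apply: cell_tri => //; first exact: edge_neq.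
by rewrite -Tk.
Qed.

Lemma edist_cst_open m (r : R) : open [set x : plane R | edist x m < r].
Proof.
have -> : [set x | edist x m < r] = [set x | 0 < r] `&` [set x | dot (x - m) (x - m) < r ^+ 2].
  apply/seteqP; split=> x /=.
    move=> h; have r0 : 0 < r := le_lt_trans (edist_ge0 _ _) h; split=> //.
    by rewrite -edist_sqr ltr_sqr ?nnegrE ?edist_ge0// ltW.
  by move=> [r0]; rewrite -edist_sqr ltr_sqr ?nnegrE ?edist_ge0// ltW.
have [r0|r0] := ltP 0 r; last first.
  by rewrite (_ : [set x | _] = set0) ?set0I; [exact: open0|apply/seteqP; split=> x //=].
rewrite (_ : [set x | _] = setT) ?setTI; last by apply/seteqP; split=> x //=.
apply: (open_comp _ (@open_lt R (r ^+ 2))) => x _; apply: cvgD; apply: cvgM.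
- apply: cvgB; [exact: cvg_fst|exact: cvg_cst].
- apply: cvgB; [exact: cvg_fst|exact: cvg_cst].
- apply: cvgB; [exact: cvg_snd|exact: cvg_cst].
- apply: cvgB; [exact: cvg_snd|exact: cvg_cst].
Qed.

Lemma half_disc_cell e T x : e \in edges M -> T \in edge_triangles e ->
  edist x (midpoint e) < elen e / kappa ->
  dot (outward_normal T e) (x - midpoint e) < 0 -> cell T x.
Proof.
move=> eE TE xm xn.
pose U := [set x | edist x (midpoint e) < elen e / kappa] `&`
  [set x : plane R | dot (outward_normal T e) (x - midpoint e) < 0].
have oU : open U.
  apply: openI; first exact: edist_cst_open.
  apply: (open_comp _ (@open_lt R 0)) => y _; apply: cvgD; apply: cvgM;
    (try exact: cvg_cst); apply: cvgB;
    [exact: cvg_fst|exact: cvg_cst|exact: cvg_snd|exact: cvg_cst].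
have Ux : nbhs x U by exact: (open_nbhs_nbhs (conj oU (conj xm xn))).
rewrite /cell /interior; apply: filterS Ux => y [ym yn].
by apply: (half_disc eE TE); exact: ltW.
Qed.

Lemma hull_face i j k S x : i != j -> i != k -> j != k -> trips i j k \in triangles M ->
  S \subset trips i j k -> hull S x ->
  [/\ i \notin S -> bary (V j) (V k) (V i) x = 0, j \notin S -> bary (V k) (V i) (V j) x = 0
    & k \notin S -> bary (V i) (V j) (V k) x = 0].
Proof.
move=> ij ik jk tT ST [l [l0 l1 xE]].
have [D0 _] := hull_tri ij ik jk tT.
have ni : i \notin (j |: [set k])%SET by rewrite !inE negb_or ij ik.
have nj : j \notin [set k]%SET by rewrite !inE.
pose c h := if h \in S then l h else 0.
have sumS (W : zmodType) (F : I -> W) : \sum_(h in S) F h =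
    \sum_(h in trips i j k) (if h \in S then F h else 0).
  rewrite -big_mkcondr; apply: eq_bigl => h.
  by case hS : (h \in S); rewrite ?andbF// (fintype.subsetP ST _ hS).
have c1 : c i + c j + c k = 1.
  by rewrite -l1 sumS !big_setU1//= big_set1 addrA.
have xE' : x = c i *: V i + c j *: V j + c k *: V k.
  rewrite xE sumS !big_setU1//= big_set1 addrA /c.
  by case: (i \in S); case: (j \in S); case: (k \in S); rewrite ?scale0r.
have D1 : cross (V k - V j) (V i - V j) != 0 by rewrite cross_rot.
have D2 : cross (V i - V k) (V j - V k) != 0 by rewrite cross_rot.
split=> /negbTE nS.
- have -> : x = c j *: V j + c k *: V k + c i *: V i by rewrite xE' [RHS]addrC addrA.
  by rewrite baryE// -?c1 /c ?nS//; ring.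
- have -> : x = c k *: V k + c i *: V i + c j *: V j by rewrite xE' [LHS]addrC addrA.
  by rewrite baryE// -?c1 /c ?nS//; ring.
- by rewrite xE' baryE// /c nS.
Qed.

(** If both triangles were on the same side of the edge, both would contain the
    half disc of [half_disc], although their intersection is contained in the
    line through the edge. *)
Lemma opposite_normals e T1 T2 : e \in edges M -> T1 \in edge_triangles e ->
  T2 \in edge_triangles e -> T1 != T2 -> outward_normal T2 e = - outward_normal T1 e.
Proof.
move=> eE TE1 TE2 T12; have ne := edge_neq eE; have AB := edge_vert_neq eE.
have [t1 [k1 [k11 k12 Tk1 D1 hE1]]] := edge_geometry eE TE1.
have [t2 [k2 [k21 k22 Tk2 D2 hE2]]] := edge_geometry eE TE2.
have := outward_normalE eE k11 k12 D1; have := outward_normalE eE k21 k22 D2.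
rewrite -Tk1 -Tk2; set n := unit_normal _ _ => n2E n1E.
have [n12|] := eqVneq (outward_normal T1 e) (outward_normal T2 e); last first.
  have sgn (a b : R) : a != 0 -> b != 0 -> Num.sg a *: n != Num.sg b *: n ->
      Num.sg b *: n = - (Num.sg a *: n).
    move=> a0 b0; case: (sgrP a) a0 => // _ _; case: (sgrP b) b0 => // _ _;
    by rewrite ?eqxx// ?scaleN1r ?scale1r ?opprK.
  by rewrite n1E n2E => /(sgn _ _ D1 D2).
have nn := (outward_normal_dot eE TE1).1.
pose r := elen e / kappa; pose x := midpoint e - r *: outward_normal T1 e.
have r0 : 0 < r by rewrite divr_gt0// edist_gt0.
have xm : edist x (midpoint e) <= r.
  rewrite (edist_le _ _ (ltW r0)) le_eqVlt; apply/orP; left; apply/eqP.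
  rewrite -[r ^+ 2]mulr1 -nn /x !vecE /dot /=; ring.
have xn : dot (outward_normal T1 e) (x - midpoint e) = - r.
  rewrite -[r in RHS]mulr1 -nn /x !vecE /dot /=; ring.
have h1 : hull T1 x by apply: (half_disc eE TE1) => //; rewrite xn oppr_le0 ltW.
have h2 : hull T2 x by apply: (half_disc eE TE2) => //; rewrite -n12 xn oppr_le0 ltW.
have h12 : hull (T1 :&: T2)%SET x.
  by case: tM => _ _ /(_ _ _ t1 t2) <- _; split.
have k1T2 : k1 \notin (T1 :&: T2)%SET.
  rewrite inE negb_and; apply/orP; right; rewrite Tk2 !inE !negb_or eq_sym k11 eq_sym k12/=.
  by apply: contraNN T12 => /eqP k12E; rewrite Tk1 Tk2 k12E.
have [_ _ /(_ k1T2)] := hull_face ne k11 k12 (eq_ind T1 (fun T => T \in triangles M) t1 _ Tk1)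
  (eq_ind T1 (fun T => (T1 :&: T2 \subset T)%SET) (subsetIl _ _) _ Tk1) h12.
rewrite /bary -cross_midpoint => l0.
move: xn; rewrite Tk1 outward_dot// l0 mulr0 => /eqP.
by rewrite eq_sym oppr_eq0 gt_eqF.
Qed.

(** Were a point of [e] in the domain, so would be a point of its relative
    interior. That point is in no other triangle, so [T] alone would cover a
    neighbourhood of it, although [T] lies on one side of [e]. *)
Lemma boundary_edge e T : e \in edges M -> edge_triangles e = [set T]%SET ->
  segment (V e.1) (V e.2) `<=` closure Om `\` Om.
Proof.
move=> eE TE1; have TE : T \in edge_triangles e by rewrite TE1 inE.
have ne := edge_neq eE; have AB := edge_vert_neq eE.
have [tT [k [k1 k2 Tk D0 hE]]] := edge_geometry eE TE.
have tT' : trips e.1 e.2 k \in triangles M by rewrite -Tk.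
set A := V e.1 in D0 hE AB *; set B := V e.2 in D0 hE AB *.
have pE (t : R) : param A B t = (1 - t) *: A + t *: B + 0 *: V k.
  by rewrite /param !vecE /=; congr pair; ring.
move=> _ [t /= + <-]; rewrite in_itv/= => /andP[t0 t1]; split.
  apply: (hull_sub tT); rewrite Tk; apply/(hull_trips _ ne k1 k2).
  by exists (1 - t), t, 0; split=> //; [lra|ring].
move=> xO; have oO : open Om by rewrite -rO; exact: open_interior.
have [t' t'01 yO] : exists2 t', 0 < t' < 1 & Om (param A B t').
  have : nbhs t (param A B @^-1` Om).
    have cp : continuous (param A B).
      by move=> s; apply: cvgD; [exact: cvg_cst|apply: cvgZl; exact: cvg_id].
    by apply: cp; exact: (open_nbhs_nbhs (conj oO xO)).
  move=> /nbhs_ballP[eps /= eps0 H].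
  pose d := Num.min 1 eps / 2.
  have d0 : 0 < d by rewrite divr_gt0// lt_min ltr01.
  have d1 : d <= 2^-1 by rewrite /d ler_pdivrMr// mulVf// ge_min lexx.
  have d2 : d < eps by rewrite /d ltr_pdivrMr// gt_min; apply/orP; right; lra.
  exists (t + d * (2^-1 - t)).
    have d3 : 0 <= 1 - d by lra.
    have t1' : 0 <= 1 - t by lra.
    have := mulr_ge0 t0 d3; have := mulr_ge0 t1' d3; rewrite mulrBl mul1r !mulrBr !mulr1.
    by move=> h1 h2; rewrite [d * t]mulrC; apply/andP; split; lra.
  apply: H; rewrite /ball /= opprD addNKr normrN normrM (gtr0_norm d0).
  apply: le_lt_trans d2; rewrite -[leRHS]mulr1 ler_wpM2l ?(ltW d0)// ler_norml.
  by apply/andP; split; lra.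
set y := param A B t' in yO.
have noT T' : T' \in triangles M -> T' != T -> ~ hull T' y.
  move=> tT2 T'T hy.
  have hyT : hull T y.
    rewrite Tk; apply/(hull_trips _ ne k1 k2); exists (1 - t'), t', 0.
    by case/andP: t'01 => ? ?; split=> //; [lra|lra|ring|exact: pE].
  have hI : hull (T :&: T')%SET y by case: tM => _ _ /(_ _ _ tT tT2) <- _; split.
  have sI : T :&: T' \subset trips e.1 e.2 k by rewrite -Tk; exact: subsetIl.
  have [f1 f2 _] := hull_face ne k1 k2 tT' sI hI.
  have D1 : cross (V k - B) (A - B) != 0 by rewrite cross_rot.
  have D2 : cross (A - V k) (B - V k) != 0 by rewrite cross_rot.
  have e1 : e.1 \in T'.
    have [] // := boolP (e.1 \in T'); move=> nT'; have := f1; rewrite inE (negbTE nT') andbF.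
    move=> /(_ isT); rewrite /y pE.
    have -> : (1 - t') *: A + t' *: B + 0 *: V k = t' *: B + 0 *: V k + (1 - t') *: A.
      by rewrite [RHS]addrC addrA.
    by rewrite baryE//; [case/andP: t'01; lra|ring].
  have e2 : e.2 \in T'.
    have [] // := boolP (e.2 \in T'); move=> nT'; have := f2; rewrite inE (negbTE nT') andbF.
    move=> /(_ isT); rewrite /y pE.
    have -> : (1 - t') *: A + t' *: B + 0 *: V k = 0 *: V k + (1 - t') *: A + t' *: B.
      by rewrite [LHS]addrC addrA.
    by rewrite baryE//; [case/andP: t'01; lra|ring].
  have : T' \in edge_triangles e by rewrite inE tT2 e1 e2.
  by rewrite TE1 inE (negbTE T'T).
have Un : nbhs y (Om `&` [set z | forall T', T' \in triangles M -> T' != T -> ~ hull T' z]).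
  apply: filterI; first exact: (open_nbhs_nbhs (conj oO yO)).
  apply: (@filter_forall _ _ (fun T' z => T' \in triangles M -> T' != T -> ~ hull T' z) (nbhs y)) => T'.
  have [tT2|nT2] := boolP (T' \in triangles M); last by apply: nearW.
  have [T'T|T'T] := eqVneq T' T; first by apply: nearW => z _ /eqP.
  have oc : open (~` hull T') by apply: closed_openC; exact: hull_closed.
  by apply: filterS (open_nbhs_nbhs (conj oc (noT _ tT2 T'T))) => z.
have /nbhs_planeP[eps eps0 HU] := Un.
have [nn [kk [c [_ _ _ _ nE]]]] := outward_normal_dot eE TE.
set n := outward_normal T e in nn nE.
have n1 : `|n.1| <= 1 /\ `|n.2| <= 1.
  have n12 : n.1 ^+ 2 + n.2 ^+ 2 = 1 by rewrite !expr2.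
  by split; rewrite -(@ler_sqr R) ?nnegrE// expr1n real_normK ?num_real//;
    have := sqr_ge0 n.1; have := sqr_ge0 n.2; lra.
(* A point close to [y] on the outer side of the edge. *)
pose z := y + (eps / 2) *: n.
have [zO zT] : (Om `&` [set z | forall T', T' \in triangles M -> T' != T -> ~ hull T' z]) z.
  have le (a : R) : `|a| <= 1 -> `|eps / 2 * a| < eps.
    move=> a1; rewrite normrM gtr0_norm ?divr_gt0//.
    apply: (@le_lt_trans _ _ (eps / 2)); last by lra.
    by rewrite -[leRHS]mulr1; apply: ler_wpM2l => //; rewrite divr_ge0// ltW.
  by apply: HU; rewrite /z !vecE /= addrAC subrr add0r; apply: le; case: n1.
have hz : hull T z.
  have : closure Om z by exact: subset_closure.
  case: tM => _ _ _ -> [T' tT2 hz]; have [<-//|T'T] := eqVneq T' T.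
  by case: (zT _ tT2 T'T).
have := hull_side eE TE hz; rewrite -/n.
have -> : dot n (z - midpoint e) = dot n (y - midpoint e) + eps / 2 * dot n n.
  by rewrite /z !vecE /dot /=; ring.
rewrite nE cross_midpoint nn mulr1 /y /param -/A -/B.
have -> : cross (B - A) (A + t' *: (B - A) - A) = 0 by rewrite !vecE /cross /=; ring.
by rewrite mul0r mulr0 add0r; lra.
Qed.

(** Of three triangles with a common edge, two would be on the same side of it. *)
Lemma edge_triangles_cases e : e \in edges M ->
  (exists T, edge_triangles e = [set T]%SET) \/
  (exists T1 T2, T1 != T2 /\ edge_triangles e = [set T1; T2]%SET).
Proof.
move=> eE; have : edge_triangles e != finset.set0 by move: eE; rewrite inE => /andP[].
move=> /set0Pn[T1 TE1].
have [D|/set0Pn[T2]] := eqVneq (edge_triangles e :\ T1)%SET finset.set0.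
  by left; exists T1; rewrite -(finset.setD1K TE1) D finset.setU0.
rewrite in_setD1 => /andP[T21 TE2]; right; exists T1, T2; rewrite eq_sym; split=> //.
apply/setP => T3; rewrite in_set2; apply/idP/idP; last by case/orP => /eqP ->.
move=> TE3; apply/negPn/negP; rewrite negb_or => /andP[T31 T32].
have n31 := opposite_normals eE TE3 TE1 T31; have n32 := opposite_normals eE TE3 TE2 T32.
have := opposite_normals eE TE2 TE1 T21; rewrite n31 n32 opprK => nn.
have := (outward_normal_dot eE TE3).1.
have : dot (outward_normal T3 e) (outward_normal T3 e) =
   - dot (- outward_normal T3 e) (outward_normal T3 e) by rewrite !vecE /dot /=; ring.
by rewrite nn; lra.
Qed.

End Mesh.

(** * Functions with normal traces on a polygon *)

Section Polygon.
Variables (R : realType).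
Implicit Types (Om O T : set (plane R)) (A B P x y u v n d : plane R) (w p : plane R -> R).
Implicit Types (g : bool -> plane R -> R) (h : bool -> bool -> plane R -> R).

(** If all sides were parallel to [d], a line in direction [d] through a point of
    the domain that avoids the finitely many lines of the sides would never meet
    the boundary, hence stay in the domain, which is bounded. *)
Lemma nonparallel_sides Om m (A : 'I_m -> plane R) (s : 'S_m) d : open Om -> Om !=set0 ->
  bounded_set Om -> closure Om `\` Om = \bigcup_i segment (A i) (A (s i)) -> d != 0 ->
  exists i, cross d (A (s i) - A i) != 0.
Proof.
move=> oO [x0 x0O] bO bdE d0; apply/not_existsP => par.
have par' i : cross d (A (s i) - A i) = 0 by apply/eqP/negPn/negP; exact: par.
(* Among [m.+1] points of the domain on distinct lines in direction [d], one is
   on none of the [m] lines that carry the sides. *)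
have [x xO xA] : exists2 x, Om x & forall i, cross d x != cross d (A i).
  apply/not_exists2P => /= avoid.
  have hit x : Om x -> exists i, cross d x = cross d (A i).
    by move=> xO; have [//|/existsNP[i /negP/negPn/eqP xA]] := avoid x; exists i.
  have /nbhs_planeP[e e0 He] : nbhs x0 Om by exact: (open_nbhs_nbhs (conj oO x0O)).
  pose q := e / (1 + `|d.1| + `|d.2|).
  have s0 : 0 < 1 + `|d.1| + `|d.2| by rewrite !ltr_pwDl.
  have q0 : 0 < q by rewrite divr_gt0.
  pose t (j : 'I_m.+1) : R := q / j.+1%:R.
  have t0 j : 0 < t j by rewrite divr_gt0.
  have tq j : t j <= q by rewrite ler_pdivrMr// ler_peMr ?(ltW q0)// ler1n.
  have small j (a : R) : `|a| <= `|d.1| + `|d.2| -> `|t j * a| < e.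
    move=> ha; rewrite normrM gtr0_norm//.
    apply: (@le_lt_trans _ _ (q * (`|d.1| + `|d.2|))).
      by apply: ler_pM => //; exact: ltW.
    by rewrite /q mulrAC ltr_pdivrMr// ltr_pM2l//; lra.
  have inO j : Om (x0 + t j *: (- d.2, d.1)).
    by apply: He; rewrite !vecE /= addrAC subrr add0r; apply: small;
      rewrite ?normrN ?lerDl ?lerDr.
  have [F HF] := choice (fun j => hit _ (inO j)).
  have Finj : injective F.
    move=> j j' FE; have := HF j; rewrite FE -(HF j').
    have cE (a : R) : cross d (x0 + a *: (- d.2, d.1)) = cross d x0 + a * dot d d.
      by rewrite !vecE /cross /dot /=; ring.
    have dd0 : dot d d != 0.
      apply: contra d0; rewrite paddr_eq0 -?expr2 ?sqr_ge0// !sqrf_eq0 => /andP[/eqP d1 /eqP d2].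
      by apply/eqP; move: d1 d2; case: (d) => a b /= -> ->.
    rewrite !cE => /addrI/(mulIf dd0)/(mulfI (lt0r_neq0 q0))/invr_inj/eqP.
    by rewrite eqr_nat eqSS => /eqP/val_inj.
  by have := leq_card F Finj; rewrite !card_ord ltnn.
pose L := [set t : R | Om (x + t *: d)].
have cl : continuous (fun t : R => x + t *: d).
  by move=> t; apply: cvgD; [exact: cvg_cst|apply: cvgZl; exact: cvg_id].
have LE : L = [set t | closure Om (x + t *: d)].
  apply/seteqP; split=> t /=; first by move=> h; exact: subset_closure.
  move=> ct; have [//|nO] := pselect (Om (x + t *: d)).
  have : (closure Om `\` Om) (x + t *: d) by split.
  rewrite bdE => -[i _ [u _ /(congr1 (cross d))]].
  have -> : cross d (param (A i) (A (s i)) u) = cross d (A i) + u * cross d (A (s i) - A i).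
    by rewrite /param !vecE /cross /=; ring.
  have -> : cross d (x + t *: d) = cross d x by rewrite !vecE /cross /=; ring.
  by rewrite par' mulr0 addr0 => /eqP; rewrite eq_sym (negbTE (xA i)).
have L1 : L = setT.
  have /connected_intervalP : is_interval (setT : set R) by move=> *.
  apply=> //.
  - by exists 0; rewrite /L /= scale0r addr0.
  - exists L; last by rewrite setTI.
    by move: (fun (t : R) (_ : setT t) => cl t) => cl'; apply: (open_comp _ oO).
  - exists L; last by rewrite setTI.
    by rewrite LE; apply: (closed_comp _ (@closed_closure _ Om)).
have [N ON _] := mu2_bounded_set (open_plane_measurable oO) bO.
have inL t : Om (x + t *: d) by have : L t by rewrite L1.
have d12 : d.1 != 0 \/ d.2 != 0.
  have [d1|] := eqVneq d.1 0; last by left.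
  right; apply: contra d0 => /eqP d2; apply/eqP.
  by move: d1 d2; case: (d) => a b /= -> ->.
case: d12 => di.
  have /andP[_] : - N <= (x + ((N + 1 - x.1) / d.1) *: d).1 <= N := (ON _ (inL _)).1.
  by rewrite !vecE /= divfK// addrC subrK gerDl; lra.
have /andP[_] : - N <= (x + ((N + 1 - x.2) / d.2) *: d).2 <= N := (ON _ (inL _)).2.
by rewrite !vecE /= divfK// addrC subrK gerDl; lra.
Qed.

Lemma dot_pairE (a b : R) n : dot (a, b) n = n.1 * a + n.2 * b.
Proof. by rewrite /dot /= mulrC [b * _]mulrC. Qed.

(** Membership in the closure in H^1(O) of the functions smooth on the whole
    plane: the functions which have traces. For a general domain, H^1(O) may be
    larger than this closure. *)
Definition approximable O w g := exists psi : nat -> plane R -> R,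
  [/\ forall k, smooth (psi k), norm2 O (w \- psi k) @[k --> \oo] --> (0 : R)
    & forall i, norm2 O (g i \- pderiv i (psi k)) @[k --> \oo] --> (0 : R)].

Lemma is_trace_approximable O A B w g gam : open O -> bounded_set O -> A != B ->
  wgrad O w g -> is_trace O A B w gam -> approximable O w g.
Proof.
by move=> oO bO AB wg /(is_traceP _ oO bO AB wg)[_ [psi [sp pw pg _]]]; exists psi.
Qed.

Lemma approximable_comb O (k l : R) w g w' g' : open O -> bounded_set O ->
  wgrad O w g -> wgrad O w' g' -> approximable O w g -> approximable O w' g' ->
  approximable O (fun x => k * w x + l * w' x) (fun i x => k * g i x + l * g' i x).
Proof.
move=> oO bO wg wg' [psi [sp pw pg]] [psi' [sp' pw' pg']].
have mO := open_plane_measurable oO.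
have Lc f : continuous f -> L2 O f by exact: L2_continuous.
have key f f' q q' : L2 O f -> L2 O f' -> L2 O q -> L2 O q' ->
    norm2 O ((fun x => k * f x + l * f' x) \- (fun x => k * q x + l * q' x)) <=
    `|k| * norm2 O (f \- q) + `|l| * norm2 O (f' \- q').
  move=> Lf Lf' Lq Lq'.
  rewrite -(norm2Z mO k (L2B mO Lf Lq)) -(norm2Z mO l (L2B mO Lf' Lq')).
  have -> : (fun x => k * f x + l * f' x) \- (fun x => k * q x + l * q' x) =
     (fun x => k * (f \- q) x) \+ (fun x => l * (f' \- q') x) by apply/funext => x /=; ring.
  by apply: (norm2D mO); apply: (L2Z mO); exact: (L2B mO).
exists (fun j x => k * psi j x + l * psi' j x).
have cvgkl (a b : nat -> R) : a n @[n --> \oo] --> (0 : R) -> b n @[n --> \oo] --> (0 : R) ->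
  (`|k| * a n + `|l| * b n) @[n --> \oo] --> (0 : R).
  by move=> a0 b0; exact: (cvgD0 (cvgZ0 _ a0) (cvgZ0 _ b0)).
split.
- by move=> j; apply: smoothD; apply: smoothZ.
- apply: cvg0_squeeze (cvgkl _ _ pw pw') => j; rewrite norm2_ge0.
  by apply: key; [exact: (wg false).1|exact: (wg' false).1|..];
    apply: Lc; exact: smooth_continuous.
- move=> i; apply: cvg0_squeeze (cvgkl _ _ (pg i) (pg' i)) => j; rewrite norm2_ge0.
  have -> : pderiv i (fun x => k * psi j x + l * psi' j x) =
      (fun x => k * pderiv i (psi j) x + l * pderiv i (psi' j) x).
    rewrite (pderivD i (CkZ k (sp j 1%N)) (CkZ l (sp' j 1%N))).
    by rewrite (pderivZ i k (sp j 1%N)) (pderivZ i l (sp' j 1%N)).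
  by apply: key; [exact: (wg i).2.1|exact: (wg' i).2.1|..];
    apply: Lc; apply: smooth_continuous; exact: smooth_pderiv.
Qed.

Lemma approximable_ae O w g w' : open O -> bounded_set O -> wgrad O w g -> L2 O w' ->
  ae_eq_on O w w' -> approximable O w g -> approximable O w' g.
Proof.
move=> oO bO wg Lw' ww [psi [sp pw pg]]; have mO := open_plane_measurable oO.
exists psi; split=> //.
suff E k : norm2 O (w' \- psi k) = norm2 O (w \- psi k) by under eq_fun do rewrite E.
have Lp := L2_continuous mO bO (smooth_continuous (sp k)).
apply: esym; apply: (ae_norm2 mO); [exact: (L2B mO (wg false).1 Lp)|exact: (L2B mO Lw' Lp)|].
exact: (ae_comp2 (fun a b => a - b) ww (@ae_refl _ _ _)).
Qed.

Lemma approximable_coord O g h n1 n2 i : open O -> bounded_set O ->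
  (forall i, wgrad O (g i) (h i)) -> cross n1 n2 != 0 ->
  approximable O (fun x => n1.1 * g false x + n1.2 * g true x)
    (fun j x => n1.1 * h false j x + n1.2 * h true j x) ->
  approximable O (fun x => n2.1 * g false x + n2.2 * g true x)
    (fun j x => n2.1 * h false j x + n2.2 * h true j x) ->
  approximable O (g i) (h i).
Proof.
move=> oO bO wh N0 H1 H2; have mO := open_plane_measurable oO.
have wgn (n : plane R) := wgrad_comb n.1 n.2 mO (wh false) (wh true).
suff [a [b [aE bE]]] : exists a b : R, a * n1.1 + b * n2.1 = (if i then 0 else 1) /\
    a * n1.2 + b * n2.2 = (if i then 1 else 0).
  have := approximable_comb a b oO bO (wgn n1) (wgn n2) H1 H2.
  have E (F : bool -> plane R -> R) : (fun x => a * (n1.1 * F false x + n1.2 * F true x) +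
      b * (n2.1 * F false x + n2.2 * F true x)) = F i.
    apply/funext => x; transitivity ((a * n1.1 + b * n2.1) * F false x + (a * n1.2 + b * n2.2) * F true x).
      by ring.
    by rewrite aE bE; case: (i); rewrite mul0r mul1r ?addr0 ?add0r.
  rewrite E; congr approximable.
  by apply/funext => j; exact: (E (fun i => h i j)).
move: N0; rewrite /cross => N0; case: i.
  by exists (- n2.1 / (n1.1 * n2.2 - n1.2 * n2.1)), (n1.1 / (n1.1 * n2.2 - n1.2 * n2.1)); split; field.
by exists (n2.2 / (n1.1 * n2.2 - n1.2 * n2.1)), (- n1.2 / (n1.1 * n2.2 - n1.2 * n2.1)); split; field.
Qed.

(** The boundary condition in the definition of Q asserts that the normal
    derivative on a boundary segment has a trace, so that it is approximable on
    all of the domain. The normals of two sides that are not parallel span the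
    plane, whence the claim for both partial derivatives. *)
Lemma Qspace_approximable Om p : polygonal_domain Om -> Qspace Om p ->
  forall i, approximable Om (wderiv Om i p) (fun j => wderiv Om j (wderiv Om i p)).
Proof.
move=> [oO cO O0 bO [rO [m [A [s [injA sA _ bdE]]]]]] [H2p tp].
have mO := open_plane_measurable oO.
have wh := H2_whess H2p; set g := fun i => wderiv Om i p in wh *.
set h := fun i j => wderiv Om j (g i) in wh *.
have d10 : ((1 : R), (0 : R)) != 0 by apply/eqP => -[/eqP]; rewrite oner_eq0.
have [i1 _] := nonparallel_sides oO O0 bO bdE d10.
have nA i : A i != A (s i) by apply: contra (sA i) => /eqP/injA <-.
have d1 : A (s i1) - A i1 != 0 by rewrite subr_eq0 eq_sym nA.
have [i2 D0] := nonparallel_sides oO O0 bO bdE d1.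
have sidebd i : segment (A i) (A (s i)) `<=` closure Om `\` Om.
  by rewrite bdE => x sx; exists i.
have H i n : n = unit_normal (A i) (A (s i)) ->
    approximable Om (fun x => n.1 * g false x + n.2 * g true x)
      (fun j x => n.1 * h false j x + n.2 * h true j x).
  move=> nE; have := tp _ _ (nA i) (sidebd i); rewrite -nE => tr.
  have [ae Ln] := nderiv_ae n oO wh.1.
  have wgn := wgrad_comb n.1 n.2 mO (wh.2 false) (wh.2 true).
  have ae' : ae_eq_on Om (nderiv Om n p) (fun x => n.1 * g false x + n.2 * g true x).
    apply: ae_trans ae _; by apply: eq_ae => x _; exact: dot_pairE.
  have wgn' : wgrad Om (nderiv Om n p) (fun j x => n.1 * h false j x + n.2 * h true j x).
    apply: (wgrad_ae mO wgn Ln) (ae_sym ae') _ => j; last exact: ae_refl.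
    by case: (wgn j) => _ [].
  apply: (approximable_ae oO bO wgn' _ ae'); first by case: (wgn false).
  exact: (is_trace_approximable oO bO (nA i) wgn' tr).
set n1 := unit_normal (A i1) (A (s i1)); set n2 := unit_normal (A i2) (A (s i2)).
have N0 : cross n1 n2 != 0.
  have -> : cross n1 n2 = (edist (A i1) (A (s i1)))^-1 * (edist (A i2) (A (s i2)))^-1 *
      cross (A (s i1) - A i1) (A (s i2) - A i2).
    by rewrite /n1 /n2 /unit_normal !vecE /cross /=; ring.
  by rewrite !mulf_neq0// invr_neq0// gt_eqF// edist_gt0.
by move=> i; apply: (approximable_coord i oO bO wh.2 N0 (H i1 n1 erefl) (H i2 n2 erefl)).
Qed.

Lemma pderiv_test_segment Om psi n : test_function Om psi ->
  test_function Om (fun x => n.1 * pderiv false psi x + n.2 * pderiv true psi x).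
Proof. by move=> tp; apply: testD; apply: testZ; exact: test_pderiv. Qed.

Lemma H2_norm_bound O w g h i j : open O -> whess O w g h ->
  norm2 O (g i) <= H2_norm O w /\ norm2 O (h i j) <= H2_norm O w.
Proof.
move=> oO wh; have mO := open_plane_measurable oO.
have [_ gb _] := H1_norm_bounds oO wh.1.
have [ae Lw] := whess_wderiv i j oO wh.
have E : norm2 O (wderiv O j (wderiv O i w)) = norm2 O (h i j).
  by apply: ae_norm2 => //; case: (wh.2 i j) => _ [].
have le_sqrt (a S : R) : 0 <= a -> a ^+ 2 <= S -> a <= Num.sqrt S.
  by move=> a0 aS; rewrite -(ger0_norm a0) -sqrtr_sqr; exact: ler_wsqrtr.
split.
  apply: le_trans (gb i) _; apply: le_sqrt; first exact: sqrtr_ge0.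
  by rewrite lerDl sqr_ge0.
rewrite -E; apply: (@le_trans _ _ (H2_seminorm O w)).
  apply: le_sqrt; first exact: norm2_ge0.
  have gen (F : bool -> bool -> R) : (forall a b, 0 <= F a b) ->
      F j i <= \sum_(a : bool) \sum_(b : bool) F a b.
    move=> F0; rewrite (bigD1 j)//= (bigD1 i)//= -addrA lerDl addr_ge0//.
      exact: sumr_ge0.
    by apply: sumr_ge0 => a _; exact: sumr_ge0.
  by apply: (gen (fun a b => norm2 O (wderiv O a (wderiv O b w)) ^+ 2)) => a b; exact: sqr_ge0.
apply: le_sqrt; first exact: sqrtr_ge0.
by rewrite lerDr sqr_ge0.
Qed.

Lemma combB (a b : R) (f f' q q' : plane R -> R) :
  (fun x => a * f x + b * f' x) \- (fun x => a * q x + b * q' x) =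
  (fun x => a * (1 * f x + -1 * q x) + b * (1 * f' x + -1 * q' x)).
Proof. by apply/funext => x /=; ring. Qed.

(** The directional derivatives of the test functions that converge to [p] are
    themselves test functions, with trace zero. *)
Lemma Vspace_Qspace Om p : open Om -> bounded_set Om -> Vspace Om p -> Qspace Om p.
Proof.
move=> oO bO [H2p [psi [tp pp]]]; split=> // A B AB bd.
have mO := open_plane_measurable oO.
have wh := H2_whess H2p.
have := unit_normal_norm AB; move: (unit_normal A B) => n nn.
have [ae Ln] := nderiv_ae n oO wh.1.
have wgn := wgrad_comb n.1 n.2 mO (wh.2 false) (wh.2 true).
have ae' : ae_eq_on Om (fun x => n.1 * wderiv Om false p x + n.2 * wderiv Om true p x) (nderiv Om n p).
  apply: ae_sym; apply: ae_trans ae _; by apply: eq_ae => x _; exact: dot_pairE.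
apply: (is_trace_ae oO bO AB wgn Ln ae').
apply/(is_traceP _ oO bO AB wgn); split; first exact: (@sqint0 _ _ _ (leb1 R) `[0, 1]%classic).
have tps k := pderiv_test_segment n (tp k).
have sp k : smooth (psi k) by case: (tp k).
exists (fun k x => n.1 * pderiv false (psi k) x + n.2 * pderiv true (psi k) x).
have wd k := whess_comb 1 (-1) mO wh (whess_smooth mO bO (sp k)).
have wE k : (fun x => 1 * p x + -1 * psi k x) = p \- psi k.
  by apply/funext => x /=; ring.
have bnd k i j := H2_norm_bound i j oO (wd k).
have bE k := congr1 (H2_norm Om) (wE k).
have bnd1 k i : norm2 Om (fun x => 1 * wderiv Om i p x + -1 * pderiv i (psi k) x) <=
    H2_norm Om (p \- psi k) by rewrite -(bE k); exact: (bnd k i i).1.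
have bnd2 k i j : norm2 Om (fun x => 1 * wderiv Om j (wderiv Om i p) x +
    -1 * pderiv j (pderiv i (psi k)) x) <= H2_norm Om (p \- psi k).
  by rewrite -(bE k); exact: (bnd k i j).2.
have Lc f : continuous f -> L2 Om f by exact: L2_continuous.
have n12 : `|n.1| <= 1 /\ `|n.2| <= 1.
  have n12 := nn; rewrite /dot -!expr2 in n12.
  by split; rewrite -(@ler_sqr R) ?nnegrE// expr1n real_normK ?num_real//;
    have := sqr_ge0 n.1; have := sqr_ge0 n.2; lra.
have key f f' : L2 Om f -> L2 Om f' -> norm2 Om (fun x => n.1 * f x + n.2 * f' x) <=
    norm2 Om f + norm2 Om f'.
  move=> Lf Lf'; apply: le_trans (norm2D mO (L2Z mO n.1 Lf) (L2Z mO n.2 Lf')) _.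
  rewrite !(norm2Z mO)//; case: n12 => n1 n2.
  by apply: lerD; rewrite -[leRHS]mul1r ler_wpM2r ?norm2_ge0.
have cvg2 : (H2_norm Om (p \- psi k) + H2_norm Om (p \- psi k)) @[k --> \oo] --> (0 : R).
  exact: cvgD0.
split.
- by move=> k; case: (tps k).
- apply: cvg0_squeeze cvg2 => k; rewrite norm2_ge0.
  rewrite combB.
  apply: le_trans (key _ _ ((wd k).1 false).2.1 ((wd k).1 true).2.1) _.
  exact: lerD (bnd1 k false) (bnd1 k true).
- move=> i; apply: cvg0_squeeze cvg2 => k; rewrite norm2_ge0.
  have -> : pderiv i (fun x => n.1 * pderiv false (psi k) x + n.2 * pderiv true (psi k) x) =
      (fun x => n.1 * pderiv i (pderiv false (psi k)) x + n.2 * pderiv i (pderiv true (psi k)) x).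
    have sf := smooth_pderiv false (sp k); have st := smooth_pderiv true (sp k).
    rewrite (pderivD i (CkZ n.1 (sf 1%N)) (CkZ n.2 (st 1%N))).
    by rewrite (pderivZ i n.1 (sf 1%N)) (pderivZ i n.2 (st 1%N)).
  rewrite combB.
  apply: le_trans (key _ _ ((wd k).2 false i).2.1 ((wd k).2 true i).2.1) _.
  exact: lerD (bnd2 k false i) (bnd2 k true i).
- rewrite (_ : (fun k => _) = cst 0); first exact: cvg_cst.
  apply/funext => k; rewrite -[RHS](@nrm_diag _ _ _ (leb1 R) `[0, 1]%classic (cst 0)).
  apply: eq_nrm => t t01 /=.
  rewrite (test_out (tps k)) ?subr0//.
  by have [] : (closure Om `\` Om) (param A B t) by apply: bd; exists t.
Qed.

End Polygon.

(** * Jumps of normal derivatives *)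

Section Quadratic.
Variable R : realType.
Implicit Types (p q w : plane R -> R) (x : plane R).

Lemma smooth_fst : smooth (fun x => x.1).
Proof.
have -> : (fun x => x.1) = ridge (fun t : R => t) 0 (1, 0).
  by apply/funext => x; rewrite /ridge /dot /= mul1r mul0r addr0 add0r.
by apply: smooth_ridge => k; exact: Cn_id.
Qed.

Lemma smooth_snd : smooth (fun x => x.2).
Proof.
have -> : (fun x => x.2) = ridge (fun t : R => t) 0 (0, 1).
  by apply/funext => x; rewrite /ridge /dot /= mul1r mul0r !add0r.
by apply: smooth_ridge => k; exact: Cn_id.
Qed.

Lemma quadratic_smooth p : quadratic p -> smooth p.
Proof.
move=> [c0 [c1 [c2 [c3 [c4 [c5 pE]]]]]].
have s1 := smooth_fst; have s2 := smooth_snd.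
have -> : p = (((((cst c0) \+ (fun x => c1 * x.1)) \+ (fun x => c2 * x.2)) \+
   (fun x => c3 * x.1 ^+ 2)) \+ (fun x => c4 * (x.1 * x.2))) \+ (fun x => c5 * x.2 ^+ 2).
  by apply/funext => x; rewrite pE.
by do !apply: smoothD; [exact: smooth_cst|apply: smoothZ..]; rewrite ?expr2 //; exact: smoothM.
Qed.

Lemma pderiv_expansion i p b (c : plane R -> R) :
  (forall x t, p (x + t *: axis R i) = p x + b x * t + c x * t ^+ 2) -> pderiv i p = b.
Proof.
move=> pE; apply/funext => x; apply: pderiv_unique.
have pE' (t : R) : p (t *: axis R i + x) = p x + (b x * (t + 0) + c x * (t + 0) ^+ 2).
  by rewrite addr0 addrC pE addrA.
apply: (@is_derive_lineP _ p x (axis R i) (fun t : R => p x + (b x * t + c x * t ^+ 2)) 0 (b x) pE').2.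
have d1 : is_derive (0 : R) (1 : R) (fun t : R => b x * t) (b x).
  have := @is_deriveZ R R R id (b x) (0 : R) 1 1 (is_derive_id _ _).
  by rewrite -[b x *: 1]/(b x * 1) mulr1.
have d2 : is_derive (0 : R) (1 : R) (fun t : R => c x * t ^+ 2) 0.
  have := @is_deriveZ R R R (id ^+ 2) (c x) (0 : R) 1 _ (is_deriveX 2 (is_derive_id _ _)).
  by rewrite /= expr1 mulr0 scale0r scaler0.
by have := is_deriveD (is_derive_cst (p x) (0 : R) 1) (is_deriveD d1 d2); rewrite addr0 add0r.
Qed.

Lemma quadratic_lap p : quadratic p -> exists c : R, lap p = cst c.
Proof.
move=> [c0 [c1 [c2 [c3 [c4 [c5 pE]]]]]]; exists (2 * c5 + 2 * c3).
have pf : pderiv false p = (fun x => c1 + 2 * c3 * x.1 + c4 * x.2).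
  apply: (pderiv_expansion (c := fun=> c3)) => x t; rewrite !pE /axis !vecE /=.
  by rewrite !expr2; ring.
have pt : pderiv true p = (fun x => c2 + 2 * c5 * x.2 + c4 * x.1).
  apply: (pderiv_expansion (c := fun=> c5)) => x t; rewrite !pE /axis !vecE /=.
  by rewrite !expr2; ring.
have pff : pderiv false (pderiv false p) = cst (2 * c3).
  rewrite pf; apply: (pderiv_expansion (c := fun=> 0)) => x t; rewrite /axis !vecE /=.
  by rewrite !expr2; ring.
have ptt : pderiv true (pderiv true p) = cst (2 * c5).
  rewrite pt; apply: (pderiv_expansion (c := fun=> 0)) => x t; rewrite /axis !vecE /=.
  by rewrite !expr2; ring.
by apply/funext => x; rewrite /lap big_bool /= pff ptt.
Qed.

End Quadratic.

Lemma seg_nrm_ae (R : realType) (f g : R -> R) : sqint (leb1 R) `[0, 1] f -> sqint (leb1 R) `[0, 1] g ->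
  ae_eq (leb1 R) `[0, 1]%classic f g -> nrm (leb1 R) `[0, 1] f = nrm (leb1 R) `[0, 1] g.
Proof. exact: (@ae_nrm _ _ _ (leb1 R) _ (measurable_itv `[0, 1])). Qed.

Lemma ae_sum (R : realType) (J : finType) (S : {set J}) (F G : J -> R -> R) :
  (forall j, j \in S -> sqint (leb1 R) `[0, 1] (F j) /\
     ae_eq (leb1 R) `[0, 1]%classic (F j) (G j)) ->
  sqint (leb1 R) `[0, 1] (fun t => \sum_(j in S) F j t) /\
  ae_eq (leb1 R) `[0, 1]%classic (fun t => \sum_(j in S) F j t) (fun t => \sum_(j in S) G j t).
Proof.
move=> H; have E (K : J -> R -> R) : (fun t => \sum_(j in S) K j t) = (fun t => \sum_(j <- enum S) K j t).
  by apply/funext => t; rewrite big_enum.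
rewrite !E; have {}H j : j \in enum S -> sqint (leb1 R) `[0, 1] (F j) /\
     ae_eq (leb1 R) `[0, 1]%classic (F j) (G j) by rewrite mem_enum; exact: H.
elim: (enum S) H => [|j r IH] H.
  have N (K : J -> R -> R) : (fun t => \sum_(j <- [::]) K j t) = cst 0.
    by apply/funext => t; rewrite big_nil.
  by rewrite !N; split; [exact: (@sqint0 _ _ _ (leb1 R))|exact: nearW].
have C (K : J -> R -> R) : (fun t => \sum_(i <- j :: r) K i t) = K j \+ (fun t => \sum_(i <- r) K i t).
  by apply/funext => t; rewrite big_cons.
have [s1 a1] := H j (mem_head _ _).
have [|s2 a2] := IH; first by move=> i ir; apply: H; rewrite inE ir orbT.
rewrite !C; split; first exact: seg_sqintD.
exact: (ae_eq_comp2 (fun a b => a + b) a1 a2).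
Qed.

Section Jumps.
Variables (R : realType) (Om : set (plane R)) (M : mesh R) (kappa : R).
Hypotheses (pO : polygonal_domain Om) (tM : is_triangulation M Om).
Hypotheses (k0 : 0 < kappa) (sM : shape_regular M kappa).
Local Notation I := ('I_(nvert M)).
Local Notation V := (@vert R M).
Implicit Types (T : {set I}) (e : I * I) (p ph w : plane R -> R) (A B n x : plane R).
Implicit Types (g : bool -> plane R -> R) (h : bool -> bool -> plane R -> R).

Let oO : open Om. Proof. by case: pO. Qed.
Let bO : bounded_set Om. Proof. by case: pO. Qed.
Let rO : interior (closure Om) = Om. Proof. by case: pO => _ _ _ _ []. Qed.
Let mO : measurable Om := open_plane_measurable oO.
Let oT T : open (cell T) := @open_cell R M T.
Arguments oT : clear implicits.
Let mT T : measurable (cell T) := open_plane_measurable (oT T).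
Let bT T : T \in triangles M -> bounded_set (cell T) := @bounded_cell R Om M bO rO tM T.
Let TO T : T \in triangles M -> cell T `<=` Om := @cell_sub R Om M rO tM T.

(** A sequence of functions smooth on the whole plane that approximates [w] in
    [Om] does so in both triangles, and its limit on the common side does not
    depend on the triangle. *)
Lemma common_trace (T1 T2 : {set I}) A B w g : T1 \in triangles M -> T2 \in triangles M -> A != B ->
  trace_domain (cell T1) A B -> wgrad Om w g -> approximable Om w g ->
  exists gam, is_trace (cell T1) A B w gam /\ is_trace (cell T2) A B w gam.
Proof.
move=> t1 t2 AB dT wg [psi [sp pw pg]].
have Lc f : continuous f -> L2 Om f by exact: L2_continuous.
have pwT T : T \in triangles M -> norm2 (cell T) (w \- psi k) @[k --> \oo] --> (0 : R).
  move=> tT; apply: cvg0_squeeze pw => k; rewrite norm2_ge0; apply: (norm2S (mT T) mO (TO tT)).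
  by apply: (L2B mO (wg false).1); apply: Lc; exact: smooth_continuous.
have pgT T i : T \in triangles M -> norm2 (cell T) (g i \- pderiv i (psi k)) @[k --> \oo] --> (0 : R).
  move=> tT; apply: cvg0_squeeze (pg i) => k; rewrite norm2_ge0; apply: (norm2S (mT T) mO (TO tT)).
  by apply: (L2B mO (wg i).2.1); apply: Lc; apply: smooth_continuous; exact: smooth_pderiv.
have wgT T : T \in triangles M -> wgrad (cell T) w g.
  by move=> tT; exact: (wgradS (mT T) mO (TO tT) wg).
have [gam sg [_ _ _ pt]] := trace_seq_exists (oT T1) (bT t1) AB dT (wgT _ t1) sp (pwT _ t1)
  (fun i => pgT T1 i t1).
exists gam; split.
  apply/(is_traceP _ (oT T1) (bT t1) AB (wgT _ t1)); split=> //; exists psi; split=> //.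
    exact: pwT.
  by move=> i; exact: pgT.
apply/(is_traceP _ (oT T2) (bT t2) AB (wgT _ t2)); split=> //; exists psi; split=> //.
  exact: pwT.
by move=> i; exact: pgT.
Qed.

Definition dircomb n g : plane R -> R := fun x => n.1 * g false x + n.2 * g true x.

Lemma dircombZ (c : R) n g : dircomb (c *: n) g = (fun x => c * dircomb n g x).
Proof. by apply/funext => x; rewrite /dircomb /= -![c *: _]/(c * _); ring. Qed.

Lemma dircombB n g g' : dircomb n (fun i => g i \- g' i) =
  (fun x => 1 * dircomb n g x + -1 * dircomb n g' x).
Proof. by apply/funext => x; rewrite /dircomb /=; ring. Qed.

Lemma is_traceZ (c : R) T A B w g gam : open (cell T) -> bounded_set (cell T) -> A != B ->
  wgrad (cell T) w g -> is_trace (cell T) A B w gam ->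
  is_trace (cell T) A B (fun x => c * w x) (fun x => c * gam x).
Proof.
move=> oT' bT' AB wg tr; have := is_trace_comb c 0 oT' bT' AB wg wg tr tr.
have E (f : plane R -> R) : (fun x => c * f x + 0 * f x) = (fun x => c * f x).
  by apply/funext => x; rewrite mul0r addr0.
by rewrite !E.
Qed.

(** On an interior edge the two traces of the gradient coincide and the outward
    normals are opposite; a boundary edge lies on the boundary of the domain,
    where the normal derivative vanishes by the definition of Q. *)
Lemma normal_trace p e : Qspace Om p -> e \in edges M ->
  exists gam : {set I} -> plane R -> R,
    (forall T, T \in edge_triangles e -> is_trace (cell T) (V e.1) (V e.2)
       (dircomb (outward_normal T e) (fun i => wderiv Om i p)) (gam T)) /\
    forall x, \sum_(T in edge_triangles e) gam T x = 0.
Proof.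
move=> Qp eE; have AB := edge_vert_neq tM eE.
have H2p := Qp.1; have wh := H2_whess H2p.
move: wh; set g := fun i => wderiv Om i p; set h := fun i j => wderiv Om j (g i) => wh.
have wgn n := wgrad_comb n.1 n.2 mO (wh.2 false) (wh.2 true).
have [[T TE]|[T1 [T2 [T12 TE]]]] := edge_triangles_cases bO rO tM k0 sM eE.
  have bd := boundary_edge rO tM eE TE.
  have TE1 : T \in edge_triangles e by rewrite TE inE.
  have [tT [k [k1 k2 Tk D0 hE]]] := edge_geometry tM eE TE1.
  have tr := Qp.2 _ _ AB bd.
  have [ae Ln] := nderiv_ae (unit_normal (V e.1) (V e.2)) oO wh.1.
  have wgm := wgn (unit_normal (V e.1) (V e.2)).
  have ae' : ae_eq_on Om (nderiv Om (unit_normal (V e.1) (V e.2)) p)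
      (dircomb (unit_normal (V e.1) (V e.2)) g).
    by apply: ae_trans ae _; apply: eq_ae => x _; exact: dot_pairE.
  have wgm' : wgrad Om (nderiv Om (unit_normal (V e.1) (V e.2)) p)
     (fun j => dircomb (unit_normal (V e.1) (V e.2)) (fun i => h i j)).
    apply: (wgrad_ae mO wgm Ln) (ae_sym ae') _ => j; last exact: ae_refl.
    by case: (wgm j) => _ [].
  have tr1 := is_trace_ae oO bO AB wgm' (wgm false).1 ae' tr.
  have tr2 := is_traceS (oT T) oO bO AB (TO tT) wgm tr1.
  have wgT := wgradS (mT T) mO (TO tT) wgm.
  exists (fun _ => cst 0); split; last by move=> x; rewrite big1.
  move=> T'; rewrite TE inE => /eqP ->.
  have := outward_normalE tM eE k1 k2 D0; rewrite -Tk => ->.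
  have -> : (cst 0 : plane R -> R) = (fun x => Num.sg (cross (V e.2 - V e.1) (V k - V e.1)) * cst 0 x).
    by apply/funext => x; rewrite /= mulr0.
  by rewrite dircombZ; exact: (is_traceZ _ (oT T) (bT tT) AB wgT tr2).
have TE1 : T1 \in edge_triangles e by rewrite TE !inE eqxx.
have TE2 : T2 \in edge_triangles e by rewrite TE !inE eqxx orbT.
have [t1 _] := edge_geometry tM eE TE1; have [t2 _] := edge_geometry tM eE TE2.
have ap := Qspace_approximable pO Qp.
set n := outward_normal T1 e.
have apn := approximable_comb n.1 n.2 oO bO (wh.2 false) (wh.2 true) (ap false) (ap true).
have [gam [tr1 tr2]] := common_trace t1 t2 AB (trace_domain_cell tM eE TE1) (wgn n) apn.
have [G [G1 G2]] : exists G : {set I} -> plane R -> R, G T1 = gam /\ G T2 = (fun x => - gam x).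
  exists (fun T => if T == T1 then gam else (fun x => - gam x)).
  by rewrite eqxx eq_sym (negbTE T12).
exists G; split; last first.
  by move=> x; rewrite TE big_setU1 ?inE//= big_set1 G1 G2 subrr.
move=> T TT; have : (T == T1) || (T == T2) by move: TT; rewrite TE !inE.
move=> /orP[|] /eqP ->; first (rewrite G1; exact: tr1).
rewrite G2 (opposite_normals bO rO tM k0 sM eE TE1 TE2 T12) -/n.
have wgT := wgradS (mT T2) mO (TO t2) (wgn n).
have -> : (fun x => - gam x) = (fun x => -1 * gam x) by apply/funext => x; rewrite mulN1r.
by rewrite -scaleN1r dircombZ; exact: (is_traceZ _ (oT T2) (bT t2) AB wgT tr2).
Qed.

Lemma piecewise_smooth ph T : L2 Om ph -> piecewise_P2 M ph -> T \in triangles M ->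
  exists q, [/\ quadratic q, ae_eq_on (cell T) ph q &
    whess (cell T) ph (fun i => pderiv i q) (fun i j => pderiv j (pderiv i q))].
Proof.
move=> Lp pp tT; have [q qq pq] := pp T tT; exists q; split=> //.
have [w1 w2] := whess_smooth (mT T) (bT tT) (quadratic_smooth qq).
split=> //; apply: (wgrad_ae (mT T) w1) (ae_sym pq) _ => //.
- exact: (L2S (mT T) mO (TO tT)).
- by move=> i; case: (w1 i) => _ [].
- by move=> i; exact: ae_refl.
Qed.

Lemma whess_sub T p ph g h g' h' : whess (cell T) p g h -> whess (cell T) ph g' h' ->
  whess (cell T) (p \- ph) (fun i => g i \- g' i) (fun i j => h i j \- h' i j).
Proof.
move=> w1 w2; have := whess_comb 1 (-1) (mT T) w1 w2.
have E (f f' : plane R -> R) : (fun x => 1 * f x + -1 * f' x) = f \- f'.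
  by apply/funext => x /=; rewrite mul1r mulN1r.
by rewrite E; congr whess; apply/funext => i; rewrite ?E//; apply/funext => j; rewrite E.
Qed.

(** The traces of the two triangles cancel in the jump of [p]. *)
Lemma dn_jump_eq p ph e : Qspace Om p -> L2 Om ph -> piecewise_P2 M ph -> e \in edges M ->
  enorm e (jump_dn e (p \- ph)) = enorm e (jump_dn e ph).
Proof.
move=> Qp Lp pp eE; have AB := edge_vert_neq tM eE.
have wh := H2_whess Qp.1; have [gam [trg gam0]] := normal_trace Qp eE.
move: wh trg; set g := fun i => wderiv Om i p; set h := fun i j => wderiv Om j (g i) => wh trg.
have sm T : exists K : plane R -> R, T \in edge_triangles e ->
   [/\ seg_L2 (V e.1) (V e.2) (etrace T e (nderiv (cell T) (outward_normal T e) ph)),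
   ae_eq (leb1 R) `[0, 1]%classic
     (etrace T e (nderiv (cell T) (outward_normal T e) ph) \o param (V e.1) (V e.2))
     (K \o param (V e.1) (V e.2)),
    seg_L2 (V e.1) (V e.2) (etrace T e (nderiv (cell T) (outward_normal T e) (p \- ph))) &
   ae_eq (leb1 R) `[0, 1]%classic
     (etrace T e (nderiv (cell T) (outward_normal T e) (p \- ph)) \o param (V e.1) (V e.2))
     ((gam T \- K) \o param (V e.1) (V e.2))].
  have [TE|] := boolP (T \in edge_triangles e); last by exists (cst 0).
  have [tT _] := edge_geometry tM eE TE.
  have [q [qq pq wq]] := piecewise_smooth Lp pp tT.
  set n := outward_normal T e.
  have dT := trace_domain_cell tM eE TE.
  have wT := whessS (mT T) mO (TO tT) wh.
  have wnT := wgrad_comb n.1 n.2 (mT T) (wT.2 false) (wT.2 true).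
  have [w1 w2] := whess_smooth (mT T) (bT tT) (quadratic_smooth qq).
  have sK : smooth (dircomb n (fun i => pderiv i q)).
    by apply: smoothD; apply: smoothZ; apply: smooth_pderiv; exact: quadratic_smooth.
  have wK := wgrad_C1 (mT T) (bT tT) (sK 1%N).
  have trK := is_trace_smooth (oT T) (bT tT) AB sK.
  have nE g' h' v : whess (cell T) v g' h' -> ae_eq_on (cell T) (dircomb n g') (nderiv (cell T) n v) /\
      L2 (cell T) (nderiv (cell T) n v).
    move=> w'; have [ae Ln] := nderiv_ae n (oT T) w'.1; split=> //.
    apply: ae_sym; apply: ae_trans ae _; apply: eq_ae => x _; exact: dot_pairE.
  exists (dircomb n (fun i => pderiv i q)) => _.
  have [aeh Lh] := nE _ _ _ wq.
  have [aed Ld] := nE _ _ _ (whess_sub wT wq).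
  have tr1 := is_trace_ae (oT T) (bT tT) AB wK Lh aeh trK.
  have wh1 := wgrad_ae (mT T) wK Lh (fun i => (wK i).2.1) aeh (fun i => @ae_refl _ _ _).
  have [s1 a1] := trace_ae (oT T) (bT tT) AB dT wh1 tr1.
  have trd := is_trace_comb 1 (-1) (oT T) (bT tT) AB wnT wK (trg T TE) trK.
  have wd := wgrad_comb 1 (-1) (mT T) wnT wK.
  have E (f f' : plane R -> R) : (fun x => 1 * f x + -1 * f' x) = f \- f'.
    by apply/funext => x /=; rewrite mul1r mulN1r.
  rewrite dircombB in aed; rewrite (E (gam T)) in trd.
  have tr2 := is_trace_ae (oT T) (bT tT) AB wd Ld aed trd.
  have wh2 := wgrad_ae (mT T) wd Ld (fun i => (wd i).2.1) aed (fun i => @ae_refl _ _ _).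
  have [s2 a2] := trace_ae (oT T) (bT tT) AB dT wh2 tr2.
  split; [exact: s1|exact: a1|exact: s2|exact: a2].
have [K HK] := choice sm.
pose Fh T (t : R) := etrace T e (nderiv (cell T) (outward_normal T e) ph) (param (V e.1) (V e.2) t).
pose Fv T (t : R) := etrace T e (nderiv (cell T) (outward_normal T e) (p \- ph)) (param (V e.1) (V e.2) t).
have [s1 a1] : sqint (leb1 R) `[0, 1] (fun t => \sum_(T in edge_triangles e) Fh T t) /\
    ae_eq (leb1 R) `[0, 1]%classic (fun t => \sum_(T in edge_triangles e) Fh T t)
      (fun t => \sum_(T in edge_triangles e) K T (param (V e.1) (V e.2) t)).
  apply: (@ae_sum R _ _ Fh (fun T t => K T (param (V e.1) (V e.2) t))) => T TE.
  by case: (HK T TE) => a b _ _; exact: (conj a b).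
have [s2 a2] : sqint (leb1 R) `[0, 1] (fun t => \sum_(T in edge_triangles e) Fv T t) /\
    ae_eq (leb1 R) `[0, 1]%classic (fun t => \sum_(T in edge_triangles e) Fv T t)
      (fun t => \sum_(T in edge_triangles e)
         (gam T (param (V e.1) (V e.2) t) - K T (param (V e.1) (V e.2) t))).
  apply: (@ae_sum R _ _ Fv (fun T t => gam T (param (V e.1) (V e.2) t) -
    K T (param (V e.1) (V e.2) t))) => T TE.
  by case: (HK T TE) => _ _ a b; exact: (conj a b).
have nN (f : R -> R) : nrm (leb1 R) `[0, 1] (fun t => - f t) = nrm (leb1 R) `[0, 1] f := nrmN _ _ _.
have s1' : sqint (leb1 R) `[0, 1] (fun t => - \sum_(T in edge_triangles e) Fh T t).
  by apply: eq_sqint (seg_sqintZ (-1) s1) => t _; rewrite mulN1r.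
suff H : nrm (leb1 R) `[0, 1] (fun t => - \sum_(T in edge_triangles e) Fv T t) =
    nrm (leb1 R) `[0, 1] (fun t => - \sum_(T in edge_triangles e) Fh T t).
  exact: (etrans (seg_normE _ _ _) (etrans (congr1 ( *%R _) H) (esym (seg_normE _ _ _)))).
rewrite [LHS](nN (fun t => \sum_(T in edge_triangles e) Fv T t)).
apply: (seg_nrm_ae s2 s1').
apply: ae_eq_trans a2 _.
apply: (@ae_eq_trans _ _ _ (leb1 R) _ _ _ (fun t => - \sum_(T in edge_triangles e) K T (param (V e.1) (V e.2) t))).
  by apply: nearW => t _; rewrite sumrB gam0 sub0r.
exact: (ae_eq_comp2 (fun a _ => - a) (ae_eq_sym a1) (ae_eq_sym a1)).
Qed.

(** By [dn_jump_eq] the estimator is a term of the mesh-dependent norm. *)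
Lemma eta_dn_le p ph (sigma : R) e : Qspace Om p -> L2 Om ph -> piecewise_P2 M ph ->
  1 <= sigma -> e \in edges M -> eta_dn ph e <= hnorm M sigma (p \- ph).
Proof.
move=> Qp Lp pp s1 eE; rewrite /eta_dn -(dn_jump_eq Qp Lp pp eE).
move: (p \- ph) => v.
have e0 : 0 < elen e by rewrite edist_gt0// (edge_vert_neq tM).
have n0 : 0 <= enorm e (jump_dn e v) by exact: sqrtr_ge0.
have a0 : 0 <= (Num.sqrt (elen e))^-1 * enorm e (jump_dn e v).
  by rewrite mulr_ge0// invr_ge0 sqrtr_ge0.
rewrite -(ger0_norm a0) -sqrtr_sqr; apply: ler_wsqrtr.
rewrite exprMn exprVn sqr_sqrtr; last exact: ltW.
apply: (@le_trans _ _ (sigma / elen e * enorm e (jump_dn e v) ^+ 2)).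
  by apply: ler_wpM2r; [exact: sqr_ge0|rewrite ler_peMl// invr_ge0 ltW].
have t0 (e' : I * I) : 0 <= sigma / elen e' * enorm e' (jump_dn e' v) ^+ 2.
  have he : 0 <= elen e' := edist_ge0 _ _.
  by apply: mulr_ge0; [apply: divr_ge0 => //; lra|exact: sqr_ge0].
rewrite [X in _ <= _ + X](bigD1 e)//= addrCA lerDl addr_ge0//.
  by apply: sumr_ge0 => *; exact: sqr_ge0.
by apply: sumr_ge0 => *; exact: t0.
Qed.

End Jumps.

(** * Bumps on the line *)

Section Bumps.
Variable R : realType.
Implicit Types (f g b : R -> R).

Definition bump f := smooth1 f /\ forall t, 1 < `|t| -> f t = 0.

Lemma bumpD f g : bump f -> bump g -> bump (f \+ g).
Proof.
by move=> [sf f0] [sg g0]; split; [exact: smooth1D|move=> t t1; rewrite /= f0// g0// addr0].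
Qed.

Lemma bumpM f g : smooth1 f -> bump g -> bump (f \* g).
Proof. by move=> sf [sg g0]; split; [exact: smooth1M|move=> t t1; rewrite /= g0// mulr0]. Qed.

Lemma bumpZ c f : bump f -> bump (fun t => c * f t).
Proof. by move=> [sf f0]; split; [exact: smooth1Z|move=> t t1; rewrite f0// mulr0]. Qed.

Lemma bump_derive f : bump f -> bump (derive1 f).
Proof.
move=> [sf f0]; split; first exact: smooth1_derive.
move=> t t1; have nE : \forall s \near t, 0 = f s.
  near=> s; rewrite f0//.
  by near: s; apply: (@cvgr_gt _ _ (nbhs t) _ (fun s => `|s|) `|t|) => //; exact: cvg_norm.
by rewrite derive1E; have := near_eq_is_derive nE (is_derive_cst 0 t (1 : R)) => -[].
Unshelve. all: by end_near. Qed.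

Lemma bump_continuous f : bump f -> continuous f.
Proof. by move=> [sf _]; exact: smooth1_continuous. Qed.

Lemma bump_bounded f : bump f -> exists2 S : R, 0 <= S & forall t, `|f t| <= S.
Proof.
move=> bf; have /compact_bounded[M [_ HM]] : compact (f @` `[-1, 1]%classic).
  apply: continuous_compact; last exact: segment_compact.
  by apply: continuous_subspaceT; exact: bump_continuous.
exists (`|M| + 1); first by rewrite addr_ge0.
move=> t; have [t1|t1] := ltP 1 `|t|; first by rewrite (bf.2 t t1) normr0 addr_ge0.
apply: (HM (`|M| + 1)); first by rewrite (le_lt_trans (ler_norm _))// ltrDl.
by exists t => //=; rewrite in_itv/= -ler_norml.
Qed.

Lemma bump_integrable f : bump f -> (leb1 R).-integrable setT (EFin \o f).
Proof.
move=> bf; have cf := bump_continuous bf.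
have i1 : (leb1 R).-integrable `[(-1)%R, 1%R] (EFin \o f).
  by apply: continuous_compact_integrable; [exact: segment_compact|exact: continuous_subspaceT].
rewrite (_ : EFin \o f = (EFin \o f) \_ `[(-1)%R, 1%R]%classic).
  exact: (@integrable_mkcond _ _ _ (leb1 R) `[(-1)%R, 1%R]%classic (EFin \o f) (measurable_itv _)).1.
apply/funext => t; rewrite patchE; case: ifPn => //.
by rewrite notin_setE /= in_itv/= => /negP; rewrite -ler_norml -ltNge => /bf.2 ->.
Qed.

Definition tot1 f : R := \int[leb1 R]_t f t.

Lemma tot1D f g : bump f -> bump g -> tot1 (f \+ g) = tot1 f + tot1 g.
Proof. by move=> /bump_integrable bf /bump_integrable bg; exact: RintegralD. Qed.

Lemma tot1Z c f : bump f -> tot1 (fun t => c * f t) = c * tot1 f.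
Proof. by move=> /bump_integrable bf; exact: RintegralZl. Qed.

Lemma tot1_derive f : bump f -> tot1 (derive1 f) = 0.
Proof.
move=> bf; have cf' := smooth1_continuous (smooth1_derive bf.1).
by rewrite /tot1 /Rintegral (integral_derive_compact (smooth1_is_derive bf.1) cf' bf.2).
Qed.

Lemma smooth1_id : smooth1 (fun t : R => t).
Proof. by move=> k; exact: Cn_id. Qed.

Lemma smooth1_Xn n : smooth1 (fun t : R => t ^+ n).
Proof.
elim: n => [|n IH]; first by move=> k; exact: Cn_cst.
have -> : (fun t : R => t ^+ n.+1) = (fun t => t) \* (fun t => t ^+ n).
  by apply/funext => t; rewrite exprS.
exact: smooth1M smooth1_id IH.
Qed.

Lemma derive1_unique f (l : R -> R) : (forall t : R, is_derive t (1 : R) f (l t)) -> derive1 f = l.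
Proof. by move=> H; apply/funext => t; rewrite derive1E; apply: derive_val. Qed.

(** The derivative of [t ^+ n.+1 * f t] has integral zero. *)
Lemma moment_derive n f : bump f ->
  tot1 (fun t => t ^+ n.+1 * derive1 f t) = - n.+1%:R * tot1 (fun t => t ^+ n * f t).
Proof.
move=> bf; pose p := (fun t : R => t ^+ n.+1) \* f.
have bp : bump p by exact: bumpM (smooth1_Xn _) bf.
have dp : derive1 p = (fun t => n.+1%:R * (t ^+ n * f t)) \+ (fun t => t ^+ n.+1 * derive1 f t).
  apply: derive1_unique => t.
  have d1 : is_derive t (1 : R) (fun t : R => t ^+ n.+1) (n.+1%:R * t ^+ n).
    have -> : (fun t : R => t ^+ n.+1) = id ^+ n.+1 by apply/funext => s; rewrite exprfctE.
    apply: (is_derive_eq (is_deriveX n.+1 (is_derive_id t (1 : R)))).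
    by rewrite -[LHS]/(_ * _) mulr1.
  apply: (is_derive_eq (is_deriveM d1 (smooth1_is_derive bf.1 t))).
  by rewrite /= -![_ *: _]/(_ * _) addrC; congr (_ + _); ring.
have b1 : bump (fun t => t ^+ n * f t) by exact: bumpM (smooth1_Xn _) bf.
have b2 : bump (fun t => t ^+ n.+1 * derive1 f t).
  by exact: bumpM (smooth1_Xn _) (bump_derive bf).
have := tot1_derive bp; rewrite dp tot1D//; last exact: bumpZ.
by rewrite tot1Z// mulNr => /eqP; rewrite addrC addr_eq0 => /eqP.
Qed.

Definition hat (t : R) : R := ramp (1 + t) * ramp (1 - t).

Lemma bump_hat : bump hat.
Proof.
split.
  apply: smooth1M => k.
    have := Cn_affine 1 1 (@smooth1_ramp R k).
    by congr Cn; apply/funext => t; rewrite mul1r addrC.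
  have := Cn_affine (-1) 1 (@smooth1_ramp R k).
  by congr Cn; apply/funext => t; rewrite mulN1r addrC.
move=> t; rewrite /hat lter_normr => /orP[t1|t1].
  by rewrite [X in _ * X]ramp_le0 ?mulr0//; lra.
by rewrite ramp_le0 ?mul0r//; lra.
Qed.

Lemma hat_gt0 t : -1 < t < 1 -> 0 < hat t.
Proof. by move=> /andP[? ?]; rewrite mulr_gt0// ramp_gt0//; lra. Qed.

Lemma tot1_hat : 0 < tot1 hat.
Proof.
have i := bump_integrable bump_hat.
have h0 t : 0 <= hat t by rewrite mulr_ge0// ramp_ge0.
have mh : measurable_fun setT (EFin \o hat) by exact: measurable_int i.
have ramp_half x : 2^-1 <= x -> expR (-2) <= ramp x.
  move=> x2; have x0 : 0 < x by apply: lt_le_trans x2.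
  by rewrite rampE// ler_expR lerN2 -[2]invrK lef_pV2 ?posrE.
pose m : R := expR (-2) * expR (-2).
have m0 : 0 < m by rewrite mulr_gt0// expR_gt0.
have hm t : `[(- 2^-1)%R, (2^-1)%R]%classic t -> m <= hat t.
  rewrite /= in_itv/= => /andP[t1 t2]; apply: ler_pM; rewrite ?expR_ge0//; apply: ramp_half; lra.
apply: (@lt_le_trans _ _ m) => //.
rewrite -lee_fin /tot1 /Rintegral fineK; last first.
  by apply: integrable_fin_num => //; exact: measurableT.
apply: (@le_trans _ _ (\int[leb1 R]_(t in `[(- 2^-1)%R, (2^-1)%R]) m%:E)%E).
  rewrite integral_cst//= lebesgue_measure_itv/= lte_fin ifT; last by lra.
  by rewrite -EFinD -EFinM lee_fin (_ : 2^-1 - - 2^-1 = 1 :> R) ?mulr1//; field.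
apply: (@le_trans _ _ (\int[leb1 R]_(t in `[(- 2^-1)%R, (2^-1)%R]) (hat t)%:E)%E).
  apply: ge0_le_integral => //.
  - by move=> t _; rewrite lee_fin ltW.
  - exact: measurable_funS mh.
apply: (@ge0_subset_integral _ _ _ (leb1 R) _ _ _ _ (EFin \o hat)) => // t _.
by rewrite lee_fin.
Qed.

(** For a bump [b] of integral one the moments of order at most two of [b], [b']
    and [b''] form a triangular matrix with nonzero diagonal, so suitable
    combinations of these three functions are dual to the monomials. *)
Lemma dual_bumps : exists d : nat -> R -> R, (forall k, bump (d k)) /\
  forall j k, (j < 3)%N -> (k < 3)%N -> tot1 (fun t => t ^+ j * d k t) = (j == k)%:R.
Proof.
pose b t := (tot1 hat)^-1 * hat t.
have bb : bump b by exact: bumpZ bump_hat.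
have b1 : tot1 b = 1 by rewrite tot1Z ?mulVf ?gt_eqF ?tot1_hat//; exact: bump_hat.
pose b' := derive1 b; pose b'' := derive1 b'.
have bb' : bump b' by exact: bump_derive.
have bb'' : bump b'' by exact: bump_derive.
pose mu k := tot1 (fun t => t ^+ k * b t).
pose D (x y z : R) t := x * b t + (y * b' t + z * b'' t).
have X n f : bump f -> bump (fun t => t ^+ n * f t) by move=> bf; exact: bumpM (smooth1_Xn _) bf.
have momD x y z n : tot1 (fun t => t ^+ n * D x y z t) = x * mu n +
    (y * tot1 (fun t => t ^+ n * b' t) + z * tot1 (fun t => t ^+ n * b'' t)).
  have -> : (fun t => t ^+ n * D x y z t) = (fun t => x * (t ^+ n * b t)) \+
     ((fun t => y * (t ^+ n * b' t)) \+ (fun t => z * (t ^+ n * b'' t))).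
    by apply/funext => t; rewrite /D /=; ring.
  rewrite tot1D ?tot1D ?tot1Z//; try apply: bumpD; try apply: bumpZ; exact: X.
have e0 f : tot1 (fun t => t ^+ 0 * f t) = tot1 f.
  by congr tot1; apply/funext => t; rewrite expr0 mul1r.
have m0 : mu 0%N = 1 by rewrite /mu e0.
have b'0 : tot1 (fun t => t ^+ 0 * b' t) = 0 by rewrite e0; exact: tot1_derive.
have b''0 : tot1 (fun t => t ^+ 0 * b'' t) = 0 by rewrite e0; exact: tot1_derive.
have b'1 : tot1 (fun t => t ^+ 1 * b' t) = - 1 by rewrite moment_derive// -/(mu 0%N) m0 mulr1.
have b'2 : tot1 (fun t => t ^+ 2 * b' t) = - 2 * mu 1%N by rewrite moment_derive.
have b''1 : tot1 (fun t => t ^+ 1 * b'' t) = 0 by rewrite moment_derive// b'0 mulr0.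
have b''2 : tot1 (fun t => t ^+ 2 * b'' t) = 2.
  by rewrite moment_derive// b'1 mulrNN mulr1.
exists (fun k => match k with
  | 0 => D 1 (mu 1%N) (mu 1%N ^+ 2 - mu 2%N / 2)
  | 1 => D 0 (-1) (- mu 1%N)
  | _ => D 0 0 2^-1 end); split.
  have bD x y z : bump (D x y z) by apply: bumpD; [|apply: bumpD]; exact: bumpZ.
  by case=> [|[|k]].
by case=> [|[|[|//]]] [|[|[|//]]] _ _; rewrite momD ?m0 ?b'0 ?b'1 ?b'2 ?b''0 ?b''1 ?b''2 /=; field.
Qed.

End Bumps.

(** * Tensor products in orthonormal frames *)

Section Frames.
Variable R : realType.
Implicit Types (f g h a b : R -> R) (m n v w x y : plane R) (F G : plane R -> R) (r c : R).

Definition tot2 F : R := \int[leb2 R]_x F x.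

Lemma tensor_integral g h : (leb1 R).-integrable setT (EFin \o g) ->
  (leb1 R).-integrable setT (EFin \o h) ->
  (leb2 R).-integrable setT (EFin \o (fun x => g x.1 * h x.2)) /\
  tot2 (fun x => g x.1 * h x.2) = tot1 g * tot1 h.
Proof.
move=> ig ih; have /measurable_EFinP mg := measurable_int _ ig.
have /measurable_EFinP mh := measurable_int _ ih.
have mF : measurable_fun setT (fun x : measurableTypeR R * measurableTypeR R => (g x.1 * h x.2)%:E).
  apply/measurable_EFinP; apply: measurable_funM.
    exact: measurableT_comp mg measurable_fst.
  exact: measurableT_comp mh measurable_snd.
have /integrableP[_ gy] := ig; have /integrableP[_ hy] := ih.
have iF : (leb2 R).-integrable setT (EFin \o (fun x => g x.1 * h x.2)).
  apply/(integrable12ltyP (leb1 R) (leb1 R) mF).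
  have E (s : R) : (\int[leb1 R]_t `|(g s * h t)%:E| = `|g s|%:E * \int[leb1 R]_t `|(EFin \o h) t|)%E.
    rewrite -ge0_integralZl_EFin//; last by apply: measurableT_comp => //; exact/measurable_EFinP.
    by apply: eq_integral => t _; rewrite /= normrM EFinM.
  have -> : (\int[leb1 R]_s \int[leb1 R]_t `|(g (s, t).1 * h (s, t).2)%:E| =
      \int[leb1 R]_s (`|(EFin \o g) s| * \int[leb1 R]_t `|(EFin \o h) t|))%E.
    by apply: eq_integral => s _; exact: E.
  have I0 : (0 <= \int[leb1 R]_t `|(EFin \o h) t|)%E by exact: integral_ge0.
  move: I0 hy; set I := (\int[leb1 R]_t `|(EFin \o h) t|)%E; case: I => // I I0 _.
  have mg' : measurable_fun setT (fun s => `|(EFin \o g) s|)%E.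
    by apply: measurableT_comp => //; exact: measurable_int ig.
  rewrite ge0_integralZr// muleC lte_mul_pinfty//.
split=> //; rewrite /tot2 /Rintegral -(integral12_prod_meas1 iF) /fubini_F.
have E (s : R) : (\int[leb1 R]_t (g s * h t)%:E = (g s * tot1 h)%:E)%E.
  have := @integralZl _ _ _ (leb1 R) _ measurableT _ ih (g s).
  rewrite EFinM /tot1 /Rintegral fineK; last by apply: integrable_fin_num.
  by move=> <-; apply: eq_integral => t _; rewrite /= EFinM.
transitivity (fine (\int[leb1 R]_s ((EFin \o g) s * (tot1 h)%:E)))%E.
  by congr fine; apply: eq_integral => s _; rewrite -EFinM; exact: E.
rewrite (@integralZr _ _ _ (leb1 R) _ measurableT _ ig (tot1 h)).
by rewrite fineM//; apply: integrable_fin_num.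
Qed.

Lemma integral_affine2 F (p1 p2 a b c d : R) : a * d - b * c != 0 ->
  (leb2 R).-integrable setT (EFin \o F) ->
  let F' x := F (p1 + a * x.1 + b * x.2, p2 + c * x.1 + d * x.2) in
  (leb2 R).-integrable setT (EFin \o F') /\ tot2 F' = `|a * d - b * c|^-1 * tot2 F.
Proof.
move=> D0 iF F'; have mF := measurable_int _ iF.
pose A x : plane R := (p1 + a * x.1 + b * x.2, p2 + c * x.1 + d * x.2).
have mA : measurable_fun (setT : set (measurableTypeR R * measurableTypeR R)%type) A.
  by apply: measurable_fun_pair; exact: measurable_affine2.
have pos (G : plane R -> \bar R) : measurable_fun setT G -> (forall x, 0 <= G x)%E ->
    (\int[leb2 R]_x G (A x) = `|a * d - b * c|^-1%:E * \int[leb2 R]_x G x)%E.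
  by move=> mG G0; exact: ge0_integral_affine2.
have /integrableP[_ Fy] := iF.
have iF' : (leb2 R).-integrable setT (EFin \o F').
  apply/integrableP; split; first exact: (measurableT_comp mF mA).
  have mFa : measurable_fun setT (fun x => `|(EFin \o F) x|)%E by apply: measurableT_comp.
  by rewrite (pos _ mFa)// lte_mul_pinfty// lee_fin invr_ge0.
split=> //; rewrite /tot2 /Rintegral.
rewrite (integralE (leb2 R) setT (EFin \o F')) (integralE (leb2 R) setT (EFin \o F)).
have fp : (\int[leb2 R]_x (EFin \o F)^\+ x \is a fin_num)%E.
  by apply: integrable_fin_num => //; exact: integrable_funepos.
have fn : (\int[leb2 R]_x (EFin \o F)^\- x \is a fin_num)%E.
  by apply: integrable_fin_num => //; exact: integrable_funeneg.
have -> : (\int[leb2 R]_x (EFin \o F')^\+ x = `|a * d - b * c|^-1%:E * \int[leb2 R]_x (EFin \o F)^\+ x)%E.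
  have H := pos _ (measurable_funepos mF) (fun x => funepos_ge0 (EFin \o F) x); rewrite -H.
  by apply: eq_integral => x _; rewrite !funeposE.
have -> : (\int[leb2 R]_x (EFin \o F')^\- x = `|a * d - b * c|^-1%:E * \int[leb2 R]_x (EFin \o F)^\- x)%E.
  have H := pos _ (measurable_funeneg mF) (fun x => funeneg_ge0 (EFin \o F) x); rewrite -H.
  by apply: eq_integral => x _; rewrite !funenegE.
by rewrite -(fineK fp) -(fineK fn) -!EFinM -!EFinB /= mulrBr.
Qed.

Definition perp n : plane R := (- n.2, n.1).

(** Coordinates with respect to the orthonormal basis [n], [perp n] and the origin
    [m], in the unit of length [r]. *)
Definition frame m n r x : plane R := (dot n (x - m) / r, dot (perp n) (x - m) / r).

Lemma integral_frame m n r F : 0 < r -> dot n n = 1 -> (leb2 R).-integrable setT (EFin \o F) ->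
  (leb2 R).-integrable setT (EFin \o (F \o frame m n r)) /\
  tot2 (F \o frame m n r) = r ^+ 2 * tot2 F.
Proof.
move=> r0 nn iF; have rn : r != 0 by rewrite gt_eqF.
have D : n.1 / r * (n.1 / r) - n.2 / r * (- n.2 / r) = (r ^+ 2)^-1.
  by transitivity (dot n n / r ^+ 2); [rewrite /dot; field|rewrite nn mul1r].
have D0 : n.1 / r * (n.1 / r) - n.2 / r * (- n.2 / r) != 0 by rewrite D invr_neq0// expf_neq0.
have := integral_affine2 (- dot n m / r) (- dot (perp n) m / r) D0 iF.
rewrite D ger0_norm ?invr_ge0 ?sqr_ge0// invrK /=.
suff -> : (fun x => F (- dot n m / r + n.1 / r * x.1 + n.2 / r * x.2,
   - dot (perp n) m / r + - n.2 / r * x.1 + n.1 / r * x.2)) = F \o frame m n r by [].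
by apply/funext => x /=; congr F; rewrite /frame /perp !vecE /dot /=; congr pair; field.
Qed.

Definition tens m n r a b x := a (frame m n r x).1 * b (frame m n r x).2.

Lemma tens_ridge m n r a b : tens m n r a b =
  ridge a (- dot n m / r) (r^-1 *: n) \* ridge b (- dot (perp n) m / r) (r^-1 *: perp n).
Proof.
apply/funext => x; rewrite /tens /ridge /=.
by congr (a _ * b _); rewrite /perp !vecE /dot /=; ring.
Qed.

Lemma smooth_tens m n r a b : smooth1 a -> smooth1 b -> smooth (tens m n r a b).
Proof. by move=> sa sb; rewrite tens_ridge; apply: smoothM; exact: smooth_ridge. Qed.

Lemma pderiv_tens i m n r a b : smooth1 a -> smooth1 b ->
  pderiv i (tens m n r a b) = (fun x =>
    (if i then n.2 else n.1) / r * tens m n r (derive1 a) b x +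
    (if i then n.1 else - n.2) / r * tens m n r a (derive1 b) x).
Proof.
move=> sa sb; apply/funext => x; apply: pderiv_unique; rewrite tens_ridge.
have := is_derive_mul (is_derive_ridge _ _ i x (smooth1_is_derive sa))
  (is_derive_ridge _ _ i x (smooth1_is_derive sb)).
move=> /(_ (- dot n m / r) (r^-1 *: n) (- dot (perp n) m / r) (r^-1 *: perp n)).
move=> H; apply: (is_derive_eq H); rewrite !tens_ridge !scale2E /=.
by case: i {H}; rewrite /perp /=; ring.
Qed.

Lemma lap_tens m n r a b x : r != 0 -> dot n n = 1 -> smooth1 a -> smooth1 b ->
  lap (tens m n r a b) x =
    (r ^+ 2)^-1 * (tens m n r (derive1 (derive1 a)) b x + tens m n r a (derive1 (derive1 b)) x).
Proof.
move=> r0 nn sa sb; have sa' := smooth1_derive sa; have sb' := smooth1_derive sb.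
have P2 i : pderiv i (pderiv i (tens m n r a b)) x =
    (if i then n.2 else n.1) / r * ((if i then n.2 else n.1) / r * tens m n r (derive1 (derive1 a)) b x +
      (if i then n.1 else - n.2) / r * tens m n r (derive1 a) (derive1 b) x) +
    (if i then n.1 else - n.2) / r * ((if i then n.2 else n.1) / r * tens m n r (derive1 a) (derive1 b) x +
      (if i then n.1 else - n.2) / r * tens m n r a (derive1 (derive1 b)) x).
  have s1 := smooth_tens m n r sa' sb; have s2 := smooth_tens m n r sa sb'.
  rewrite (pderiv_tens _ _ _ _ sa sb).
  rewrite (pderivD i (CkZ _ (s1 1%N)) (CkZ _ (s2 1%N))) (pderivZ i _ (s1 1%N)) (pderivZ i _ (s2 1%N)).
  by rewrite (pderiv_tens _ _ _ _ sa' sb) (pderiv_tens _ _ _ _ sa sb').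
rewrite /lap big_bool /= !P2.
move: (tens _ _ _ _ _ x) (tens _ _ _ _ _ x) (tens _ _ _ _ _ x) => A B C.
have nn' : n.1 ^+ 2 + n.2 ^+ 2 = 1 by rewrite !expr2.
transitivity ((n.1 ^+ 2 + n.2 ^+ 2) / r ^+ 2 * (A + C)); first by field.
by rewrite nn' mul1r addrC.
Qed.

Lemma frame_sqr m n r x : r != 0 -> dot n n = 1 ->
  dot (x - m) (x - m) = r ^+ 2 * ((frame m n r x).1 ^+ 2 + (frame m n r x).2 ^+ 2).
Proof.
move=> r0 nn; transitivity (dot n n * dot (x - m) (x - m)); first by rewrite nn mul1r.
by rewrite /frame /perp !vecE /dot /=; field.
Qed.

(** The square on which the bumps are supported lies in the disc of radius
    [Num.sqrt 2 * r]. *)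
Lemma tens_out m n r a b x : 0 < r -> dot n n = 1 -> bump a -> bump b ->
  2 * r ^+ 2 < dot (x - m) (x - m) -> tens m n r a b x = 0.
Proof.
move=> r0 nn [_ a0] [_ b0]; rewrite (frame_sqr _ _ (lt0r_neq0 r0) nn) mulrC ltr_pM2l ?exprn_gt0//.
rewrite /tens; move: (frame m n r x) => [s t] /= st.
have [s1|s1] := ltP 1 `|s|; first by rewrite a0 ?mul0r.
have [t1|t1] := ltP 1 `|t|; first by rewrite b0 ?mulr0.
have sq (u : R) : `|u| <= 1 -> u ^+ 2 <= 1.
  by move=> u1; rewrite -real_normK ?num_real// expr_le1.
by have := sq _ s1; have := sq _ t1; lra.
Qed.

Lemma test_tens m n r a b (O : set (plane R)) : 0 < r -> dot n n = 1 -> bump a -> bump b ->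
  (forall x, edist x m < 2 * r -> O x) -> test_function O (tens m n r a b).
Proof.
move=> r0 nn ba bb HO; split; first by apply: smooth_tens; [exact: ba.1|exact: bb.1].
have cd : continuous (fun x => dot (x - m) (x - m)).
  move=> x; apply: cvgD; apply: cvgM; apply: cvgB; (exact: cvg_cst || exact: cvg_fst || exact: cvg_snd).
exists [set x | dot (x - m) (x - m) <= 2 * r ^+ 2]; split.
- apply: (subclosed_compact _ (@compact_crect R (m.1 - 2 * r) (m.1 + 2 * r) (m.2 - 2 * r) (m.2 + 2 * r))).
    by apply: (closed_comp _ (@closed_le R (2 * r ^+ 2))) => x _; exact: cd.
  move=> x /=; rewrite /dot !vecE /= => h.
  have sq (u : R) : u * u <= 4 * (r * r) -> `|u| <= 2 * r.
    move=> u4; have r2 : 0 <= 2 * r by rewrite mulr_ge0// ltW.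
    by rewrite -(@ler_sqr R) ?nnegrE// real_normK ?num_real// !expr2; lra.
  have := sqr_ge0 (x.1 - m.1); have := sqr_ge0 (x.2 - m.2); rewrite !expr2 => h2 h1.
  have rr : 0 < r * r by rewrite mulr_gt0.
  have /ler_normlP[u1 u2] : `|x.1 - m.1| <= 2 * r by apply: sq; move: h; rewrite expr2; lra.
  have /ler_normlP[u3 u4] : `|x.2 - m.2| <= 2 * r by apply: sq; move: h; rewrite expr2; lra.
  by split; rewrite /= in_itv/=; apply/andP; split; lra.
- move=> x /= h; apply: HO; have r2 : 0 < 2 * r by rewrite mulr_gt0.
  rewrite -(@ltr_sqr R) ?nnegrE ?edist_ge0 ?ltW// edist_sqr; apply: le_lt_trans h _.
  by rewrite exprMn ltr_pM2r ?exprn_gt0// expr2; lra.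
- by move=> x /= /negP; rewrite -ltNge; exact: tens_out.
Qed.

End Frames.

(** * Testing with bubbles *)

Section MeshSize.
Variables (R : realType) (Om : set (plane R)) (M : mesh R) (kappa : R).
Hypotheses (bO : bounded_set Om) (rO : interior (closure Om) = Om).
Hypotheses (tM : is_triangulation M Om) (k0 : 0 < kappa) (sM : shape_regular M kappa).
Local Notation I := ('I_(nvert M)).
Local Notation V := (@vert R M).
Implicit Types (T : {set I}) (x y : plane R) (f : plane R -> R).

Lemma hT_gt0 T : T \in triangles M -> 0 < hT T.
Proof.
move=> tT; have [i [j [k [ij ik jk TE]]]] := triangle_trips tM tT.
apply: (@lt_le_trans _ _ (edist (V i) (V j))); first by rewrite edist_gt0// (vert_neq tM).
apply: (edist_hT bO rO tM tT); rewrite TE; apply/(hull_trips _ ij ik jk).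
- by exists 1, 0, 0; rewrite !scale0r scale1r !addr0; split.
- by exists 0, 1, 0; rewrite !scale0r scale1r !addr0 !add0r; split.
Qed.

Lemma inscribed_disc T : T \in triangles M -> exists c, hull T c /\
  forall x, edist x c < hT T / kappa -> cell T x.
Proof.
move=> tT; have [c cT] := sM tT; have r0 : 0 < hT T / kappa by rewrite divr_gt0 ?hT_gt0.
exists c; split.
  by apply: cT; rewrite /= edist_le ?(ltW r0)// /dot subrr mul0r addr0 sqr_ge0.
move=> x xc; rewrite /cell /interior.
apply: (@filterS _ _ _ [set y | edist y c < hT T / kappa]).
  by move=> y yc; apply: cT; rewrite /= edistC ltW.
exact: (open_nbhs_nbhs (conj (@edist_cst_open _ c _) xc)).
Qed.

Lemma abs_le_edist x y : `|(x - y).1| <= edist x y /\ `|(x - y).2| <= edist x y.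
Proof.
split; rewrite -(@ler_sqr R) ?nnegrE ?edist_ge0// edist_sqr real_normK ?num_real// /dot -!expr2.
  by rewrite lerDl sqr_ge0.
by rewrite lerDr sqr_ge0.
Qed.

(** The triangle lies in a square of side [2 * hT T]. *)
Lemma cell_norm_bounded T f (S : R) : T \in triangles M -> 0 <= S -> continuous f ->
  (forall x, cell T x -> `|f x| <= S) -> norm2 (cell T) f <= S * (2 * hT T).
Proof.
move=> tT S0 cf fS; have h0 := hT_gt0 tT.
have oT := @open_cell R M T; have mT := open_plane_measurable oT.
have [c [hc _]] := inscribed_disc tT.
pose K := crect (c.1 - hT T) (c.1 + hT T) (c.2 - hT T) (c.2 + hT T).
have TK : cell T `<=` K.
  move=> x /interior_subset hx; have xc := edist_hT bO rO tM tT hx hc.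
  have [/le_trans/(_ xc)/ler_normlP[a1 a2] /le_trans/(_ xc)/ler_normlP[a3 a4]] := abs_le_edist x c.
  move: a1 a2 a3 a4; rewrite !vecE /= => a1 a2 a3 a4.
  by split; rewrite /= in_itv/=; apply/andP; split; lra.
have Koo : (leb2 R K < +oo)%E by exact: mu2_crect_lt.
have mK : measurable K by exact: measurable_crect.
have TK' : (leb2 R (cell T) <= leb2 R K)%E by apply: le_measure => //; rewrite inE.
have itvE (s : R) : lebesgue_measure (`[s - hT T, s + hT T]%classic : set R) = (2 * hT T)%:E.
  rewrite lebesgue_measure_itv/= lte_fin ifT; last by lra.
  by rewrite -EFinD; congr EFin; ring.
have KE : leb2 R K = ((2 * hT T) ^+ 2)%:E.
  transitivity ((2 * hT T)%:E * (2 * hT T)%:E)%E; last by rewrite -EFinM expr2.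
  apply: etrans (congr2 mule (itvE c.1) (itvE c.2)).
  by apply: product_measure1E; exact: measurable_itv.
have mf : measurable_fun (cell T) f by exact: continuous_plane_measurable.
have [_] := L2_bounded mT mf (le_lt_trans TK' Koo) fS; move=> /le_trans; apply.
rewrite ger0_norm// ler_wpM2l//.
have h2 : 0 <= 2 * hT T by rewrite mulr_ge0// ltW.
rewrite -[leRHS]ger0_norm// -sqrtr_sqr; apply: ler_wsqrtr.
rewrite -lee_fin fineK; first by rewrite -KE.
by rewrite ge0_fin_numE//; exact: le_lt_trans TK' Koo.
Qed.

End MeshSize.

Section Bubble.
Variable R : realType.
Implicit Types (x y m n : plane R) (z F : plane R -> R).

Lemma tot2_sum (J : Type) (s : seq J) (F : J -> plane R -> R) :
  (forall j, (leb2 R).-integrable setT (EFin \o F j)) ->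
  (leb2 R).-integrable setT (EFin \o (fun x => \sum_(j <- s) F j x)) /\
  tot2 (fun x => \sum_(j <- s) F j x) = \sum_(j <- s) tot2 (F j).
Proof.
move=> iF; elim: s => [|j s [IH1 IH2]].
  have -> : (fun x => \sum_(j <- [::]) F j x) = cst 0 by apply/funext => x; rewrite big_nil.
  rewrite big_nil; split; first exact: integrable0.
  by rewrite /tot2 /Rintegral integral0_eq.
have -> : (fun x => \sum_(i <- j :: s) F i x) = F j \+ (fun x => \sum_(i <- s) F i x).
  by apply/funext => x; rewrite big_cons.
split; first by have := integrableD measurableT (iF j) IH1.
by rewrite big_cons -IH2; exact: RintegralD.
Qed.

Definition deg2 : seq (nat * nat) := [:: (0, 0); (1, 0); (0, 1); (2, 0); (1, 1); (0, 2)]%N.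

Lemma quadratic_frame z m r : r != 0 -> quadratic z -> exists E : nat * nat -> R,
  forall x, z x = \sum_(p <- deg2) E p * ((frame m (1, 0) r x).1 ^+ p.1 * (frame m (1, 0) r x).2 ^+ p.2).
Proof.
move=> r0 [c0 [c1 [c2 [c3 [c4 [c5 zE]]]]]].
exists (fun p => match p with
  | (0, 0) => c0 + c1 * m.1 + c2 * m.2 + c3 * m.1 ^+ 2 + c4 * (m.1 * m.2) + c5 * m.2 ^+ 2
  | (1, 0) => r * (c1 + 2 * c3 * m.1 + c4 * m.2)
  | (0, 1) => r * (c2 + 2 * c5 * m.2 + c4 * m.1)
  | (2, 0) => r ^+ 2 * c3
  | (1, 1) => r ^+ 2 * c4
  | (_, _) => r ^+ 2 * c5 end).
by move=> x; rewrite zE /deg2 !big_cons big_nil /frame /perp !vecE /dot /=; field.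
Qed.

(** A quadratic function whose pairings with all test functions of a triangle are
    small is itself small, uniformly over shape-regular triangles. In
    coordinates scaled to the inscribed disc its coefficients are its pairings
    with tensor products of dual bumps, and the Laplacian of such a product is of
    order [hT T ^- 2]. *)
Lemma bubble_estimate (kappa : R) : 0 < kappa -> exists2 C : R, 0 < C &
  forall Om (M : mesh R), bounded_set Om -> interior (closure Om) = Om ->
  is_triangulation M Om -> shape_regular M kappa ->
  forall (T : {set 'I_(nvert M)}) z (a b : R), T \in triangles M -> quadratic z -> 0 <= a -> 0 <= b ->
  (forall psi, test_function (cell T) psi ->
     `|inner (cell T) z psi| <= norm2 (cell T) psi * a + norm2 (cell T) (lap psi) * b) ->
  hT T ^+ 2 * norm2 (cell T) z <= C * (hT T ^+ 2 * a + b).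
Proof.
move=> k0; have [d [bd dual]] := dual_bumps R.
have [S S0 HS] : exists2 S : R, 0 < S & forall k t, (k < 3)%N ->
    `|d k t| <= S /\ `|derive1 (derive1 (d k)) t| <= S.
  have sb k : exists S : R, 0 <= S /\ forall t, `|d k t| <= S /\ `|derive1 (derive1 (d k)) t| <= S.
    have [s1 s10 H1] := bump_bounded (bd k).
    have [s2 s20 H2] := bump_bounded (bump_derive (bump_derive (bd k))).
    exists (s1 + s2); split; first exact: addr_ge0.
    by move=> t; split; [apply: le_trans (H1 t) _; rewrite lerDl|apply: le_trans (H2 t) _; rewrite lerDr].
  have [S HS] := choice sb.
  exists (1 + (S 0%N + S 1%N + S 2%N)).
    by rewrite ltr_pwDl// !addr_ge0//; case: (HS 0%N); case: (HS 1%N); case: (HS 2%N).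
  move=> k t k3; have [s0 _] := HS 0%N; have [s1 _] := HS 1%N; have [s2 _] := HS 2%N.
  have [_ /(_ t)[h1 h2]] := HS k.
  have Sk : S k <= 1 + (S 0%N + S 1%N + S 2%N) by case: k k3 {h1 h2} => [|[|[|//]]] _; lra.
  by split; [exact: le_trans h1 Sk|exact: le_trans h2 Sk].
(* Bound for the scaled coordinates of the points of the triangle. *)
pose L := 1 + 2 * kappa.
have L1 : 1 <= L by rewrite lerDl mulr_ge0// ltW.
have L0 : 0 < L by exact: lt_le_trans L1.
pose C0 := 96 * kappa ^+ 2 * L ^+ 4 * S ^+ 2.
have C00 : 0 < C0 by rewrite !mulr_gt0// exprn_gt0.
have kk : 0 <= 8 * kappa ^+ 2 by rewrite mulr_ge0// sqr_ge0.
exists (C0 * (1 + 8 * kappa ^+ 2)).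
  by rewrite mulr_gt0// ltr_pwDl.
move=> Om M bO rO tM sM T z a b tT qz a0 b0 H.
have h0 := hT_gt0 bO rO tM tT; set h := hT T in h0 *.
have [c [hc discT]] := inscribed_disc bO rO tM k0 sM tT.
(* The square of half side [r] is then inside the disc of radius [h / kappa]. *)
pose r := h / (2 * kappa).
have r0 : 0 < r by rewrite divr_gt0// mulr_gt0.
have rn : r != 0 by rewrite gt_eqF.
have r2 : 2 * r = h / kappa by rewrite /r; field; rewrite gt_eqF.
have nn : dot ((1, 0) : plane R) (1, 0) = 1 by rewrite /dot /= mulr1 mulr0 addr0.
have [E zE] := quadratic_frame c rn qz.
pose psi k l := tens c (1, 0) r (d k) (d l).
have tpsi k l : test_function (cell T) (psi k l).
  by apply: test_tens => // x; rewrite r2; exact: discT.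
have coef k l : (k, l) \in deg2 -> inner (cell T) z (psi k l) = r ^+ 2 * E (k, l).
  move=> kl; have [k3 l3] : (k < 3)%N /\ (l < 3)%N.
    by move: kl; rewrite !inE => /or4P[/eqP[-> ->]|/eqP[-> ->]|/eqP[-> ->]|/or3P[] /eqP[-> ->]].
  rewrite inner_out; last by move=> x; exact: test_out.
  pose g (q : nat * nat) (t : R) := E q * (t ^+ q.1 * d k t).
  pose g' (q : nat * nat) (t : R) := t ^+ q.2 * d l t.
  have bg q : bump (g q) by apply: bumpZ; exact: bumpM (@smooth1_Xn R _) (bd k).
  have bg' q : bump (g' q) by exact: bumpM (@smooth1_Xn R _) (bd l).
  have ten q := tensor_integral (bump_integrable (bg q)) (bump_integrable (bg' q)).
  have [iG GE] := tot2_sum deg2 (fun q => (ten q).1).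
  have [_] := integral_frame c r0 nn iG; rewrite GE.
  have -> : \sum_(q <- deg2) tot2 (fun y => g q y.1 * g' q y.2) = E (k, l).
    have dE q : (q.1 < 3)%N -> (q.2 < 3)%N ->
        tot2 (fun y => g q y.1 * g' q y.2) = E q * ((q.1 == k)%:R * (q.2 == l)%:R).
      move=> q1 q2; rewrite (ten q).2 mulrA; congr (_ * _); last exact: dual.
      by rewrite -(dual _ _ q1 k3) -tot1Z//; exact: bumpM (@smooth1_Xn R _) (bd k).
    rewrite /deg2 !big_cons big_nil !dE//=.
    by move: kl; rewrite !inE => /or4P[/eqP[-> ->]|/eqP[-> ->]|/eqP[-> ->]|/or3P[] /eqP[-> ->]] /=; ring.
  move=> <-; rewrite /inner; apply: eq_Rintegral => x _ /=.
  rewrite zE mulr_suml; apply: eq_bigr => q _.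
  by rewrite /psi /tens /g /g'; ring.
(* The common bound for the coefficients. *)
pose Em := (S ^+ 2 * (2 * h) * a + (r ^+ 2)^-1 * (2 * S ^+ 2) * (2 * h) * b) / r ^+ 2.
have rr : 0 < r ^+ 2 by rewrite exprn_gt0.
have Em0 : 0 <= Em.
  rewrite divr_ge0 ?(ltW rr)// addr_ge0//; rewrite !mulr_ge0// ?sqr_ge0// ?invr_ge0 ?(ltW rr)//; exact: ltW.
have sm k l : smooth (psi k l) by apply: smooth_tens; [exact: (bd k).1|exact: (bd l).1].
have EEm p : p \in deg2 -> `|E p| <= Em.
  case: p => k l kl; have [k3 l3] : (k < 3)%N /\ (l < 3)%N.
    by move: kl; rewrite !inE => /or4P[/eqP[-> ->]|/eqP[-> ->]|/eqP[-> ->]|/or3P[] /eqP[-> ->]].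
  rewrite /Em ler_pdivlMr//; have := H _ (tpsi k l).
  rewrite coef// normrM (gtr0_norm rr) mulrC => /le_trans; apply; apply: lerD.
    apply: ler_wpM2r => //; apply: (cell_norm_bounded bO rO tM k0 sM tT).
    - exact: sqr_ge0.
    - exact: smooth_continuous.
    - move=> x _; rewrite normrM expr2; apply: ler_pM => //; [exact: (HS k _ k3).1|exact: (HS l _ l3).1].
  apply: ler_wpM2r => //; apply: (cell_norm_bounded bO rO tM k0 sM tT).
  - by rewrite mulr_ge0// ?invr_ge0 ?(ltW rr)// mulr_ge0// sqr_ge0.
  - have -> : lap (psi k l) = pderiv true (pderiv true (psi k l)) \+ pderiv false (pderiv false (psi k l)).
      by apply/funext => x; rewrite /lap big_bool.
    by apply: smooth_continuous; apply: smoothD; apply: smooth_pderiv; exact: smooth_pderiv.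
  - move=> x _; rewrite lap_tens//; [|exact: (bd k).1|exact: (bd l).1].
    rewrite normrM ger0_norm ?invr_ge0 ?(ltW rr)//; apply: ler_wpM2l; first by rewrite invr_ge0 ltW.
    have -> : 2 * S ^+ 2 = S ^+ 2 + S ^+ 2 by ring.
    apply: le_trans (ler_normD _ _) _.
    apply: lerD; rewrite normrM expr2; apply: ler_pM => //.
    + exact: (HS k _ k3).2.
    + exact: (HS l _ l3).1.
    + exact: (HS k _ k3).1.
    + exact: (HS l _ l3).2.
have zS x : cell T x -> `|z x| <= 6 * (Em * L ^+ 4).
  move=> /interior_subset hx; have xc := edist_hT bO rO tM tT hx hc.
  have X2 : (frame c (1, 0) r x).1 ^+ 2 + (frame c (1, 0) r x).2 ^+ 2 <= (2 * kappa) ^+ 2.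
    rewrite -(ler_pM2l rr) -(frame_sqr _ _ rn nn) -exprMn -edist_sqr.
    have rk : r * (2 * kappa) = h by rewrite /r divfK// gt_eqF// mulr_gt0.
    by rewrite rk ler_sqr ?nnegrE ?edist_ge0// ltW.
  have Xb : `|(frame c (1, 0) r x).1| <= L /\ `|(frame c (1, 0) r x).2| <= L.
    have k2 : 0 <= 2 * kappa by rewrite mulr_ge0// ltW.
    have := sqr_ge0 (frame c (1, 0) r x).1; have := sqr_ge0 (frame c (1, 0) r x).2 => q1 q2.
    split; apply: (@le_trans _ _ (2 * kappa)); rewrite ?lerDr// -(@ler_sqr R) ?nnegrE// real_normK ?num_real//; lra.
  rewrite zE; apply: le_trans (ler_norm_sum _ _ _) _.
  have -> : 6 * (Em * L ^+ 4) = \sum_(p <- deg2) Em * L ^+ 4 by rewrite /deg2 !big_cons big_nil; ring.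
  rewrite big_seq [leRHS]big_seq; apply: ler_sum => p pd.
  have [p1 p2] : (p.1 <= 2)%N /\ (p.2 <= 2)%N.
    by move: pd; rewrite !inE => /or4P[/eqP->|/eqP->|/eqP->|/or3P[] /eqP->].
  rewrite normrM; apply: ler_pM => //; first exact: EEm.
  rewrite normrM !normrX (_ : 4 = 2 + 2)%N// exprD.
  have pw (t : R) k : 0 <= t -> t <= L -> (k <= 2)%N -> t ^+ k <= L ^+ 2.
    move=> t0 tL k2; apply: (@le_trans _ _ (L ^+ k)).
      by apply: lerXn2r; rewrite ?nnegrE// ltW.
    by apply: ler_weXn2l.
  by apply: ler_pM; rewrite ?exprn_ge0//; apply: pw => //; case: Xb.
have zn : norm2 (cell T) z <= 6 * (Em * L ^+ 4) * (2 * h).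
  apply: (cell_norm_bounded bO rO tM k0 sM tT) => //.
    by rewrite mulr_ge0// mulr_ge0// exprn_ge0// ltW.
  by apply: smooth_continuous; exact: quadratic_smooth.
apply: (@le_trans _ _ (h ^+ 2 * (6 * (Em * L ^+ 4) * (2 * h)))).
  by apply: ler_wpM2l => //; exact: sqr_ge0.
have -> : h ^+ 2 * (6 * (Em * L ^+ 4) * (2 * h)) = C0 * (h ^+ 2 * a + 8 * kappa ^+ 2 * b).
  by rewrite /Em /C0 /r; field; rewrite !gt_eqF.
rewrite -[leRHS]mulrA; apply: ler_wpM2l; first exact: ltW.
have := mulr_ge0 (sqr_ge0 h) a0; move: (h ^+ 2 * a) (8 * kappa ^+ 2) kk => ha K K0 ha0.
have -> : (1 + K) * (ha + b) = (ha + K * b) + (K * ha + b) by ring.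
by rewrite lerDl addr_ge0// mulr_ge0.
Qed.

End Bubble.

(** * Weak equations and element residuals *)

Section WeakEquations.
Variable R : realType.
Implicit Types (O : set (plane R)) (psi chi w G f : plane R -> R).

Lemma pderiv_cst i (c : R) : pderiv i (cst c : plane R -> R) = cst 0.
Proof. by apply/funext => x; apply: pderiv_unique; exact: is_derive_cst. Qed.

Lemma lap_pderiv psi : lap psi = pderiv true (pderiv true psi) \+ pderiv false (pderiv false psi).
Proof. by apply/funext => x; rewrite /lap big_bool. Qed.

Lemma continuous_lap psi : smooth psi -> continuous (lap psi).
Proof.
move=> sp; rewrite lap_pderiv.
by apply: smooth_continuous; apply: smoothD; do 2 apply: smooth_pderiv.
Qed.

Lemma inner_cst_lap O (c : R) psi : open O -> bounded_set O -> test_function O psi ->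
  inner O (cst c) (lap psi) = 0.
Proof.
move=> oO bO tp; have mO := open_plane_measurable oO.
have Lc : L2 O (cst c) by apply: L2_continuous => // x; exact: cvg_cst.
have z i : inner O (cst c) (pderiv i (pderiv i psi)) = 0.
  rewrite (inner_pderiv i (Ck_cst 1 c) (test_pderiv i tp)) [pderiv i _]pderiv_cst.
  rewrite /inner /Rintegral integral0_eq ?oppr0// => x _; by rewrite mul0r.
have t2 i := test_L2 mO (test_pderiv i (test_pderiv i tp)).
rewrite lap_pderiv; apply: etrans (innerDr mO Lc (t2 true) (t2 false)) _.
exact: etrans (congr2 +%R (z true) (z false)) (addr0 _).
Qed.

Lemma test_Vspace O psi : open O -> bounded_set O -> test_function O psi -> Vspace O psi.
Proof.
move=> oO bO tp; have mO := open_plane_measurable oO.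
have wh := whess_smooth mO bO tp.1; split; first exact: whess_H2 wh.
exists (fun=> psi); split=> //.
have -> : psi \- psi = cst 0 by apply/funext => x /=; rewrite subrr.
have w0 := whess_smooth mO bO (@smooth_cst R 0).
have n0 : norm2 O (cst 0) = 0.
  have := @norm2_diag R O (cst 0).
  by congr (norm2 O _ = _); apply/funext => x /=; rewrite subrr.
have d1 i : norm2 O (wderiv O i (cst 0)) = 0.
  apply: etrans n0; apply: (ae_norm2 mO); [exact: (wderivP (w0.1 i)).2.1|exact: (@L20 _ O)|].
  by have := wderiv_ae oO (w0.1 i); rewrite pderiv_cst.
have d2 i j : norm2 O (wderiv O i (wderiv O j (cst 0))) = 0.
  have [ae L] := whess_wderiv j i oO w0.
  apply: etrans n0; apply: (ae_norm2 mO) => //; first exact: (@L20 _ O).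
  by move: ae; rewrite !pderiv_cst.
have -> : H2_norm O (cst 0) = 0.
  have s1 : \sum_(i : bool) norm2 O (wderiv O i (cst 0)) ^+ 2 = 0.
    by apply: big1 => i _; rewrite (d1 i) expr0n.
  have s2 : \sum_(i : bool) \sum_(j : bool) norm2 O (wderiv O i (wderiv O j (cst 0))) ^+ 2 = 0.
    by apply: big1 => i _; apply: big1 => j _; rewrite (d2 i j) expr0n.
  transitivity (Num.sqrt (Num.sqrt (0 ^+ 2 + 0) ^+ 2 + Num.sqrt 0 ^+ 2) : R).
    by congr (Num.sqrt (Num.sqrt (_ ^+ 2 + _) ^+ 2 + Num.sqrt _ ^+ 2)); [exact: n0|exact: s1|exact: s2].
  by rewrite expr0n /= addr0 sqrtr0 expr0n /= addr0 sqrtr0.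
exact: cvg_cst.
Qed.

(** The common form of the equations of the state, the adjoint state and the
    control. *)
Definition weak_biharmonic O w G := forall psi, test_function O psi ->
  inner O (wlap O w) (lap psi) = inner O G psi.

Lemma weak_biharmonicP O w G : open O -> bounded_set O -> H2 O w ->
  (forall v, Vspace O v -> abil O w v = inner O G v) -> weak_biharmonic O w G.
Proof.
move=> oO bO Hw H psi tp; have mO := open_plane_measurable oO.
rewrite -(H psi (test_Vspace oO bO tp)); have [ae L] := wlap_smooth oO bO tp.1.
have [_ Lw] := wlap_ae oO (H2_whess Hw).
apply: (ae_inner mO) => //; [exact: L2_lap_test tp|exact: ae_refl|exact: ae_sym].
Qed.

End WeakEquations.

Section Elements.
Variables (R : realType) (Om : set (plane R)) (M : mesh R).
Hypotheses (pO : polygonal_domain Om) (tM : is_triangulation M Om).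
Local Notation I := ('I_(nvert M)).
Implicit Types (T : {set I}) (w ph G psi z : plane R -> R).

Let oO : open Om. Proof. by case: pO. Qed.
Let bO : bounded_set Om. Proof. by case: pO. Qed.
Let rO : interior (closure Om) = Om. Proof. by case: pO => _ _ _ _ []. Qed.
Let mO : measurable Om := open_plane_measurable oO.

Lemma quadratic_wlap w ph T : H2 Om w -> L2 Om ph -> piecewise_P2 M ph -> T \in triangles M ->
  exists c : R, [/\ ae_eq_on (cell T) (wlap (cell T) ph) (cst c), L2 (cell T) (wlap (cell T) ph),
    ae_eq_on (cell T) (wlap (cell T) (w \- ph)) (wlap Om w \- cst c) &
    L2 (cell T) (wlap (cell T) (w \- ph))].
Proof.
move=> Hw Lp pp tT; have oT := @open_cell R M T; have mT := open_plane_measurable oT.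
have TO := @cell_sub R Om M rO tM T tT.
have [q [qq pq wq]] := piecewise_smooth pO tM Lp pp tT.
have [c cE] := quadratic_lap qq; exists c.
have [a1 L1] := wlap_ae oT wq.
have wT := whessS mT mO TO (H2_whess Hw).
have [a2 L2'] := wlap_ae oT (whess_sub wT wq).
have [a3 L3] := wlap_ae oO (H2_whess Hw).
split=> //.
  by apply: ae_trans a1 _; apply: eq_ae => x _; rewrite -[RHS](congr1 (fun f => f x) cE).
apply: ae_trans a2 _.
apply: (@ae_trans _ _ _ ((fun x => \sum_(i : bool) wderiv Om i (wderiv Om i w) x) \- cst c)).
  apply: eq_ae => x _; apply: etrans (sumrB _ _ _ _) _.
  exact: (congr1 (fun t => _ - t) (congr1 (fun f => f x) cE)).
by apply: (ae_comp2 (fun a b => a - b)); [exact: ae_refl|exact: ae_refl].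
Qed.

(** On [T] the Laplacian of the discrete function is a constant, and constants are
    orthogonal to the Laplacians of test functions of [T]. *)
Lemma element_identity w ph G psi T : H2 Om w -> L2 Om ph -> piecewise_P2 M ph ->
  weak_biharmonic Om w G -> T \in triangles M -> test_function (cell T) psi ->
  inner (cell T) G psi = inner (cell T) (wlap (cell T) (w \- ph)) (lap psi).
Proof.
move=> Hw Lp pp wG tT tp; have oT := @open_cell R M T; have mT := open_plane_measurable oT.
have TO := @cell_sub R Om M rO tM T tT; have bT := @bounded_cell R Om M bO rO tM T tT.
have [c [_ _ a1 L1]] := quadratic_wlap Hw Lp pp tT.
have [_ Lw] := wlap_ae oO (H2_whess Hw).
have LwT := L2S mT mO TO Lw.
have Ll := L2_lap_test mT tp.
have Lc : L2 (cell T) (cst c) by apply: L2_continuous => // x; exact: cvg_cst.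
rewrite (ae_inner mT L1 (L2B mT LwT Lc) Ll Ll a1 (@ae_refl _ _ _)) (innerBl mT)//.
rewrite inner_cst_lap// subr0 (inner_sub _ TO tp) -(wG _ (testS TO tp)).
have out x : ~ cell T x -> lap psi x = 0.
  move=> nx; rewrite lap_pderiv /= !(test_out _ nx) ?addr0//;
  by do 2 apply: test_pderiv.
rewrite !inner_out// => x nx; apply: out => // /TO; exact: nx.
Qed.

End Elements.

(** Any quadratic [z] may replace the right-hand side [G] on the triangle, at the
    price of the data error [G \- z]. *)
Lemma element_residual (R : realType) (kappa : R) : 0 < kappa -> exists2 C : R, 0 < C &
  forall Om (M : mesh R), polygonal_domain Om ->
  is_triangulation M Om -> shape_regular M kappa ->
  forall (T : {set 'I_(nvert M)}) w ph G z, H2 Om w -> L2 Om ph -> piecewise_P2 M ph ->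
  weak_biharmonic Om w G -> L2 Om G -> T \in triangles M -> quadratic z ->
  hT T ^+ 2 * norm2 (cell T) z <=
    C * (hT T ^+ 2 * norm2 (cell T) (G \- z) + lap_norm T (w \- ph)).
Proof.
move=> k0; have [C C0 HC] := bubble_estimate k0; exists C => //.
move=> Om M pO tM sM T w ph G z Hw Lp pp wG LG tT qz.
have [oO _ _ bO [rO _]] := pO.
have mO := open_plane_measurable oO.
have oT := @open_cell R M T; have mT := open_plane_measurable oT.
have TO := @cell_sub R Om M rO tM T tT; have bT := @bounded_cell R Om M bO rO tM T tT.
apply: (HC Om) => //; [exact: norm2_ge0|exact: norm2_ge0|].
move=> psi tp.
have LGT := L2S mT mO TO LG.
have Lz : L2 (cell T) z.
  by apply: L2_continuous => //; apply: smooth_continuous; exact: quadratic_smooth.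
have Lpsi := test_L2 mT tp; have Ll := L2_lap_test mT tp.
have [c [_ _ _ L1]] := quadratic_wlap pO tM Hw Lp pp tT.
have -> : inner (cell T) z psi = inner (cell T) G psi - inner (cell T) (G \- z) psi.
  by rewrite (innerBl mT)//; ring.
rewrite (element_identity pO tM Hw Lp pp wG tT tp) addrC.
apply: le_trans (ler_normD _ _) _; rewrite normrN; apply: lerD.
  by rewrite mulrC; apply: (cauchy_schwarz mT) => //; exact: L2B.
by rewrite mulrC; exact: (cauchy_schwarz mT).
Qed.

Section ElementEstimates.
Variables (R : realType) (kappa : R).
Hypothesis k0 : 0 < kappa.
Implicit Types (w ph G f ud u uh phi phih : plane R -> R).

(** For [z = cst (mean (cell T) f)] the data error is the oscillation of [f]. *)
Lemma eta1_estimate : exists2 C : R, 0 < C &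
  forall Om (M : mesh R), polygonal_domain Om ->
  is_triangulation M Om -> shape_regular M kappa ->
  forall (T : {set 'I_(nvert M)}) u uh f, H2 Om u -> L2 Om uh -> piecewise_P2 M uh ->
  weak_biharmonic Om u f -> L2 Om f -> T \in triangles M ->
  eta1 f T <= C * (hT T ^+ 2 * osc T f + lap_norm T (u \- uh)).
Proof.
have [C C0 HC] := element_residual k0; exists (1 + C); first by rewrite ltr_pwDl// ltW.
move=> Om M pO tM sM T u uh f Hu Lp pp wG Lf tT.
have [oO _ _ bO [rO _]] := pO.
have oT := @open_cell R M T; have mT := open_plane_measurable oT.
have TO := @cell_sub R Om M rO tM T tT; have bT := @bounded_cell R Om M bO rO tM T tT.
pose z : plane R -> R := cst (mean (cell T) f).
have qz : quadratic z.
  by exists (mean (cell T) f), 0, 0, 0, 0, 0 => x; rewrite !mul0r !addr0.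
have := HC _ _ pO tM sM T u uh f z Hu Lp pp wG Lf tT qz.
have LfT := L2S mT (open_plane_measurable oO) TO Lf.
have Lz : L2 (cell T) z by apply: L2_continuous => // x; exact: cvg_cst.
have oE : norm2 (cell T) (f \- z) = osc T f by [].
rewrite oE; have fz : f = (f \- z) \+ z by apply/funext => x /=; rewrite subrK.
have : norm2 (cell T) f <= osc T f + norm2 (cell T) z.
  by rewrite {1}fz; apply: (norm2D mT) => //; exact: L2B.
have l0 : 0 <= lap_norm T (u \- uh) by exact: norm2_ge0.
rewrite /eta1 => h1 h2.
apply: le_trans (ler_wpM2l (sqr_ge0 _) h1) _; rewrite mulrDr mulrDl mul1r.
by move: h2; set A := hT T ^+ 2 * osc T f; lra.
Qed.

(** The choice of [z] as the quadratic [uh] minus the mean of [ud]: its data error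
    is [u \- uh] up to the oscillation of [ud]. *)
Lemma eta2_estimate : exists2 C : R, 0 < C &
  forall Om (M : mesh R), polygonal_domain Om ->
  is_triangulation M Om -> shape_regular M kappa ->
  forall (T : {set 'I_(nvert M)}) phi phih u uh ud, H2 Om phi -> L2 Om phih -> piecewise_P2 M phih ->
  weak_biharmonic Om phi (u \- ud) -> L2 Om u -> L2 Om ud -> L2 Om uh -> piecewise_P2 M uh ->
  T \in triangles M ->
  eta2 uh ud T <= C * (hT T ^+ 2 * osc T ud + hT T ^+ 2 * norm2 (cell T) (u \- uh)
                       + lap_norm T (phi \- phih)).
Proof.
have [C C0 HC] := element_residual k0; exists (1 + C); first by rewrite ltr_pwDl// ltW.
move=> Om M pO tM sM T phi phih u uh ud Hphi Lp pp wG Lu Lud Luh puh tT.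
have [oO _ _ bO [rO _]] := pO.
have mO := open_plane_measurable oO.
have oT := @open_cell R M T; have mT := open_plane_measurable oT.
have TO := @cell_sub R Om M rO tM T tT; have bT := @bounded_cell R Om M bO rO tM T tT.
have [g qg ag] := puh T tT.
pose mu := mean (cell T) ud; pose z : plane R -> R := g \- cst mu.
have qz : quadratic z.
  case: qg => [c0 [c1 [c2 [c3 [c4 [c5 gE]]]]]]; exists (c0 - mu), c1, c2, c3, c4, c5 => x.
  by rewrite /z /= gE; ring.
have := HC _ _ pO tM sM T phi phih (u \- ud) z Hphi Lp pp wG (L2B mO Lu Lud) tT qz.
have LuT := L2S mT mO TO Lu; have LudT := L2S mT mO TO Lud; have LuhT := L2S mT mO TO Luh.
have Lg : L2 (cell T) g.
  by apply: L2_continuous => //; apply: smooth_continuous; exact: quadratic_smooth.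
have Lmu : L2 (cell T) (cst mu) by apply: L2_continuous => // x; exact: cvg_cst.
have Lz : L2 (cell T) z by exact: L2B.
have Lo : L2 (cell T) (ud \- cst mu) by exact: L2B.
have oE : norm2 (cell T) (ud \- cst mu) = osc T ud by [].
have Lug := L2B mT LuT Lg.
have n1 : norm2 (cell T) ((u \- ud) \- z) <= norm2 (cell T) (u \- uh) + osc T ud.
  have -> : (u \- ud) \- z = (u \- g) \- (ud \- cst mu).
    by apply/funext => x; rewrite /z /=; ring.
  rewrite -oE; have <- : norm2 (cell T) (u \- g) = norm2 (cell T) (u \- uh).
    apply: (ae_norm2 mT) => //; first exact: L2B.
    exact: (ae_comp2 (fun a b => a - b) (@ae_refl _ _ _) (ae_sym ag)).
  exact: norm2B.
have n2 : norm2 (cell T) (uh \- ud) <= norm2 (cell T) z + osc T ud.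
  rewrite -oE; have -> : norm2 (cell T) (uh \- ud) = norm2 (cell T) (z \- (ud \- cst mu)).
    have -> : z \- (ud \- cst mu) = g \- ud by apply/funext => x; rewrite /z /=; ring.
    apply: (ae_norm2 mT); [exact: L2B|exact: L2B|].
    exact: (ae_comp2 (fun a b => a - b) ag (@ae_refl _ _ _)).
  exact: norm2B.
have l0 : 0 <= lap_norm T (phi \- phih) by exact: norm2_ge0.
have v0 := norm2_ge0 (cell T) (u \- uh).
have h2 := sqr_ge0 (hT T).
rewrite /eta2 => H; apply: le_trans (ler_wpM2l h2 n2) _.
have := ler_wpM2l h2 n1; have := mulr_ge0 h2 v0.
move: H; rewrite !mulrDr; set A := hT T ^+ 2 * norm2 (cell T) z.
set B := hT T ^+ 2 * osc T ud; set D := hT T ^+ 2 * norm2 (cell T) (u \- uh).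
set E := hT T ^+ 2 * norm2 (cell T) (u \- ud \- z); set L := lap_norm _ _ in l0 *.
move=> H D0 EB; have := ler_wpM2l (ltW C0) EB; rewrite mulrDr => H'.
by rewrite !mulrDl !mul1r; lra.
Qed.

End ElementEstimates.

(** * Geometry around an interior edge *)

Section EdgeGeometry.
Variables (R : realType) (Om : set (plane R)) (M : mesh R) (kappa : R).
Hypotheses (pO : polygonal_domain Om) (tM : is_triangulation M Om).
Hypotheses (k0 : 0 < kappa) (sM : shape_regular M kappa).
Local Notation I := ('I_(nvert M)).
Local Notation V := (@vert R M).
Implicit Types (T : {set I}) (e : I * I) (x n m : plane R) (F g psi w ph G : plane R -> R).

Let oO : open Om. Proof. by case: pO. Qed.
Let bO : bounded_set Om. Proof. by case: pO. Qed.
Let rO : interior (closure Om) = Om. Proof. by case: pO => _ _ _ _ []. Qed.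
Let mO : measurable Om := open_plane_measurable oO.

(** Along [e] the barycentric coordinate of one of its end points grows from 0 to
    1, with slope at most [kappa / (2 * hT T)]. *)
Lemma hT_le_elen e T : e \in edges M -> T \in edge_triangles e -> hT T * 2 <= kappa * elen e.
Proof.
move=> eE TE; have [tT [k [k1 k2 Tk D0 hE]]] := edge_geometry tM eE TE.
have r0 : 0 < hT T / kappa by rewrite divr_gt0// (hT_gt0 bO rO tM).
have [c cT] := sM tT; rewrite hE in cT.
set A := V e.1 in D0 hE cT *; set B := V e.2 in D0 hE cT *; set P := V k in D0 hE cT *.
have D2 : cross (A - P) (B - P) != 0 by rewrite (cross_rot B P A) (cross_rot A B P).
have rotT : tri A B P = tri P A B by apply/seteqP; split=> y [] *; split.
rewrite rotT in cT; have := bary_lipschitz (B - A) r0 D2 cT.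
have -> : cross (A - P) (B - A) = cross (A - P) (B - P) by rewrite !vecE /cross /=; ring.
rewrite divff// normr1 mul1r -/(edist B A) edistC mulrA ler_pdivrMr//.
by rewrite mulrC [leRHS]mulrC.
Qed.

(** A nonzero linear form does not attain its maximum over a set at an interior
    point. *)
Lemma cell_side e T x : e \in edges M -> T \in edge_triangles e -> cell T x ->
  dot (outward_normal T e) (x - midpoint e) < 0.
Proof.
move=> eE TE cx; have [nn _] := outward_normal_dot tM eE TE.
move: nn (@hull_side R Om M tM e T) ; set n := outward_normal T e => nn side.
have /nbhs_planeP[eps eps0 H] : nbhs x (hull T) := cx.
have n1 : `|n.1| <= 1 /\ `|n.2| <= 1.
  have n12 : n.1 ^+ 2 + n.2 ^+ 2 = 1 by rewrite !expr2.
  by split; rewrite -(@ler_sqr R) ?nnegrE// expr1n real_normK ?num_real//;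
    have := sqr_ge0 n.1; have := sqr_ge0 n.2; lra.
have le (a : R) : `|a| <= 1 -> `|eps / 2 * a| < eps.
  move=> a1; rewrite normrM gtr0_norm ?divr_gt0//.
  apply: (@le_lt_trans _ _ (eps / 2)); last by lra.
  by rewrite -[leRHS]mulr1; apply: ler_wpM2l => //; rewrite divr_ge0// ltW.
have hz : hull T (x + (eps / 2) *: n).
  by apply: H; rewrite !vecE /= addrAC subrr add0r; apply: le; case: n1.
have := side _ eE TE hz.
have -> : dot n (x + (eps / 2) *: n - midpoint e) = dot n (x - midpoint e) + eps / 2 * dot n n.
  by rewrite !vecE /dot /=; ring.
by rewrite nn; lra.
Qed.

Lemma interior_edge_triangles e : e \in interior_edges M ->
  let T1 := nth finset.set0 (enum (edge_triangles e)) 0 in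
  let T2 := nth finset.set0 (enum (edge_triangles e)) 1 in
  [/\ e \in edges M, T1 \in edge_triangles e, T2 \in edge_triangles e, T1 != T2 &
    edge_triangles e = [set T1; T2]%SET].
Proof.
rewrite inE => /andP[eE /eqP card2] T1 T2.
have s2 : size (enum (edge_triangles e)) = 2 by rewrite -cardE.
have TE1 : T1 \in edge_triangles e by rewrite -mem_enum mem_nth// s2.
have TE2 : T2 \in edge_triangles e by rewrite -mem_enum mem_nth// s2.
have T12 : T1 != T2 by rewrite nth_uniq// ?s2// enum_uniq.
split=> //; apply/esym/eqP; rewrite eqEcard card2 cards2 T12 andbT.
by apply/fintype.subsetP => T; rewrite in_set2 => /orP[|] /eqP ->.
Qed.

(** In the coordinates of an orthonormal frame the line is a coordinate axis. *)
Lemma line_null n m : dot n n = 1 -> leb2 R [set x | dot n (x - m) = 0] = 0%E.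
Proof.
move=> nn; pose N := [set x | dot n (x - m) = 0].
pose Z : set (plane R) := [set 0] `*` [set: R].
have mZ : measurable (Z : set (measurableTypeR R * measurableTypeR R)%type).
  by apply: measurableX => //; exact: measurable_set1.
have Z0 : leb2 R Z = 0%E.
  transitivity (leb1 R [set 0%R : R] * leb1 R [set: R])%E.
    by apply: product_measure1E => //; exact: measurable_set1.
  by rewrite lebesgue_measure_set1 mul0e.
pose f (x : plane R) : \bar R := (\1_Z x)%:E.
have mf : measurable_fun (setT : set (measurableTypeR R * measurableTypeR R)%type) f.
  by apply/measurable_EFinP; exact: measurable_indic.
have f0 x : (0 <= f x)%E by rewrite lee_fin.
have D : n.1 * n.1 - n.2 * - n.2 = 1 by rewrite mulrN opprK.
have D0 : n.1 * n.1 - n.2 * - n.2 != 0 by rewrite D oner_neq0.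
have := ge0_integral_affine2 (- dot n m) 0 D0 mf f0.
have ind (A : set (plane R)) : measurable (A : set (measurableTypeR R * measurableTypeR R)%type) ->
    (\int[leb2 R]_x (\1_A x)%:E = leb2 R A)%E.
  by move=> mA; rewrite (@integral_indic _ _ _ (leb2 R) setT measurableT A mA) setIT.
rewrite D normr1 invr1 mul1e /f ind// Z0.
have mN : measurable (N : set (measurableTypeR R * measurableTypeR R)%type).
  have cN : closed N.
    apply: (closed_comp _ (@closed_eq R 0)) => x _; apply: cvgD; apply: cvgM;
      (try exact: cvg_cst); apply: cvgB; (exact: cvg_cst || exact: cvg_fst || exact: cvg_snd).
  by have := measurableC (open_plane_measurable (closed_openC cN)); rewrite setCK.
rewrite (_ : (\int[leb2 R]_x _)%E = (\int[leb2 R]_x (\1_N x)%:E)%E); first by rewrite ind.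
apply: eq_integral => x _; rewrite !indicE; congr ((_ : bool)%:R%:E).
apply/idP/idP; rewrite !inE /N /Z /= /dot !vecE /=.
  by move=> [h _]; rewrite -h; ring.
by move=> h; split=> //; rewrite -h; ring.
Qed.

(** The disc of radius [elen e / kappa] around the midpoint consists of two half
    discs, one in each triangle, and of a diameter, which is a null set. *)
Lemma inner_split e T1 T2 F g : e \in edges M -> T1 \in edge_triangles e ->
  T2 \in edge_triangles e -> T1 != T2 -> L2 Om F -> L2 Om g ->
  (forall x, elen e / kappa <= edist x (midpoint e) -> g x = 0) ->
  inner Om F g = inner (cell T1) F g + inner (cell T2) F g.
Proof.
move=> eE TE1 TE2 T12 LF Lg g0.
have [t1 _] := edge_geometry tM eE TE1; have [t2 _] := edge_geometry tM eE TE2.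
have m1 : measurable (cell T1) := open_plane_measurable (@open_cell R M T1).
have m2 : measurable (cell T2) := open_plane_measurable (@open_cell R M T2).
have O1 := @cell_sub R Om M rO tM T1 t1; have O2 := @cell_sub R Om M rO tM T2 t2.
have opp := opposite_normals bO rO tM k0 sM eE TE1 TE2 T12.
pose n := outward_normal T1 e; pose m := midpoint e.
have dN x : dot (outward_normal T2 e) (x - m) = - dot n (x - m).
  by rewrite opp -/n !vecE /dot /=; ring.
pose U := cell T1 `|` cell T2.
have mU : measurable U by exact: measurableU.
have UO : U `<=` Om by move=> x [/O1|/O2].
have dis : [disjoint cell T1 & cell T2].
  apply/disj_setPS => x [/(cell_side eE TE1) h1 /(cell_side eE TE2)].
  by move: h1; rewrite -/n -/m dN oppr_lt0 => /lt_trans h /h; rewrite ltxx.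
have ig : (leb2 R).-integrable Om (EFin \o (fun x => F x * g x)) := L2_integrableM mO LF Lg.
have mD : measurable (Om `\` U) by exact: measurableD.
have OE : Om = U `|` (Om `\` U) by rewrite setUDr setDv setD0 setUC; apply/seteqP; split=> [x|x []]; [left|exact|exact: UO].
have E1 : inner Om F g = inner U F g + inner (Om `\` U) F g.
  rewrite /inner {1}OE; apply: (@Rintegral_setU _ _ _ (leb2 R)) => //; first by rewrite -OE.
  by apply/disj_setPS => x [? []].
have E2 : inner U F g = inner (cell T1) F g + inner (cell T2) F g.
  apply: (@Rintegral_setU _ _ _ (leb2 R)) => //.
  exact: (@integrableS _ _ _ (leb2 R) _ _ _ mO mU UO ig).
suff E3 : inner (Om `\` U) F g = 0 by rewrite E1 E2 E3 addr0.
have D1 : Om `\` U `<=` Om by move=> x [].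
have LFD := L2S mD mO D1 LF; have LgD := L2S mD mO D1 Lg.
have L0 : L2 (Om `\` U) (cst 0) by exact: (@L20 _ (Om `\` U)).
have nn := (outward_normal_dot tM eE TE1).1.
have ae0 : ae_eq_on (Om `\` U) g (cst 0).
  exists [set x | dot n (x - m) = 0]; split; [| exact: line_null|].
    have cN : closed [set x | dot n (x - m) = 0].
      apply: (closed_comp _ (@closed_eq R 0)) => x _; apply: cvgD; apply: cvgM;
        (try exact: cvg_cst); apply: cvgB; (exact: cvg_cst || exact: cvg_fst || exact: cvg_snd).
    by have := measurableC (open_plane_measurable (closed_openC cN)); rewrite setCK.
  move=> x /= nx; apply: contrapT => dn; apply: nx => -[Ox nU].
  have [|xm] := leP (elen e / kappa) (edist x (midpoint e)); first exact: g0.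
  exfalso; apply: nU; have [d1|d1|d1] := ltgtP (dot n (x - m)) 0; last by [].
    by left; exact: (half_disc_cell bO rO tM k0 sM eE TE1).
  by right; apply: (half_disc_cell bO rO tM k0 sM eE TE2) => //; rewrite -/m dN oppr_lt0.
rewrite (ae_inner mD LFD LFD LgD L0 (@ae_refl _ _ _) ae0).
by rewrite /inner /Rintegral integral0_eq// => x _; rewrite mulr0.
Qed.

End EdgeGeometry.

(** * Edge residuals *)

Section HalfPlane.
Variable R : realType.
Implicit Types (a b f : R -> R) (m n x : plane R) (r : R).

Lemma half_line_integrable f : bump f ->
  (leb1 R).-integrable setT (EFin \o (fun s : R => (s < 0)%R%:R * f s)).
Proof.
move=> bf; have i0 := bump_integrable bf.
have i1 : (leb1 R).-integrable `]-oo, 0%R[ (EFin \o f).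
  exact: (@integrableS _ _ _ (leb1 R) _ _ _ measurableT (measurable_itv _) (@subsetT _ _) i0).
rewrite (_ : EFin \o _ = (EFin \o f) \_ `]-oo, 0%R[%classic).
  exact: (@integrable_mkcond _ _ _ (leb1 R) _ (EFin \o f) (measurable_itv _)).1.
apply/funext => s; rewrite patchE /= mem_setE in_itv/=.
by case: (s < 0); rewrite ?mul1r ?mul0r.
Qed.

Lemma half_line_derive f : bump f -> tot1 (fun s : R => (s < 0)%R%:R * derive1 f s) = f 0.
Proof.
move=> bf; have bf' := bump_derive bf.
have mf' : measurable_fun setT (derive1 f) by apply: continuous_measurable_fun; exact: bump_continuous.
have ab : (-2 : R) < 0 by lra.
have := FTC_line ab (smooth1_is_derive bf.1) (bump_continuous bf').
have -> : f (-2) = 0 by apply: bf.2; rewrite normrN ger0_norm//; lra.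
rewrite subr0 -integral_itv_bndo_bndc; last by apply/measurable_EFinP; exact: measurable_funS mf'.
move=> H; rewrite /tot1 /Rintegral -[RHS]/(fine (f 0)%:E) -H; congr fine.
rewrite [RHS]integral_mkcond; apply: eq_integral => s _; rewrite patchE mem_setE in_itv/=.
have [s2|s2] := leP (-2) s; first by case: (s < 0); rewrite ?mul1r ?mul0r.
rewrite (_ : derive1 f s = 0) ?mulr0//; apply: bf'.2.
by rewrite ltr0_norm; lra.
Qed.

(** Green's formula for the half-plane: in the frame coordinates the normal
    derivative on the boundary line is [derive1 a 0 * b t]; the factor [r ^+ 2] of
    the change of variables cancels that of the Laplacian. *)
Lemma half_plane_lap m n r a b : 0 < r -> dot n n = 1 -> bump a -> bump b ->
  tot2 (fun x => (dot n (x - m) < 0)%R%:R * lap (tens m n r a b) x) = derive1 a 0 * tot1 b.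
Proof.
move=> r0 nn ba bb; have rn : r != 0 by rewrite gt_eqF.
have ba' := bump_derive ba; have ba'' := bump_derive ba'.
have bb' := bump_derive bb; have bb'' := bump_derive bb'.
have [i1 e1] := tensor_integral (half_line_integrable ba'') (bump_integrable bb).
have [i2 e2] := tensor_integral (half_line_integrable ba) (bump_integrable bb'').
have i12 := integrableD measurableT i1 i2.
have := @RintegralD _ _ _ (leb2 R) _ _ _ measurableT i1 i2.
rewrite -/(tot2 _) -/(tot2 _) -/(tot2 _) e1 e2 (half_line_derive ba') (tot1_derive bb') mulr0 addr0 => e12.
have [_] := integral_frame m r0 nn i12; rewrite [X in _ = _ * X]e12 => H.
apply: (mulfI (lt0r_neq0 (exprn_gt0 2 r0))); rewrite -H.
have iF := (integral_frame m r0 nn i12).1.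
have -> : (fun x => (dot n (x - m) < 0)%R%:R * lap (tens m n r a b) x) =
   (fun x => (r ^+ 2)^-1 * ((fun y : plane R => (y.1 < 0)%R%:R * derive1 (derive1 a) y.1 * b y.2 +
      (y.1 < 0)%R%:R * a y.1 * derive1 (derive1 b) y.2) \o frame m n r) x).
  apply/funext => x; rewrite (lap_tens _ _ rn nn ba.1 bb.1) /=.
  have -> : (dot n (x - m) / r < 0) = (dot n (x - m) < 0) by rewrite pmulr_llt0// invr_gt0.
  rewrite /tens /=.
  move: (derive1 (derive1 a) _) (b _) (a _) (derive1 (derive1 b) _) ((dot n (x - m) < 0)%R%:R) (r ^- 2).
  by move=> *; ring.
rewrite /tot2 (@RintegralZl _ _ _ (leb2 R) _ _ (r ^+ 2)^-1 measurableT iF).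
by rewrite mulrA mulfV ?mul1r// expf_neq0.
Qed.

End HalfPlane.

Lemma seg_nrm_cst (R : realType) (k : R) : nrm (leb1 R) `[0, 1] (cst k) = `|k|.
Proof.
rewrite /nrm /dotp /Rintegral (_ : (\int[leb1 R]_(t in _) _)%E = (k * k)%:E).
  by rewrite -expr2 sqrtr_sqr.
rewrite (eq_integral (cst (k * k)%:E))// integral_cst//= lebesgue_measure_itv/= lte_fin ltr01.
by rewrite -EFinD subr0 mule1.
Qed.

(** Let [psi] be a test function supported in the disc around the midpoint of the
    edge, and [K] the integral of its Laplacian over the first triangle. The
    integral over the second one is [- K], so that pairing [lap psi] with the
    piecewise constant Laplacian of [ph] yields [K] times the jump. The rest is
    the weak equation of [w] and the Cauchy-Schwarz inequality, with [psi] of order 1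
    and [lap psi] of order [elen e ^- 2]. *)
Lemma edge_residual (R : realType) (kappa : R) : 0 < kappa -> exists2 C : R, 0 < C &
  forall Om (M : mesh R), polygonal_domain Om -> is_triangulation M Om -> shape_regular M kappa ->
  forall w ph G (e : 'I_(nvert M) * 'I_(nvert M)), H2 Om w -> L2 Om ph -> piecewise_P2 M ph ->
  weak_biharmonic Om w G -> L2 Om G -> e \in interior_edges M ->
  eta_lap ph e <= C * \sum_(T in edge_triangles e)
    (lap_norm T (w \- ph) + hT T ^+ 2 * norm2 (cell T) G).
Proof.
(* [K] is the slope at the origin of the profile [a] across the edge times the
   integral of the profile [b] along it: the factor [t] in [a] makes it nonzero. *)
move=> k0; pose b := @hat R; pose a := (fun t : R => t) \* b.
have bb : bump b := @bump_hat R.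
have ba : bump a by apply: bumpM => //; exact: smooth1_id.
pose K := derive1 a 0 * tot1 b.
have K0 : 0 < K.
  rewrite mulr_gt0 ?tot1_hat//.
  have := is_deriveM (is_derive_id (0 : R) (1 : R)) (smooth1_is_derive bb.1 (0 : R)).
  move=> /(@derive_val _ _ _ _ _ _ _); rewrite -derive1E => ->.
  by rewrite /= scale0r add0r -[_ *: _]/(_ * _) mulr1 hat_gt0//; lra.
have [sa sa0 Ha] := bump_bounded ba; have [sb sb0 Hb] := bump_bounded bb.
have [sa2 sa20 Ha2] := bump_bounded (bump_derive (bump_derive ba)).
have [sb2 sb20 Hb2] := bump_bounded (bump_derive (bump_derive bb)).
pose S := sa * sb; pose S2 := sa2 * sb + sa * sb2.
have S0 : 0 <= S by exact: mulr_ge0.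
have S20 : 0 <= S2 by rewrite addr_ge0// mulr_ge0.
pose C1 := 4 * kappa ^+ 3 * S2.
have C10 : 0 <= C1 by rewrite mulr_ge0// mulr_ge0// exprn_ge0// ltW.
have kS : 0 <= 2 * S by rewrite mulr_ge0.
exists ((1 + C1 + 2 * S) / K); first by rewrite divr_gt0// -addrA ltr_pwDl// addr_ge0.
move=> Om M pO tM sM w ph G e Hw Lp pp wG LG eI.
have [oO _ _ bO [rO _]] := pO; have mO := open_plane_measurable oO.
have [eE TE1 TE2 T12 TE] := interior_edge_triangles eI.
rewrite /eta_lap /jump_lap.
set T1 := nth _ _ 0 in TE1 TE2 T12 TE *; set T2 := nth _ _ 1 in TE2 T12 TE *.
have [t1 _] := edge_geometry tM eE TE1; have [t2 _] := edge_geometry tM eE TE2.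
have AB := edge_vert_neq tM eE; have l0 : 0 < elen e by rewrite edist_gt0.
set l := elen e in l0 *; pose m := midpoint e; pose n := outward_normal T1 e.
have nn : dot n n = 1 := (outward_normal_dot tM eE TE1).1.
have n2 x : dot (outward_normal T2 e) (x - m) = - dot n (x - m).
  by rewrite (opposite_normals bO rO tM k0 sM eE TE1 TE2 T12) -/n !vecE /dot /=; ring.
(* The square of half side [r] is then inside the disc of radius [l / kappa]. *)
pose r := l / (2 * kappa).
have r0 : 0 < r by rewrite divr_gt0// mulr_gt0.
have rn : r != 0 by rewrite gt_eqF.
have r2 : 2 * r = l / kappa by rewrite /r; field; rewrite gt_eqF.
have disc x : edist x m < 2 * r -> Om x.
  rewrite r2 => xm; rewrite -rO /interior.
  apply: (@filterS _ _ _ [set y | edist y m < l / kappa]); last first.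
    exact: (open_nbhs_nbhs (conj (@edist_cst_open _ m _) xm)).
  move=> y /= ym; have [d0|d0] := leP (dot n (y - m)) 0.
    by apply: (hull_sub tM t1); apply: (half_disc bO rO tM k0 sM eE TE1) => //; exact: ltW.
  apply: (hull_sub tM t2); apply: (half_disc bO rO tM k0 sM eE TE2); first exact: ltW.
  by rewrite -/m n2 oppr_le0 ltW.
pose psi := tens m n r a b.
have tp : test_function Om psi by exact: test_tens.
have Lpsi := test_L2 mO tp; have Llap := L2_lap_test mO tp.
have far x : l / kappa <= edist x m -> 2 * r ^+ 2 < dot (x - m) (x - m).
  move=> xm; rewrite -edist_sqr; apply: (@lt_le_trans _ _ ((2 * r) ^+ 2)).
    have rr : 0 < r ^+ 2 by rewrite exprn_gt0.
    by have -> : (2 * r) ^+ 2 = 4 * r ^+ 2; [ring|lra].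
  by rewrite r2 ler_sqr ?nnegrE ?edist_ge0// divr_ge0// ltW.
have out x : l / kappa <= edist x m -> psi x = 0 by move=> /far h; exact: tens_out h.
have outl x : l / kappa <= edist x m -> lap psi x = 0.
  move=> /far h; rewrite (lap_tens _ _ rn nn ba.1 bb.1).
  rewrite (tens_out r0 nn (bump_derive (bump_derive ba)) bb h).
  by rewrite (tens_out r0 nn ba (bump_derive (bump_derive bb)) h) addr0 mulr0.
have m1 : measurable (cell T1) := open_plane_measurable (@open_cell R M T1).
have m2 : measurable (cell T2) := open_plane_measurable (@open_cell R M T2).
have O1 := @cell_sub R Om M rO tM T1 t1; have O2 := @cell_sub R Om M rO tM T2 t2.
have split2 F g LF Lg g0 := @inner_split R Om M kappa pO tM k0 sM e T1 T2 F g eE TE1 TE2 T12 LF Lg g0.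
have Lone (O : set (plane R)) : bounded_set O -> measurable O -> L2 O (cst (1 : R)).
  by move=> bO' mO'; apply: L2_continuous => // x; exact: cvg_cst.
have I1 : inner (cell T1) (cst 1) (lap psi) = K.
  apply: etrans (half_plane_lap m r0 nn ba bb); rewrite /inner Rintegral_mkcond /tot2.
  apply: eq_Rintegral => x _; rewrite patchE; case: ifPn => [|] xT.
    by rewrite (cell_side tM eE TE1 (set_mem xT)).
  have [d0|d0] := ltP (dot n (x - m)) 0; last by rewrite mul0r.
  rewrite -[tens _ _ _ _ _]/psi outl ?mulr0// leNgt; apply: contra xT => xm; apply: mem_set.
  exact: (half_disc_cell bO rO tM k0 sM eE TE1).
have I2 : inner (cell T2) (cst 1) (lap psi) = - K.
  have := split2 _ _ (Lone _ bO mO) Llap outl.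
  by rewrite inner_cst_lap// I1 => /eqP; rewrite eq_sym addrC addr_eq0 => /eqP.
have [_ Lw] := wlap_ae oO (H2_whess Hw).
have local T c : T \in triangles M -> ae_eq_on (cell T) (wlap (cell T) (w \- ph)) (wlap Om w \- cst c) ->
    L2 (cell T) (wlap (cell T) (w \- ph)) ->
    inner (cell T) (wlap (cell T) (w \- ph)) (lap psi) =
    inner (cell T) (wlap Om w) (lap psi) - c * inner (cell T) (cst 1) (lap psi).
  move=> tT aT LT; have mT : measurable (cell T) := open_plane_measurable (@open_cell R M T).
  have TO := @cell_sub R Om M rO tM T tT; have bT := @bounded_cell R Om M bO rO tM T tT.
  have LwT := L2S mT mO TO Lw; have LlT := L2S mT mO TO Llap.
  have L1 := Lone _ bT mT.
  have Lc : L2 (cell T) (cst c) by apply: L2_continuous => // x; exact: cvg_cst.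
  rewrite (ae_inner mT LT (L2B mT LwT Lc) LlT LlT aT (@ae_refl _ _ _)) (innerBl mT)//.
  rewrite -(innerZl mT c L1 LlT); congr (_ - _); apply: eq_inner => x _ //=.
  by rewrite mulr1.
have [c1 [p1 Lp1 d1 Ld1]] := quadratic_wlap pO tM Hw Lp pp t1.
have [c2 [p2 Lp2 d2 Ld2]] := quadratic_wlap pO tM Hw Lp pp t2.
(* The constants [c1] and [c2] are paired with [K] and [- K], and the weak equation
   turns the pairing with the Laplacian of [w] into one with [G]. *)
have main : K * (c1 - c2) = inner (cell T1) G psi + inner (cell T2) G psi -
    (inner (cell T1) (wlap (cell T1) (w \- ph)) (lap psi) +
     inner (cell T2) (wlap (cell T2) (w \- ph)) (lap psi)).
  rewrite (local _ _ t1 d1 Ld1) (local _ _ t2 d2 Ld2) I1 I2.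
  rewrite -(split2 _ _ LG Lpsi out) -(wG _ tp) (split2 _ _ Lw Llap outl).
  by ring.
have jump : enorm e (fun x => etrace T1 e (wlap (cell T1) ph) x - etrace T2 e (wlap (cell T2) ph) x) =
    Num.sqrt l * `|c1 - c2|.
  have tr T c : T \in edge_triangles e -> T \in triangles M ->
      ae_eq_on (cell T) (wlap (cell T) ph) (cst c) -> L2 (cell T) (wlap (cell T) ph) ->
      seg_L2 (vert e.1) (vert e.2) (etrace T e (wlap (cell T) ph)) /\
      ae_eq (leb1 R) `[0%R, 1%R]%classic (etrace T e (wlap (cell T) ph) \o param (vert e.1) (vert e.2))
        (cst c \o param (vert e.1) (vert e.2)).
    move=> TT tT aT LT; have oT := @open_cell R M T; have mT := open_plane_measurable oT.
    have bT := @bounded_cell R Om M bO rO tM T tT.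
    have wc := wgrad_C1 mT bT (@smooth_cst R c 1%N).
    have trc := is_trace_ae oT bT AB wc LT (ae_sym aT) (is_trace_smooth oT bT AB (@smooth_cst R c)).
    have wT := wgrad_ae mT wc LT (fun i => (wc i).2.1) (ae_sym aT) (fun i => @ae_refl _ _ _).
    exact: (trace_ae oT bT AB (trace_domain_cell tM eE TT) wT trc).
  have [s1 e1] := tr _ _ TE1 t1 p1 Lp1; have [s2 e2] := tr _ _ TE2 t2 p2 Lp2.
  rewrite /enorm seg_normE; congr (_ * _).
  have sc : sqint (leb1 R) `[0, 1] (cst (c1 - c2)).
    have sd := sqint_param (vert e.1) (vert e.2) (smooth_continuous (@smooth_cst R (c1 - c2))).
    exact: sd.
  transitivity (nrm (leb1 R) `[0, 1] (cst (c1 - c2))).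
    apply: seg_nrm_ae (seg_sqintB s1 s2) sc _.
    exact: (ae_eq_comp2 (fun a b => a - b) e1 e2).
  exact: seg_nrm_cst.
have bound T : T \in edge_triangles e ->
    l * (`|inner (cell T) G psi| + `|inner (cell T) (wlap (cell T) (w \- ph)) (lap psi)|) <=
    (1 + C1 + 2 * S) * (lap_norm T (w \- ph) + hT T ^+ 2 * norm2 (cell T) G).
  move=> TT; have [tT _] := edge_geometry tM eE TT.
  have mT : measurable (cell T) := open_plane_measurable (@open_cell R M T).
  have TO := @cell_sub R Om M rO tM T tT.
  have [c [_ _ _ LT]] := quadratic_wlap pO tM Hw Lp pp tT.
  have LGT := L2S mT mO TO LG; have LpT := L2S mT mO TO Lpsi; have LlT := L2S mT mO TO Llap.
  have h0 := hT_gt0 bO rO tM tT; have lh := elen_le_hT bO rO tM eE TT.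
  have hl := hT_le_elen pO tM k0 sM eE TT; rewrite -/l in lh hl.
  set h := hT T in h0 lh hl *.
  have nG := norm2_ge0 (cell T) G; have nW : 0 <= lap_norm T (w \- ph) by exact: norm2_ge0.
  have rr : 0 < r ^+ 2 by rewrite exprn_gt0.
  have tb a' b' (u v : R) x : (forall t, `|a' t| <= u) -> (forall t, `|b' t| <= v) ->
      `|tens m n r a' b' x| <= u * v.
    by move=> Hu Hv; rewrite normrM; apply: ler_pM.
  have b1 : norm2 (cell T) psi <= S * (2 * h).
    apply: (cell_norm_bounded bO rO tM k0 sM tT) => //; first by apply: smooth_continuous; case: tp.
    by move=> x _; exact: tb.
  have b2 : norm2 (cell T) (lap psi) <= (r ^+ 2)^-1 * S2 * (2 * h).
    apply: (cell_norm_bounded bO rO tM k0 sM tT).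
    - by rewrite mulr_ge0// invr_ge0 ltW.
    - by apply: continuous_lap; case: tp.
    - move=> x _; rewrite (lap_tens _ _ rn nn ba.1 bb.1) normrM ger0_norm ?invr_ge0 ?(ltW rr)//.
      apply: ler_wpM2l; first by rewrite invr_ge0 ltW.
      by apply: le_trans (ler_normD _ _) _; apply: lerD; exact: tb.
  have h1 : `|inner (cell T) G psi| <= norm2 (cell T) G * (S * (2 * h)).
    by apply: le_trans (cauchy_schwarz mT LGT LpT) _; apply: ler_wpM2l.
  have h2 : `|inner (cell T) (wlap (cell T) (w \- ph)) (lap psi)| <=
      lap_norm T (w \- ph) * ((r ^+ 2)^-1 * S2 * (2 * h)).
    by apply: le_trans (cauchy_schwarz mT LT LlT) _; apply: ler_wpM2l.
  have q1 : l * (S * (2 * h)) <= 2 * S * h ^+ 2.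
    rewrite [leLHS](_ : _ = (2 * S) * (l * h)); last by ring.
    by apply: ler_wpM2l => //; rewrite expr2 ler_pM2r.
  have q2 : l * ((r ^+ 2)^-1 * S2 * (2 * h)) <= C1.
    have -> : l * ((r ^+ 2)^-1 * S2 * (2 * h)) = 4 * kappa ^+ 2 * S2 * (h * 2 / l).
      by rewrite /r; field; rewrite !gt_eqF.
    have -> : C1 = 4 * kappa ^+ 2 * S2 * kappa by rewrite /C1; ring.
    apply: ler_wpM2l; last by rewrite ler_pdivrMr.
    by apply: mulr_ge0 => //; apply: mulr_ge0 => //; exact: sqr_ge0.
  rewrite mulrDr; apply: (@le_trans _ _ (2 * S * (h ^+ 2 * norm2 (cell T) G) + C1 * lap_norm T (w \- ph))).
    apply: lerD.
      apply: le_trans (ler_wpM2l (ltW l0) h1) _.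
      rewrite mulrCA [leRHS]mulrA [leRHS]mulrC; exact: ler_wpM2l.
    apply: le_trans (ler_wpM2l (ltW l0) h2) _.
    by rewrite mulrCA [leRHS]mulrC; exact: ler_wpM2l.
  have hG : 0 <= h ^+ 2 * norm2 (cell T) G by rewrite mulr_ge0// sqr_ge0.
  move: (h ^+ 2 * norm2 (cell T) G) hG (lap_norm T (w \- ph)) nW => x x0 y y0.
  have -> : (1 + C1 + 2 * S) * (y + x) = (2 * S * x + C1 * y) + (y + x + (C1 * x + 2 * S * y)).
    by ring.
  by rewrite lerDl; apply: addr_ge0; apply: addr_ge0 => //; exact: mulr_ge0.
rewrite -/l jump mulrA -expr2 sqr_sqrtr ?(ltW l0)//.
rewrite mulrAC ler_pdivlMr// TE big_setU1 ?inE//= big_set1 mulrDr.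
apply: le_trans (lerD (bound _ TE1) (bound _ TE2)).
rewrite -mulrDr -mulrA; apply: ler_wpM2l; first exact: ltW.
rewrite mulrC -{1}(gtr0_norm K0) -normrM main.
apply: le_trans (ler_normB _ _) _; rewrite addrACA.
by apply: lerD; exact: ler_normD.
Qed.

(** * The local efficiency estimates *)

Theorem theorem6p3 (R : realType) (Omega : set (plane R))
    (hOmega : polygonal_domain Omega)
    (alpha : R) (halpha : 0 < alpha)
    (f ud : plane R -> R) (hf : L2 Omega f) (hud : L2 Omega ud)
    (q u phi : plane R -> R)
    (hq : Qspace Omega q) (hu : Qspace Omega u) (hphi : Vspace Omega phi)
    (hopt : optimal_control Omega alpha f ud q u)
    (hsys : optimality_system Omega alpha f ud q u phi)
    (F : set (mesh R)) (hF : shape_regular_family Omega F)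
    (sigma : R) (hsigma : 1 <= sigma)
    (hcoer : coercive_bounded Omega F sigma) :
  exists2 C : R, 0 < C &
    forall (M : mesh R) (qh uh phih : plane R -> R),
      F M -> Qh M Omega qh -> Qh M Omega uh -> Vh M Omega phih ->
      discrete_system M Omega alpha sigma f ud qh uh phih ->
      [/\ (forall T, T \in triangles M ->
             eta1 f T <= C * (hT T ^+ 2 * osc T f + lap_norm T (u \- uh)) /\
             eta2 uh ud T <= C * (hT T ^+ 2 * osc T ud
                                  + hT T ^+ 2 * norm2 (cell T) (u \- uh)
                                  + lap_norm T (phi \- phih))),
          (forall e, e \in interior_edges M ->
             [/\ eta_lap qh e <=
                   C * \sum_(T in edge_triangles e) lap_norm T (q \- qh),
                 eta_lap uh e <=
                   C * \sum_(T in edge_triangles e)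
                         (lap_norm T (u \- uh)
                          + hT T ^+ 2 * norm2 (cell T) f)
               & eta_lap phih e <=
                   C * \sum_(T in edge_triangles e)
                         (lap_norm T (phi \- phih)
                          + hT T ^+ 2 * norm2 (cell T) (u \- uh)
                          + hT T ^+ 2 * osc T ud)])
        & (forall e, e \in edges M ->
             [/\ eta_dn qh e <= C * hnorm M sigma (q \- qh),
                 eta_dn uh e <= C * hnorm M sigma (u \- uh)
               & eta_dn phih e <= C * hnorm M sigma (phi \- phih)])].
Proof.
have [oO _ _ bO [rO _]] := hOmega; have mO := open_plane_measurable oO.
have [kappa k0 HF] := hF.
have [C1 C10 H1] := eta1_estimate k0.
have [C2 C20 H2] := eta2_estimate k0.
have [C3 C30 H3] := edge_residual k0.
have Hu := hu.1; have Hq := hq.1; have Hphi := hphi.1.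
have Lu : L2 Omega u := Hu.1.1.
have [wu wphi wq] := hsys.
have weakV : forall w, Vspace Omega w -> abil Omega u w = inner Omega f w.
  by case: hopt => _ [].
have bu : weak_biharmonic Omega u f by exact: weak_biharmonicP.
have bphi : weak_biharmonic Omega phi (u \- ud) by exact: weak_biharmonicP.
(* On V the right-hand side of the control equation vanishes by the adjoint
   equation: the control is weakly biharmonic. *)
have bq : weak_biharmonic Omega q (cst 0).
  apply: weak_biharmonicP => // v Vv.
  have := wq v (Vspace_Qspace oO bO Vv).
  have -> : abil Omega v phi = abil Omega phi v by exact: innerC.
  rewrite wphi// subrr => /eqP; rewrite mulf_eq0 gt_eqF//= => /eqP ->.
  by rewrite /inner /Rintegral integral0_eq// => x _; rewrite mul0r.
have Ld := L2B mO Lu hud.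
pose C := 1 + C1 + C2 + C3 * (1 + C2).
have C0 : 0 < C by rewrite !addr_gt0// mulr_gt0// addr_gt0.
have C32 : C3 <= C3 * (1 + C2) by rewrite ler_peMr// ?(ltW C30)// lerDl ltW.
have [CC1 CC2 CC3 CC4] : [/\ 1 <= C, C1 <= C, C2 <= C & C3 * (1 + C2) <= C].
  by rewrite /C; split; lra.
exists C => // M qh uh phih FM Hqh Huh Hphih _.
have [tM sM] := HF _ FM.
have Lqh : L2 Omega qh := Hqh.1.1; have Luh : L2 Omega uh := Huh.1.1.
have Lphih : L2 Omega phih := Hphih.1.1.1.
have pqh := Hqh.2; have puh := Huh.2; have pphih := Hphih.2.
have up (c X Y : R) : c <= C -> 0 <= Y -> X <= c * Y -> X <= C * Y.
  by move=> cC Y0 XY; apply: le_trans XY _; exact: ler_wpM2r.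
have l0 (T : {set 'I_(nvert M)}) v : 0 <= lap_norm T v :> R by exact: norm2_ge0.
have hn (T : {set 'I_(nvert M)}) (g : plane R -> R) : 0 <= hT T ^+ 2 * norm2 (cell T) g.
  by rewrite mulr_ge0 ?sqr_ge0// norm2_ge0.
have ho (T : {set 'I_(nvert M)}) (g : plane R -> R) : 0 <= hT T ^+ 2 * osc T g by exact: hn.
have E2 T : T \in triangles M -> eta2 uh ud T <= C2 * (hT T ^+ 2 * osc T ud
    + hT T ^+ 2 * norm2 (cell T) (u \- uh) + lap_norm T (phi \- phih)).
  by move=> tT; exact: (H2 Omega).
split.
- move=> T tT; split.
    apply: (up C1) => //; first by rewrite addr_ge0.
    exact: (H1 Omega).
  by apply: (up C2) => //; [rewrite !addr_ge0|exact: E2].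
- move=> e eI; have [eE _ _ _ _] := interior_edge_triangles eI.
  split.
  + apply: (up C3); [exact: le_trans CC4|by apply: sumr_ge0|].
    have L0 : L2 Omega (cst 0) by exact: (@L20 _ Omega).
    have := H3 Omega M hOmega tM sM q qh (cst 0) e Hq Lqh pqh bq L0 eI.
    move=> /le_trans; apply; rewrite ler_pM2l//; apply: ler_sum => T _.
    have -> : norm2 (cell T) (cst 0) = 0 :> R.
      by rewrite /norm2 /inner /Rintegral integral0_eq ?sqrtr0// => x _; rewrite mulr0.
    by rewrite mulr0 addr0.
  + apply: (up C3); [exact: le_trans CC4|by apply: sumr_ge0 => T _; rewrite addr_ge0|].
    exact: (H3 Omega).
  + apply: (up (C3 * (1 + C2))) => //; first by apply: sumr_ge0 => T _; rewrite !addr_ge0.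
    apply: le_trans (H3 Omega M hOmega tM sM phi phih (u \- ud) e Hphi Lphih pphih bphi Ld eI) _.
    rewrite -mulrA ler_pM2l// mulr_sumr; apply: ler_sum => T TE.
    have [tT _] := edge_geometry tM eE TE.
    have oT := @open_cell R M T; have mT := open_plane_measurable oT.
    have TO := @cell_sub R Omega M rO tM T tT.
    have LuT := L2S mT mO TO Lu; have LudT := L2S mT mO TO hud; have LuhT := L2S mT mO TO Luh.
    (* The right-hand side of the adjoint equation is split at [uh]; what remains
       is the second estimator. *)
    have tri : norm2 (cell T) (u \- ud) <= norm2 (cell T) (u \- uh) + norm2 (cell T) (uh \- ud).
      have -> : u \- ud = (u \- uh) \+ (uh \- ud) by apply/funext => x /=; ring.
      by apply: (norm2D mT); exact: (L2B mT).
    have := ler_wpM2l (sqr_ge0 (hT T)) tri; rewrite mulrDr.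
    have := E2 _ tT; rewrite /eta2.
    have := hn T (u \- uh); have := ho T ud; have := l0 T (phi \- phih).
    move: (hT T ^+ 2 * norm2 (cell T) (u \- uh)) (hT T ^+ 2 * osc T ud) (lap_norm T (phi \- phih))
      (hT T ^+ 2 * norm2 (cell T) (uh \- ud)) (hT T ^+ 2 * norm2 (cell T) (u \- ud)).
    move=> a b c d x c0 b0 a0 dle xle.
    have -> : (1 + C2) * (c + a + b) = c + a + b + C2 * (b + a + c) by ring.
    by lra.
- move=> e eE.
  have Qphi := Vspace_Qspace oO bO hphi.
  have one v : 0 <= hnorm M sigma v by exact: sqrtr_ge0.
  have e1 p ph : Qspace Omega p -> L2 Omega ph -> piecewise_P2 M ph ->
      eta_dn ph e <= C * hnorm M sigma (p \- ph).
    move=> Qp Lp pp; apply: (up 1) => //; rewrite mul1r.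
    exact: (eta_dn_le hOmega tM k0 sM).
  by split; exact: e1.
Qed.
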